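(* Assume that $V$ is self-adjoint with $|V(x)|\lesssim\langle x\rangle^{-\beta}$ for some $\beta>2$. If $H\psi=0$ (in the sense of distributions) with $\psi\in L^2+\bigcap_{p\in(2,\infty]}L^p$, then $\phi=Uv\psi\in S_1L^2$, i.e. $T\phi=0$.
   Context: Functions are $\mathbb C^2$-valued on $\mathbb R^2$ and $L^p$ means $L^p(\mathbb R^2;\mathbb C^2)$. $D_0=-i\alpha\cdot\nabla=-i(\alpha_1\partial_1+\alpha_2\partial_2)$ with $\alpha_1=\begin{pmatrix}0&1\\1&0\end{pmatrix}$, $\alpha_2=\begin{pmatrix}0&-i\\ i&0\end{pmatrix}$; $V:\mathbb R^2\to\mathbb C^{2\times2}$ is Hermitian matrix valued; $H=D_0+V$. $\langle x\rangle=(1+|x|^2)^{1/2}$, and $|V(x)|\lesssim\langle x\rangle^{-\beta}$ means every entry satisfies this bound with some constant. Diagonalize $V=B^*\,\mathrm{diag}(\zeta_1,\zeta_2)B$ pointwise with $B(x)$ unitary, $\zeta_j(x)\in\mathbb R$; put $\eta_j=|\zeta_j|^{1/2}$, $v=\mathrm{diag}(\eta_1,\eta_2)B$, $U=\mathrm{diag}(\mathrm{sign}\,\zeta_1,\mathrm{sign}\,\zeta_2)$ (with $\mathrm{sign}\,0:=1$), so $V=v^*Uv$. $\mathcal G_{0,0}$ is the integral operator with kernel $\frac{i\alpha\cdot(x-y)}{2\pi|x-y|^2}$, $T=U+v\mathcal G_{0,0}v^*$ on $L^2$, and $S_1$ is the Riesz projection onto $\ker T$. *)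

(* Defs.v *)
From HB Require Import structures.
From mathcomp Require Import all_boot all_order all_algebra.
From mathcomp Require Import complex.
From mathcomp Require Import all_classical all_reals all_analysis.

Set Implicit Arguments.
Unset Strict Implicit.
Unset Printing Implicit Defensive.

Import Order.TTheory GRing.Theory Num.Theory.
Import numFieldNormedType.Exports.

#[global] Open Scope classical_set_scope.
#[global] Open Scope ring_scope.
#[global] Open Scope complex_scope.
#[global] Open Scope sesquilinear_scope.

Notation plane R := (measurableTypeR R * measurableTypeR R)%type.
Notation vec2 R := 'cV[R[i]]_2.
Notation mat2 R := 'M[R[i]]_2.

Section Definitions.
Variable R : realType.
Implicit Types (x y : plane R) (V B : plane R -> mat2 R)
  (zeta : plane R -> 'rV[R]_2) (psi phi : plane R -> vec2 R).

Local Notation mu2 := (@lebesgue_measure R \x @lebesgue_measure R)%E.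

(* Complex functions are handled through their real and imaginary parts; the
   measurable structure on the plane is the Borel one. *)
Definition cmeasurable (f : plane R -> R[i]) : Prop :=
  measurable_fun setT (fun x => complex.Re (f x)) /\
  measurable_fun setT (fun x => complex.Im (f x)).

Definition mxmeasurable m n (A : plane R -> 'M[R[i]]_(m, n)) : Prop :=
  forall i j, cmeasurable (fun x => A x i j).

Definition cintegrable (f : plane R -> R[i]) : Prop :=
  mu2.-integrable setT (fun x => (complex.Re (f x))%:E) /\
  mu2.-integrable setT (fun x => (complex.Im (f x))%:E).

Definition cintegral (f : plane R -> R[i]) : R[i] :=
  (\int[mu2]_(x in setT) complex.Re (f x))%R +i*
  (\int[mu2]_(x in setT) complex.Im (f x))%R.

Definition vintegrable psi : Prop :=
  forall i, cintegrable (fun x => psi x i 0).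

Definition vintegral psi : vec2 R := \col_i cintegral (fun x => psi x i 0).

Definition cabs (z : R[i]) : R := complex.Re `|z|.

Definition vnorm (z : vec2 R) : R := Num.sqrt (\sum_i cabs (z i 0) ^+ 2).

Definition normsq x : R := x.1 ^+ 2 + x.2 ^+ 2.

Definition bracket x : R := Num.sqrt (1 + normsq x).

Definition in_Lp (p : \bar R) psi : Prop :=
  mxmeasurable psi /\ (Lnorm mu2 p (fun x => (vnorm (psi x))%:E) < +oo)%E.

(* Borel representatives can always be adjusted on a null set so that the
   decomposition holds everywhere. *)
Definition in_L2_plus_Lp_gt2 psi : Prop :=
  exists f g : plane R -> vec2 R,
    [/\ in_Lp 2%:E f,
        forall p : \bar R, (2%:E < p)%E -> in_Lp p g &
        forall x, psi x = f x + g x].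

Definition alpha1 : mat2 R := \matrix_(i, j) (i != j)%:R.

Definition alpha2 : mat2 R :=
  \matrix_(i, j) (if (i == 0) && (j == 1) then - 'i
                  else if (i == 1) && (j == 0) then 'i else 0).

Definition alpha_dot x : mat2 R := x.1%:C *: alpha1 + x.2%:C *: alpha2.

Definition decay V (beta : R) : Prop :=
  exists C : R, forall x i j, cabs (V x i j) <= C * (bracket x) `^ (- beta).

Definition partial (k : bool) (f : R * R -> R) (x : R * R) : R :=
  'D_(if k then (0, 1) else (1, 0)) f x.

Definition smooth (f : R * R -> R) : Prop :=
  forall (s : seq bool) x, differentiable (foldr partial f s) x.

Definition test_function (chi : R * R -> R[i]) : Prop :=
  [/\ smooth (fun x => complex.Re (chi x)),
      smooth (fun x => complex.Im (chi x)) &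
      compact (closure [set x : R * R | chi x != 0])].

Definition cpartial (k : bool) (chi : R * R -> R[i]) (x : R * R) : R[i] :=
  partial k (fun y => complex.Re (chi y)) x +i*
  partial k (fun y => complex.Im (chi y)) x.

(* The vector-valued distribution (D_0 + V) psi.  The derivatives in
   D_0 = - i (alpha1 d_1 + alpha2 d_2) are moved onto the scalar test function
   chi, which turns the factor - i into 'i. *)
Definition H_distribution V psi (chi : R * R -> R[i]) : vec2 R :=
  vintegral (fun x =>
    'i *: ((cpartial false chi x *: alpha1 + cpartial true chi x *: alpha2)
             *m psi x)
    + chi x *: (V x *m psi x)).

Definition H_null V psi : Prop :=
  forall chi, test_function chi -> H_distribution V psi chi = 0.

Definition diagonalizes V B zeta : Prop :=
  forall x, B x \is unitarymx /\
    V x = (B x)^t* *m diag_mx (map_mx (real_complex R) (zeta x)) *m B x.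

Definition sign0 (t : R) : R := if t < 0 then -1 else 1.

Definition vfactor B zeta x : mat2 R :=
  diag_mx (\row_j (Num.sqrt `|zeta x 0 j|)%:C) *m B x.

Definition Ufactor zeta x : mat2 R := diag_mx (\row_j (sign0 (zeta x 0 j))%:C).

(* At x = y the value is 0, since division by zero is zero. *)
Definition G00 x y : mat2 R :=
  ('i / (2 * pi * normsq (x - y))%:C) *: alpha_dot (x - y).

Definition T_integrand B zeta phi x y : vec2 R :=
  G00 x y *m ((vfactor B zeta y)^t* *m phi y).

Definition T_op B zeta phi x : vec2 R :=
  Ufactor zeta x *m phi x
  + vfactor B zeta x *m vintegral (T_integrand B zeta phi x).

(* S_1 L^2, the range of the projection S_1 onto ker T.  Since the library
   integral is total, absolute convergence of the integral defining T phi is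
   part of the definition. *)
Definition S1L2 B zeta : set (plane R -> vec2 R) :=
  [set phi | [/\ in_Lp 2%:E phi,
     {ae mu2, forall x, vintegrable (T_integrand B zeta phi x)} &
     {ae mu2, forall x, T_op B zeta phi x = 0}]].

End Definitions.

(* Main.v *)
From HB Require Import structures.
Require Import Defs.
From mathcomp Require Import all_boot all_order all_algebra.
From mathcomp Require Import complex.
From mathcomp Require Import all_classical all_reals all_analysis.
From mathcomp Require Import measurable_realfun.
From mathcomp Require Import ring lra.

Set Implicit Arguments.
Unset Strict Implicit.
Unset Printing Implicit Defensive.

Import Order.TTheory GRing.Theory Num.Theory.
Import numFieldNormedType.Exports.

Local Open Scope ring_scope.

(** Why the theorem is true.  Put U = sign V and v = |V|^(1/2) in the
    diagonalising frame, so that U^2 = 1 and v^* U v = V.  For phi = U v psi one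
    has U phi = v psi and v^* phi = V psi, hence
      T phi = v (psi + G_{0,0} V psi),
    and everything reduces to psi = - G_{0,0} V psi almost everywhere: D_0 is
    inverted on D_0 psi = - V psi.  Formally G_{0,0} is a fundamental solution of
    D_0, so that psi + G_{0,0} V psi is annihilated by D_0, and decay excludes
    the nonzero solutions.

    Separating real and imaginary parts, each of the four real components p of
    psi solves, together with a conjugate r, a Cauchy-Riemann system
    d_1 r + d_2 p = - a, d_1 p - d_2 r = b in the sense of distributions, where
    a and b are components of V psi up to sign.  The kernel of G_{0,0} consists
    of the components of K(z) = z / (2 pi |z|^2), and the claim is the
    representation p = K_1 * b - K_2 * a, proved in weak_gradient_representation.
    The system is tested directly on a regularised fundamental solution
    K_e(z) = z / (2 pi (|z|^2 + e^2)), the gradient of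
    (4 pi)^-1 log (|z|^2 + e^2).  Its curl vanishes and its divergence is the
    positive kernel P_e(z) = e^2 / (pi (|z|^2 + e^2)^2) of mass 1, so that for
    all x and all e <> 0
      P_e * p + K_{e,2} * a - K_{e,1} * b = 0      (regularised_identity).
    The kernel K_e(x - .) has to be cut off to become a test function; the
    cutoffs are exp(-1/t) composed with a polynomial, whose smoothness follows
    from the stability of the class elementary under partial derivatives.  The
    error terms disappear because K_e and the gradients of the cutoffs decay
    like <y>^-1 each, while <y>^-2 psi is integrable; it is at this point that the
    decay of psi excludes the nonzero solutions of D_0 u = 0.

    Letting e tend to 0 at a fixed x would require Lebesgue points.  Instead the
    identity is integrated over x in a box.  The mass that P_e(. - y) gives to a
    box is an explicit combination of arctangents (integral_poisson_box) that
    is bounded by a multiple of <y>^-2 uniformly in e (box_mass_weighted_le) and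
    tends to the indicator of the box (cvg_box_mass); the terms in K_e are
    dominated by those in K, whose integrals over a box are bounded uniformly in
    the centre (integral_kern_box_le).  Hence p + K_2 * a - K_1 * b integrates to
    0 over every box, and it vanishes almost everywhere by a Dynkin class
    argument (ae_eq0_of_integrals_on_boxes).

    The space assumption enters through integrability only.  Write psi = f + g
    with f in L^2 and g in L^3.  Since <x>^-3 is integrable on the plane,
    elementary inequalities of Young type show that <x>^-2 |psi| and
    <x>^-2 |psi|^2 are integrable.  The first makes V psi integrable, so that
    the integral defining T phi converges absolutely almost everywhere, by
    Fubini on boxes; the second gives phi in L^2, as |phi|^2 is at most a
    multiple of |V| |psi|^2. *)

(** * Calculus on the line and the functions t^-k exp(-1/t) *)

Section Calculus.
Variable R : realType.
Implicit Types (f g : R -> R) (x a b : R).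

Lemma is_derive1_add f g x a b : is_derive x 1 f a -> is_derive x 1 g b ->
  is_derive x 1 (fun t => f t + g t) (a + b).
Proof. by move=> ? ?; exact: is_deriveD. Qed.

Lemma is_derive1_opp f x a : is_derive x 1 f a ->
  is_derive x 1 (fun t => - f t) (- a).
Proof. by move=> ?; exact: is_deriveN. Qed.

Lemma is_derive1_mul f g x a b : is_derive x 1 f a -> is_derive x 1 g b ->
  is_derive x 1 (fun t => f t * g t) (a * g x + f x * b).
Proof.
move=> ? ?; apply: (@is_derive_eq _ _ _ (f * g)).
by rewrite addrC /GRing.scale /= [g x * a]mulrC.
Qed.

Lemma is_derive1_inv f x a : is_derive x 1 f a -> f x != 0 ->
  is_derive x 1 (fun t => (f t)^-1) (- a / f x ^+ 2).
Proof.
move=> [/= df <-] fx0; split.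
  exact: derivableV.
by rewrite deriveV// /GRing.scale /= !mulNr mulrC.
Qed.

Lemma is_derive1_exp f x a n : is_derive x 1 f a ->
  is_derive x 1 (fun t => f t ^+ n) (n%:R * f x ^+ n.-1 * a).
Proof.
move=> fa; have -> : (fun t => f t ^+ n) = (f ^+ n : R -> R).
  by apply/funext => t; rewrite exprfctE.
exact: is_deriveX.
Qed.

Lemma is_derive1_chain f g x a b : is_derive (f x) 1 g b -> is_derive x 1 f a ->
  is_derive x 1 (fun t => g (f t)) (b * a).
Proof. by move=> gb fa; apply: (@is_derive_eq _ _ _ (g \o f)); rewrite mulrC. Qed.

(** The difference quotient at 0 is at most C |h|. *)
Lemma derive_at0_of_quadratic_bound f (C : R) : (forall t, `|f t| <= C * t ^+ 2) ->
  is_derive (0 : R) 1 f 0.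
Proof.
move=> fC.
have f0 : f 0 = 0.
  by apply/eqP; rewrite -normr_le0; have := fC 0; rewrite expr0n mulr0.
have C0 : 0 <= C.
  by have := fC 1; rewrite expr1n mulr1; apply: le_trans.
have C1 : 0 < C + 1 by rewrite ltr_wpDl.
suff cf : h^-1 *: (f (h *: (1 : R) + 0) - f 0) @[h --> (0 : R)^'] --> (0 : R).
  by split; [apply: cvgP cf | apply: cvg_lim cf].
apply/cvgr0Pnorm_le => e e0; near=> h.
have h0 : h != 0 by near: h; exact: nbhs_dnbhs_neq.
rewrite f0 subr0 addr0 /GRing.scale /= mulr1 normrM normfV mulrC.
rewrite ler_pdivrMr ?normr_gt0//.
apply: (le_trans (fC h)).
rewrite -(real_normK (num_real h)) expr2 mulrA ler_pM2r ?normr_gt0//.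
have he : `|h| <= e / (C + 1).
  near: h; apply: dnbhs0_le; rewrite divr_gt0//.
apply: (le_trans (ler_wpM2l C0 he)).
by rewrite mulrCA ger_pMr// ler_pdivrMr// mul1r lerDl.
Unshelve. all: by end_near.
Qed.

End Calculus.

Section Flat.
Variable R : realType.
Implicit Types t : R.

(** The derivative of exp(-1/t), extended by 0, is t^-2 times itself; with all the
    powers t^-k included the family is closed under differentiation. *)
Definition flat (k : nat) t : R :=
  if 0 < t then t^-1 ^+ k * expR (- t^-1) else 0.

Lemma flat_ge0 k t : 0 <= flat k t.
Proof.
rewrite /flat; case: ifPn => // t0.
by rewrite mulr_ge0 ?expR_ge0// exprn_ge0// invr_ge0 ltW.
Qed.

Lemma exprn_expRN_le n (s : R) : 0 <= s -> s ^+ n * expR (- s) <= n`!%:R.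
Proof.
move=> s0; rewrite expRN ler_pdivrMr ?expR_gt0//.
case: n => [|n].
  by rewrite expr0 fact0 mul1r; have := expR_ge1Dx s; lra.
have := expR_ge1Dxn n s0; set E := expR s => H.
rewrite mulrC -ler_pdivrMr ?ltr0n ?fact_gt0//.
by apply: le_trans H; rewrite lerDr.
Qed.

Lemma flat_le k t : flat k t <= k`!%:R.
Proof.
rewrite /flat; case: ifPn => // t0; apply: exprn_expRN_le.
by rewrite invr_ge0 ltW.
Qed.

Lemma flat_le_sqr k t : `|flat k t| <= k.+2`!%:R * t ^+ 2.
Proof.
rewrite ger0_norm ?flat_ge0// /flat; case: ifPn => t0; last first.
  by rewrite mulr_ge0// sqr_ge0.
have s0 : 0 <= t^-1 by rewrite invr_ge0 ltW.
rewrite -ler_pdivrMr ?exprn_gt0//.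
apply: le_trans (exprn_expRN_le k.+2 s0).
by rewrite -(exprVn t 2) !exprS expr0 le_eqVlt; apply/orP; left; apply/eqP; ring.
Qed.

(** Only t = 0 needs an argument: there flat k is O(t^2), because s^(k+2) exp(-s)
    is bounded for s >= 0. *)
Lemma is_derive_flat k t :
  is_derive t 1 (flat k) (flat k.+2 t - k%:R * flat k.+1 t).
Proof.
have [t0|t0|t0] := ltgtP 0 t.
- apply: (@near_eq_is_derive R R R (fun u => u^-1 ^+ k * expR (- u^-1))).
    near=> u; rewrite /flat ifT//; near: u; exact: lt_nbhsr.
  have dV : is_derive t 1 (@GRing.inv R) (- t^-1 ^+ 2).
    apply: is_derive_eq (is_derive1_inv (is_derive_id _ _) _) _.
      by rewrite gt_eqF.
    by rewrite mulN1r exprVn.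
  apply: is_derive_eq (is_derive1_mul (is_derive1_exp _ dV)
    (is_derive1_chain (is_derive_expR _) (is_derive1_opp dV))) _.
  rewrite /flat t0; set s := t^-1; set E := expR _.
  case: k => [|k] /=; first by ring.
  by rewrite !exprS; ring.
- have dc : is_derive t 1 (cst (0 : R)) 0 by exact: is_derive_cst.
  apply: (@near_eq_is_derive R R R (cst 0)).
    near=> u; rewrite /flat ifF//; apply/negbTE; rewrite -leNgt ltW//.
    near: u; exact: lt_nbhsl.
  apply: is_derive_eq dc _; rewrite /flat !ifF ?mulr0 ?subr0//.
  + by apply/negbTE; rewrite -leNgt ltW.
  + by apply/negbTE; rewrite -leNgt ltW.
- rewrite -t0; apply: is_derive_eq (derive_at0_of_quadratic_bound (flat_le_sqr k)) _.
  by rewrite /flat ltxx mulr0 subr0.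
Unshelve. all: by end_near.
Qed.

End Flat.

(** * Gradients in the plane and a class of smooth functions *)

Section Gradient.
Variable R : realType.
Implicit Types (f g : R * R -> R) (x v : R * R).

(** The gradient in coordinates, as a pair of functions on the plane, so that the
    partial derivatives are read off and differentiated again. *)
Definition has_grad f f1 f2 :=
  forall x, is_diff x f (fun v => f1 x * v.1 + f2 x * v.2).

Lemma has_grad_partial f f1 f2 : has_grad f f1 f2 ->
  partial false f = f1 /\ partial true f = f2.
Proof.
move=> fg; split; apply/funext => x; rewrite /partial;
  have [df dE] := fg x; rewrite deriveE// dE /=.
- by rewrite mulr1 mulr0 addr0.
- by rewrite mulr1 mulr0 add0r.
Qed.

Lemma has_grad_cst c : has_grad (fun=> c) (fun=> 0) (fun=> 0).
Proof.
move=> x; apply: is_diff_eq (is_diff_cst _ _) _.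
by apply/funext => v; rewrite /= !mul0r addr0.
Qed.

Lemma has_grad_fst : has_grad fst (fun=> 1) (fun=> 0).
Proof.
move=> x.
have cfst : continuous (@fst R R) by move=> y; exact: cvg_fst.
split; first exact: (linear_differentiable (f := @fst R R)).
rewrite (diff_lin (f := @fst R R))//.
by apply/funext => v; rewrite /= mul1r mul0r addr0.
Qed.

Lemma has_grad_snd : has_grad snd (fun=> 0) (fun=> 1).
Proof.
move=> x.
have csnd : continuous (@snd R R) by move=> y; exact: cvg_snd.
split; first exact: (linear_differentiable (f := @snd R R)).
rewrite (diff_lin (f := @snd R R))//.
by apply/funext => v; rewrite /= mul1r mul0r add0r.
Qed.

Lemma has_grad_add f f1 f2 g g1 g2 : has_grad f f1 f2 -> has_grad g g1 g2 ->
  has_grad (fun x => f x + g x) (fun x => f1 x + g1 x) (fun x => f2 x + g2 x).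
Proof.
move=> df dg x; apply: is_diff_eq (is_diffD (df x) (dg x)) _.
by apply/funext => v /=; rewrite fctE !mulrDl addrACA.
Qed.

Lemma has_grad_mul f f1 f2 g g1 g2 : has_grad f f1 f2 -> has_grad g g1 g2 ->
  has_grad (fun x => f x * g x) (fun x => f1 x * g x + f x * g1 x)
    (fun x => f2 x * g x + f x * g2 x).
Proof.
move=> df dg x; apply: is_diff_eq (is_diffM (df x) (dg x)) _.
apply/funext => v.
transitivity (f x * (g1 x * v.1 + g2 x * v.2) + g x * (f1 x * v.1 + f2 x * v.2)).
  by [].
by rewrite /=; ring.
Qed.

Lemma has_grad_chain (h h' : R -> R) f f1 f2 :
  (forall x, is_derive (f x) 1 h (h' (f x))) -> has_grad f f1 f2 ->
  has_grad (fun x => h (f x)) (fun x => h' (f x) * f1 x)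
    (fun x => h' (f x) * f2 x).
Proof.
move=> dh df x; have [/derivable1_diffP dhx dhE] := dh x.
have [dfx dfE] := df x.
split; first exact: differentiable_comp.
rewrite (diff_comp dfx dhx) dfE diff1E// derive1E dhE.
by apply/funext => v /=; rewrite /GRing.scale /=; ring.
Qed.

Lemma has_grad_inv f f1 f2 : (forall x, f x != 0) -> has_grad f f1 f2 ->
  has_grad (fun x => (f x)^-1) (fun x => - (f x) ^-2 * f1 x)
    (fun x => - (f x) ^-2 * f2 x).
Proof.
move=> f0 df.
apply: (@has_grad_chain (@GRing.inv R) (fun t => - t ^-2)) => // x.
apply: is_derive_eq (is_derive1_inv (is_derive_id _ _) _) _ => //.
by rewrite mulN1r.
Qed.

(** This class is stable under partial derivatives, so that membership gives
    derivatives of every order; it contains the cutoffs and the regularised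
    kernels used as test functions. *)
Inductive elementary : (R * R -> R) -> Prop :=
| elementary_cst c : elementary (fun=> c)
| elementary_fst : elementary fst
| elementary_snd : elementary snd
| elementary_add f g : elementary f -> elementary g ->
    elementary (fun x => f x + g x)
| elementary_mul f g : elementary f -> elementary g ->
    elementary (fun x => f x * g x)
| elementary_inv f : (forall x, f x != 0) -> elementary f ->
    elementary (fun x => (f x)^-1)
| elementary_flat k f : elementary f -> elementary (fun x => flat k (f x)).

Lemma elementary_grad f : elementary f ->
  exists f1 f2, [/\ elementary f1, elementary f2 & has_grad f f1 f2].
Proof.
elim=> {f} [c|||f g ef [f1 [f2 [e1 e2 df]]] eg [g1 [g2 [e1' e2' dg]]]
  |f g ef [f1 [f2 [e1 e2 df]]] eg [g1 [g2 [e1' e2' dg]]]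
  |f f0 ef [f1 [f2 [e1 e2 df]]]|k f ef [f1 [f2 [e1 e2 df]]]].
- by do 2!exists (fun=> 0); split; [constructor..|exact: has_grad_cst].
- exists (fun=> 1), (fun=> 0); split; [constructor..|exact: has_grad_fst].
- exists (fun=> 0), (fun=> 1); split; [constructor..|exact: has_grad_snd].
- by do 2!eexists; split; last exact: has_grad_add df dg; constructor.
- by do 2!eexists; split; last exact: has_grad_mul df dg; repeat constructor.
- have einv2 : elementary (fun x => - (f x) ^- 2).
    have -> : (fun x => - (f x) ^- 2) = (fun x => (-1) * ((f x)^-1 * (f x)^-1)).
      by apply/funext => x; rewrite mulN1r -expr2 exprVn.
    by repeat constructor.
  by do 2!eexists; split; last exact: has_grad_inv f0 df; constructor.
- have eflat' : elementary (fun x => flat k.+2 (f x) - k%:R * flat k.+1 (f x)).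
    have -> : (fun x => flat k.+2 (f x) - k%:R * flat k.+1 (f x)) =
      (fun x => flat k.+2 (f x) + (- k%:R) * flat k.+1 (f x)).
      by apply/funext => x; rewrite mulNr.
    by repeat constructor.
  do 2!eexists; split; last exact: (@has_grad_chain (flat k)
    (fun t => flat k.+2 t - k%:R * flat k.+1 t)
    _ _ _ (fun x => is_derive_flat k (f x)) df); by constructor.
Qed.

Lemma elementary_smooth f : elementary f -> smooth f.
Proof.
move=> ef s x; suff : elementary (foldr (@partial R) f s).
  by move=> /elementary_grad[f1 [f2 [_ _ df]]]; have [] := df x.
elim: s => //= k s /elementary_grad[f1 [f2 [e1 e2 df]]].
by have [p1 p2] := has_grad_partial df; case: k; rewrite ?p1 ?p2.
Qed.

(** Off 0, t^-1 = t (t^2)^-1, and the inverse of a nonnegative number is a real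
    power; the identity persists at 0 with the convention 0^-1 = 0. *)
Lemma measurable_inv : measurable_fun setT (@GRing.inv R).
Proof.
have -> : @GRing.inv R = (fun t : R => t * (t ^+ 2) `^ (-1)).
  apply/funext => t; have [->|t0] := eqVneq t 0; first by rewrite mul0r invr0.
  by rewrite powR_inv1 ?sqr_ge0// expr2 invfM mulrA divff// mul1r.
apply: measurable_funM => //.
apply: (measurableT_comp (measurable_powR _)).
exact: measurable_funX.
Qed.

Lemma measurable_flat k : measurable_fun setT (@flat R k).
Proof.
apply: continuous_measurable_fun => t; apply: differentiable_continuous.
by apply/derivable1_diffP; have [] := is_derive_flat k t.
Qed.

Lemma measurable_elementary (f : plane R -> R) : elementary f ->
  measurable_fun setT f.
Proof.
elim=> {f} [c|||f g _ mf _ mg|f g _ mf _ mg|f _ _ mf|k f _ mf].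
- exact: measurable_cst.
- exact: measurable_fst.
- exact: measurable_snd.
- exact: measurable_funD.
- exact: measurable_funM.
- exact: (measurableT_comp measurable_inv).
- exact: (measurableT_comp (measurable_flat k)).
Qed.

End Gradient.

(** * The Poisson-type kernel and its mixed primitive *)

Section PoissonKernel.
Variable R : realType.
Implicit Types (e s t x y : R).

(** The divergence of the regularised gradient kernel. It is positive, has total
    mass 1 and concentrates at the origin as e tends to 0. *)
Definition poisson e s t := e ^+ 2 / (pi * (s ^+ 2 + t ^+ 2 + e ^+ 2) ^+ 2).

(** The absolute value of s smoothed at scale e. *)
Definition regrad e s := Num.sqrt (s ^+ 2 + e ^+ 2).

(** The derivative of angle in its first coordinate, a primitive of poisson in
    the second. *)
Definition angle_ds e s t := (2 * pi)^-1 *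
  (e ^+ 2 / regrad e s ^+ 3 * atan (t / regrad e s) +
   e ^+ 2 * t / (regrad e s ^+ 2 * (regrad e s ^+ 2 + t ^+ 2))).

(** A function with mixed second derivative poisson; it makes the integrals of
    poisson over boxes explicit. *)
Definition angle e s t := (2 * pi)^-1 *
  (s / regrad e s * atan (t / regrad e s) +
   t / regrad e t * atan (s / regrad e t)).

Lemma regrad_gt0 e s : e != 0 -> 0 < regrad e s.
Proof. by move=> e0; rewrite sqrtr_gt0 ltr_wpDl ?sqr_ge0// exprn_even_gt0. Qed.

Lemma regrad_sqr e s : regrad e s ^+ 2 = s ^+ 2 + e ^+ 2.
Proof. by rewrite sqr_sqrtr// addr_ge0// sqr_ge0. Qed.

Lemma is_derive_regrad e s : e != 0 ->
  is_derive s 1 (regrad e) (s / regrad e s).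
Proof.
move=> e0; have r0 := regrad_gt0 s e0.
have S0 : 0 < s ^+ 2 + e ^+ 2 by rewrite -regrad_sqr exprn_gt0.
have dc : is_derive s 1 (fun=> e ^+ 2) 0 by exact: is_derive_cst.
have d2 := is_derive1_add (is_derive1_exp 2 (is_derive_id s 1)) dc.
have d := is_derive1_chain (f := fun t => t ^+ 2 + e ^+ 2) (is_derive1_sqrt S0) d2.
have -> : regrad e = (fun t => Num.sqrt (t ^+ 2 + e ^+ 2)) by [].
apply: (is_derive_eq d).
rewrite -/(regrad e s) /= expr1 addr0 mulr1; field; exact: lt0r_neq0.
Qed.

Lemma is_derive_angle e s t : e != 0 ->
  is_derive s 1 (fun s => angle e s t) (angle_ds e s t).
Proof.
move=> e0; have r0 := regrad_gt0 s e0; have q0 := regrad_gt0 t e0.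
have dr := is_derive_regrad s e0.
have dV := is_derive1_inv dr (lt0r_neq0 r0).
have dc c : is_derive s 1 (fun=> c : R) 0 by exact: is_derive_cst.
have := is_derive1_mul (dc (2 * pi)^-1) (is_derive1_add
   (is_derive1_mul (is_derive1_mul (is_derive_id s 1) dV)
      (is_derive1_chain (is_derive1_atan _) (is_derive1_mul (dc t) dV)))
   (is_derive1_mul (dc (t / regrad e t))
      (is_derive1_chain (is_derive1_atan _)
         (is_derive1_mul (is_derive_id s 1) (dc (regrad e t)^-1))))).
move/is_derive_eq; apply; rewrite /angle_ds /= mul0r add0r; congr (_ * _).
have := regrad_sqr e s; have := regrad_sqr e t.
move: (atan _) (atan _) r0 q0; set r := regrad e s; set q := regrad e t.
move=> A B r0 q0 Eq Er.
have N : 0 < r ^+ 2 + t ^+ 2 by rewrite ltr_wpDr ?sqr_ge0// exprn_gt0.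
have -> : 1 + (t / r) ^+ 2 = (r ^+ 2 + t ^+ 2) / r ^+ 2.
  by field; rewrite gt_eqF.
have -> : 1 + (s / q) ^+ 2 = (r ^+ 2 + t ^+ 2) / q ^+ 2.
  have -> : r ^+ 2 + t ^+ 2 = q ^+ 2 + s ^+ 2 by rewrite Eq Er; ring.
  by field; rewrite gt_eqF.
have -> : e ^+ 2 = r ^+ 2 - s ^+ 2 by rewrite Er; ring.
by field; rewrite !gt_eqF.
Qed.

Lemma is_derive_angle_ds e s t : e != 0 ->
  is_derive t 1 (angle_ds e s) (poisson e s t).
Proof.
move=> e0; have r0 := regrad_gt0 s e0.
have dc c : is_derive t 1 (fun=> c : R) 0 by exact: is_derive_cst.
set r := regrad e s in r0 *.
have N : 0 < r ^+ 2 + t ^+ 2 by rewrite ltr_wpDr ?sqr_ge0// exprn_gt0.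
have D0 : r ^+ 2 * (r ^+ 2 + t ^+ 2) != 0 by rewrite mulf_neq0// gt_eqF// exprn_gt0.
have := is_derive1_mul (dc (2 * pi)^-1) (is_derive1_add
   (is_derive1_mul (dc (e ^+ 2 / r ^+ 3))
      (is_derive1_chain (is_derive1_atan _)
         (is_derive1_mul (is_derive_id t 1) (dc r^-1))))
   (is_derive1_mul (is_derive1_mul (dc (e ^+ 2)) (is_derive_id t 1))
     (is_derive1_inv (is_derive1_mul (dc (r ^+ 2)) (is_derive1_add (dc (r ^+ 2))
        (is_derive1_exp 2 (is_derive_id t 1)))) D0))).
move/is_derive_eq; apply; rewrite /poisson /=.
have -> : s ^+ 2 + t ^+ 2 + e ^+ 2 = r ^+ 2 + t ^+ 2.
  by rewrite regrad_sqr; ring.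
have -> : 1 + (t / r) ^+ 2 = (r ^+ 2 + t ^+ 2) / r ^+ 2.
  by field; rewrite gt_eqF.
move: (pi : R) (pi_gt0 R) => p p0.
by field; rewrite !gt_eqF.
Qed.

Lemma derivable_poisson e s t : e != 0 -> derivable (poisson e s) t 1.
Proof.
move=> e0; have dc c : is_derive t 1 (fun=> c : R) 0 by exact: is_derive_cst.
have S0 : 0 < s ^+ 2 + t ^+ 2 + e ^+ 2.
  by rewrite ltr_wpDl ?addr_ge0 ?sqr_ge0// exprn_even_gt0.
have D0 : pi * (s ^+ 2 + t ^+ 2 + e ^+ 2) ^+ 2 != 0.
  by rewrite mulf_neq0// gt_eqF// ?pi_gt0// exprn_gt0.
have [+ _] := is_derive1_mul (dc (e ^+ 2)) (is_derive1_inv (is_derive1_mul (dc pi)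
  (is_derive1_exp 2 (is_derive1_add (is_derive1_add (dc (s ^+ 2))
    (is_derive1_exp 2 (is_derive_id t 1))) (dc (e ^+ 2))))) D0).
by [].
Qed.

Lemma derivable_angle_ds e s t : e != 0 -> derivable (fun s => angle_ds e s t) s 1.
Proof.
move=> e0; have r0 := regrad_gt0 s e0.
have dr := is_derive_regrad s e0.
have dV := is_derive1_inv dr (lt0r_neq0 r0).
have dc c : is_derive s 1 (fun=> c : R) 0 by exact: is_derive_cst.
have r30 : regrad e s ^+ 3 != 0 by rewrite gt_eqF ?exprn_gt0.
have D0 : regrad e s ^+ 2 * (regrad e s ^+ 2 + t ^+ 2) != 0.
  by rewrite gt_eqF// mulr_gt0 ?exprn_gt0// ltr_wpDr ?sqr_ge0// exprn_gt0.
have dr2 := is_derive1_exp 2 dr.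
have [+ _] := is_derive1_mul (dc (2 * pi)^-1) (is_derive1_add
   (is_derive1_mul (is_derive1_mul (dc (e ^+ 2)) (is_derive1_inv (is_derive1_exp 3 dr) r30))
      (is_derive1_chain (is_derive1_atan _) (is_derive1_mul (dc t) dV)))
   (is_derive1_mul (dc (e ^+ 2 * t)) (is_derive1_inv (is_derive1_mul dr2
     (is_derive1_add dr2 (dc (t ^+ 2)))) D0))).
by [].
Qed.

Lemma integral_segment_FTC (f F : R -> R) a b : a <= b ->
  (forall t, is_derive t 1 F (f t)) -> (forall t, derivable f t 1) ->
  (\int[lebesgue_measure]_(t in `[a, b]) (f t)%:E = (F b - F a)%:E)%E.
Proof.
move=> + dF df; rewrite le_eqVlt => /predU1P[->|ab].
  by rewrite set_itv1 integral_set1 subrr.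
have cf : continuous f.
  by move=> t; apply: differentiable_continuous; apply/derivable1_diffP.
have cF : continuous F.
  move=> t; apply: differentiable_continuous; apply/derivable1_diffP.
  by have [] := dF t.
rewrite EFinB; apply: continuous_FTC2 => //.
- exact: continuous_subspaceT.
- split.
  + by move=> t _; have [] := dF t.
  + by apply: cvg_at_right_filter; exact: cF.
  + by apply: cvg_at_left_filter; exact: cF.
- by move=> t _; rewrite derive1E; have [_ ->] := dF t.
Qed.

End PoissonKernel.

(** * The mixed primitive as the regularisation vanishes *)

Section AngleLimit.
Variable R : realType.
Implicit Types (e s t x y : R).

Lemma atan_inv x : 0 < x -> atan x + atan x^-1 = pi / 2.
Proof.
move=> x0; suff -> : atan x^-1 = pi / 2 - atan x by rewrite addrC subrK.
have a0 : 0 < atan x by rewrite -(@atan0 R) lt_atan.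
rewrite -[RHS]tanK; last first.
  rewrite in_itv /= ltrBlDr ltrDl a0 andbT.
  by have := atan_ltpi2 x; have := pi_gt0 R; lra.
congr atan; rewrite -[in LHS](atanK x) /tan sinB cosB.
by rewrite sin_pihalf cos_pihalf !mul0r !mul1r subr0 add0r invf_div.
Qed.

(** Each quotient s / regrad e s has modulus at most 1 and each arctangent is
    below pi / 2, uniformly in e. *)
Lemma angle_le e s t : `|angle e s t| <= 2^-1.
Proof.
have pi0 := pi_gt0 R.
have H u w : `|u / regrad e u * atan w| <= pi / 2.
  rewrite normrM -[leRHS]mul1r ler_pM//.
    have r0 : 0 <= regrad e u by exact: sqrtr_ge0.
    rewrite normrM normfV (ger0_norm r0).
    move: r0; rewrite le_eqVlt => /predU1P[<-|r0]; first by rewrite invr0 mulr0.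
    rewrite ler_pdivrMr// mul1r.
    rewrite -sqrtr_sqr ler_wsqrtr// lerDl sqr_ge0//.
  by rewrite ler_norml !ltW ?atan_gtNpi2 ?atan_ltpi2.
rewrite /angle normrM ger0_norm; last first.
  by rewrite invr_ge0 mulr_ge0// ltW.
rewrite ler_pdivrMl ?mulr_gt0//.
apply: (le_trans (ler_normD _ _)).
by apply: (le_trans (lerD (H _ _) (H _ _))); lra.
Qed.

(** Without regularisation the quotients s / |s| are signs, and the two remaining
    arctangents are complementary angles. *)
Lemma angle0 s t : angle 0 s t = Num.sg s * Num.sg t / 4.
Proof.
have [->|s0] := eqVneq s 0; first by rewrite /angle !mul0r atan0 mulr0 addr0 sgr0 mulr0 !mul0r.
have [->|t0] := eqVneq t 0; first by rewrite /angle !mul0r atan0 mulr0 addr0 sgr0 !mulr0 mul0r.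
have sgE (u : R) : u != 0 -> u / regrad 0 u = Num.sg u.
  by move=> u0; rewrite /regrad expr0n addr0 sqrtr_sqr {1}(numEsg u) mulfK// normr_eq0.
have atE (u w : R) : w != 0 -> atan (u / `|w|) = Num.sg u * atan (`|u| / `|w|).
  move=> w0; have [u0|u0|->] := ltgtP u 0.
  - by rewrite ltr0_sg// mulN1r -atanN (ltr0_norm u0) mulNr opprK.
  - by rewrite gtr0_sg// mul1r (gtr0_norm u0).
  - by rewrite sgr0 !mul0r atan0.
rewrite /angle !sgE// /regrad expr0n /= !addr0 !sqrtr_sqr (atE t s)// (atE s t)//.
have : atan (`|t| / `|s|) + atan (`|s| / `|t|) = pi / 2.
  by rewrite -[`|s| / `|t|]invf_div atan_inv// divr_gt0 ?normr_gt0.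
move: (atan _) (atan _) => A B /(canRL (addKr _)) ->.
by move: (pi : R) (pi_gt0 R) => p p0; field; exact: lt0r_neq0.
Qed.

(** On the axes angle vanishes for every e; off the axes it is continuous in e
    up to e = 0. *)
Lemma cvg_angle s t :
  angle (@harmonic R n) s t @[n --> \oo] --> Num.sg s * Num.sg t / 4.
Proof.
rewrite -angle0.
have [s0|s0] := eqVneq s 0.
  have E e : angle e s t = 0 by rewrite /angle s0 !mul0r atan0 mulr0 addr0 mulr0.
  by under eq_fun do rewrite E; rewrite E; exact: cvg_cst.
have [t0|t0] := eqVneq t 0.
  have E e : angle e s t = 0 by rewrite /angle t0 !mul0r atan0 mulr0 addr0 mulr0.
  by under eq_fun do rewrite E; rewrite E; exact: cvg_cst.
have cr u : regrad (@harmonic R n) u @[n --> \oo] --> regrad 0 u.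
  have : (u ^+ 2 + @harmonic R n ^+ 2) @[n --> \oo] --> u ^+ 2 + 0 ^+ 2.
    apply: cvgD; first exact: cvg_cst.
    rewrite expr2; under eq_fun do rewrite expr2.
    by apply: cvgM; exact: cvg_harmonic.
  by apply: continuous_cvg; exact: sqrt_continuous.
have cV u w : u != 0 -> w / regrad (@harmonic R n) u @[n --> \oo] --> w / regrad 0 u.
  move=> u0; apply: cvgM; first exact: cvg_cst.
  apply: cvgV; last exact: cr.
  by rewrite /regrad expr0n addr0 sqrtr_sqr normr_eq0.
have ca u w : u != 0 -> atan (w / regrad (@harmonic R n) u) @[n --> \oo] --> atan (w / regrad 0 u).
  by move=> u0; apply: continuous_cvg; [exact: continuous_atan|exact: cV].
apply: cvgM; first exact: cvg_cst.
by apply: cvgD; apply: cvgM; first [exact: cV|exact: ca].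
Qed.

End AngleLimit.

(** * Functions whose integrals over boxes vanish *)

Section Uniqueness.
Local Open Scope ereal_scope.

(** The sets A for which w integrates to 0 over the part of D above A form a
    Dynkin class, so a generating class stable under intersection suffices. *)
Lemma integral_preimage_eq0 d d' (T : measurableType d) (S : measurableType d')
    (R : realType) (mu : {measure set T -> \bar R}) (D : set T) (phi : T -> S)
    (G : set (set S)) (w : T -> \bar R) :
  measurable D -> measurable_fun setT phi -> mu.-integrable D w ->
  @measurable _ S = <<s G >> -> setI_closed G ->
  \int[mu]_(x in D) w x = 0 ->
  (forall A, G A -> \int[mu]_(x in D `&` phi @^-1` A) w x = 0) ->
  forall A, measurable A -> \int[mu]_(x in D `&` phi @^-1` A) w x = 0.
Proof.
move=> mD mphi iw SG GI D0 G0 A mA.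
have mpre B : measurable B -> measurable (D `&` phi @^-1` B).
  by move=> mB; apply: measurableI => //; rewrite -[X in measurable X]setTI; exact: mphi.
have iE B : B `<=` D -> measurable B -> mu.-integrable B w.
  by move=> BD mB; apply: integrableS iw.
suff : forall B, <<s G >> B -> \int[mu]_(x in D `&` phi @^-1` B) w x = 0.
  by apply; rewrite -SG.
apply: (@dynkin_induction _ S G
  (fun B => \int[mu]_(x in D `&` phi @^-1` B) w x = 0) SG GI).
- by rewrite preimage_setT setIT.
- exact: G0.
- move=> B mB B0.
  have DE : (D `&` phi @^-1` B) `|` (D `&` phi @^-1` (~` B)) = D.
    by rewrite -setIUr -preimage_setU setUv preimage_setT setIT.
  have := integral_setU mu (mpre _ mB) (mpre _ (measurableC mB)).
  move=> /(_ w); rewrite DE D0 B0 add0e => <- //; first exact: measurable_int iw.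
  apply/disj_setPS => x [[_ Bx] [_]]; exact.
- move=> F mF tF F0.
  rewrite preimage_bigcup setI_bigcupr integral_bigcup.
  + by rewrite eseries0// => i _ _; exact: F0.
  + apply/trivIsetP => i j _ _ ij; apply/seteqP; split => // x [[_ Fi] [_ Fj]].
    by move/trivIsetP : tF => /(_ i j Logic.I Logic.I ij)/seteqP[/(_ (phi x) (conj Fi Fj))].
  + by move=> k; exact: mpre.
  + apply: iE; first by move=> x [k _ []].
    by apply: bigcup_measurable => k _; exact: mpre.
Qed.

Variable R : realType.
Local Notation mu2 := (@lebesgue_measure R \x @lebesgue_measure R).

(** The plane is a countable union of boxes. *)
Lemma ae_of_boxes (P : plane R -> Prop) :
  (forall I J, ocitv I -> ocitv J -> {ae mu2, forall x, (I `*` J) x -> P x}) ->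
  {ae mu2, forall x, P x}.
Proof.
move=> H; pose K n : set (measurableTypeR R) := `](- n%:R)%R, n%:R]%classic.
have oK n : ocitv (K n) by exact: is_ocitv.
have := ae_foralln (fun n => H _ _ (oK n) (oK n)); apply: filterS => x wx.
pose n := Num.bound (Num.max `|x.1| `|x.2|)%R; apply: (wx n).
have : (Num.max `|x.1| `|x.2| < n%:R)%R.
  by apply: archi_boundP; rewrite le_max normr_ge0.
rewrite gt_max => /andP[/ltr_normlP[a b] /ltr_normlP[c e]].
by split; rewrite /K /= in_itv /=; apply/andP; split; lra.
Qed.

(** The vanishing extends from products of intervals to products of a measurable
    set and an interval, then to products of measurable sets, then to all
    measurable sets, each time by integral_preimage_eq0. Restricting w to a fixed
    box first makes it integrable. *)
Lemma ae_eq0_of_integrals_on_boxes (w : plane R -> R) :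
  (forall I J, ocitv I -> ocitv J -> mu2.-integrable (I `*` J) (EFin \o w)) ->
  (forall I J, ocitv I -> ocitv J -> \int[mu2]_(x in I `*` J) (w x)%:E = 0) ->
  {ae mu2, forall x, w x = 0%R}.
Proof.
move=> iw w0.
have mI (I : set (measurableTypeR R)) : ocitv I -> measurable I.
  by move=> oI; exact: sub_sigma_algebra.
apply: ae_of_boxes => K L oK oL.
pose D : set (plane R) := K `*` L.
have mD : measurable D by apply: measurableX; exact: mI.
have iD := iw _ _ oK oL.
have pre1 (A B : set (measurableTypeR R)) :
    (A `*` B : set (plane R)) = (setT `*` B) `&` fst @^-1` A.
  by apply/seteqP; split => x /=; [move=> [? ?]; split|move=> [[_ ?] ?]].
pose wn := (EFin \o w) \_ D.
have iwn : mu2.-integrable setT wn by apply/(integrable_mkcond _ mD).1.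
have wn0 (A B : set (measurableTypeR R)) :
   \int[mu2]_(x in A `*` B) wn x = \int[mu2]_(x in (A `&` K) `*` (B `&` L)) (w x)%:E.
  rewrite -integral_mkcondr; congr (\int[_]_(x in _) _).
  by apply/seteqP; split => x /=; [move=> [[? ?] []]|move=> [[? ?] []]].
have iwnS E : measurable E -> mu2.-integrable E wn.
  by move=> mE; apply: integrableS iwn.
have s1 I J : measurable I -> ocitv J -> \int[mu2]_(x in I `*` J) wn x = 0.
  move=> mI' oJ; rewrite pre1.
  apply: (integral_preimage_eq0 (G := @ocitv R)) => //.
  - by apply: measurableX => //; exact: mI.
  - by apply: iwnS; apply: measurableX => //; exact: mI.
  - exact: ocitvI.
  - by rewrite wn0 setTI; apply: w0 => //; exact: ocitvI.
  - by move=> A oA; rewrite -pre1 wn0; apply: w0; exact: ocitvI.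
have pre2 (A B : set (measurableTypeR R)) :
    (A `*` B : set (plane R)) = (A `*` setT) `&` snd @^-1` B.
  by apply/seteqP; split => x /=; [move=> [? ?]; split|move=> [[? _] ?]].
have s2 I J : measurable I -> measurable J -> \int[mu2]_(x in I `*` J) wn x = 0.
  move=> mI' mJ; rewrite pre2.
  apply: (integral_preimage_eq0 (G := @ocitv R)) => //.
  - exact: measurableX.
  - by apply: iwnS; exact: measurableX.
  - exact: ocitvI.
  - by have := s1 I L mI' oL; rewrite !wn0 setIid setTI.
  - by move=> A oA; rewrite -pre2; exact: s1.
have s3 E : measurable E -> \int[mu2]_(x in E) wn x = 0.
  move=> mE; rewrite -[E]setTI.
  apply: (integral_preimage_eq0 (phi := idfun)
    (S := (measurableTypeR R * measurableTypeR R)%type)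
    (G := [set A `*` B | A in @measurable _ (measurableTypeR R) & B in @measurable _ (measurableTypeR R)])) => //.
  - exact: measurable_id.
  - exact: measurable_prod_measurableType.
  - move=> _ _ [A1 mA1 [B1 mB1 <-]] [A2 mA2 [B2 mB2 <-]].
    by rewrite -setXI; exists (A1 `&` A2); [exact: measurableI|];
      exists (B1 `&` B2) => //; exact: measurableI.
  - by rewrite -setXTT; exact: s2.
  - by move=> _ [A mA [B mB <-]]; rewrite setTI; exact: s2.
have : ae_eq mu2 setT wn (cst 0).
  apply: integral_ae_eq => // E _ mE.
  by rewrite s3// integral0.
apply: filterS => x /(_ Logic.I) + Dx.
by rewrite /wn patchE mem_set//= => -[].
Qed.
End Uniqueness.

(** * Integrals of the kernels over boxes and segments *)

Section BoxIntegrals.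
Variable R : realType.
Local Notation leb := (@lebesgue_measure R).
Local Notation mu2 := (@lebesgue_measure R \x @lebesgue_measure R)%E.
Implicit Types (e s t : R).

Section Tonelli.
Local Open Scope ereal_scope.
Variables (f : plane R -> \bar R) (I J : set (measurableTypeR R)).
Hypotheses (mf : measurable_fun setT f) (f0 : forall x, 0 <= f x).
Hypotheses (mI : measurable I) (mJ : measurable J).

Let mpatch : measurable_fun setT (f \_ (I `*` J)).
Proof.
apply/(measurable_restrictT _ _).1; first exact: measurableX.
exact: measurable_funTS.
Qed.

Let patch_ge0 x : 0 <= (f \_ (I `*` J)) x.
Proof. exact: erestrict_ge0. Qed.

Lemma integral_setX12 :
  \int[mu2]_(x in I `*` J) f x = \int[leb]_(s in I) \int[leb]_(t in J) f (s, t).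
Proof.
rewrite [LHS]integral_mkcond fubini_tonelli1// [RHS]integral_mkcond.
apply: eq_integral => s _; rewrite /fubini_F patchE; case: ifPn => sI.
  rewrite [RHS]integral_mkcond; apply: eq_integral => t _.
  by rewrite !patchE in_setX /= sI.
by rewrite integral0_eq// => t _; rewrite patchE in_setX /= (negbTE sI).
Qed.

Lemma integral_setX21 :
  \int[mu2]_(x in I `*` J) f x = \int[leb]_(t in J) \int[leb]_(s in I) f (s, t).
Proof.
rewrite [LHS]integral_mkcond fubini_tonelli2// [RHS]integral_mkcond.
apply: eq_integral => t _; rewrite /fubini_G patchE; case: ifPn => tJ.
  rewrite [RHS]integral_mkcond; apply: eq_integral => s _.
  by rewrite !patchE in_setX /= tJ andbT.
by rewrite integral0_eq// => s _; rewrite patchE in_setX /= (negbTE tJ) andbF.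
Qed.

Lemma measurable_integral12 :
  measurable_fun setT (fun s : measurableTypeR R => \int[leb]_(t in J) f (s, t)).
Proof.
have mp : measurable_fun setT (f \_ ([set: measurableTypeR R] `*` J)).
  apply/(measurable_restrictT _ _).1; first exact: measurableX.
  exact: measurable_funTS.
have p0 x : 0 <= (f \_ ([set: measurableTypeR R] `*` J)) x by exact: erestrict_ge0.
have := measurable_fun_fubini_tonelli_F (m2 := leb) _ mp p0.
congr measurable_fun; apply/funext => s; rewrite /fubini_F [RHS]integral_mkcond.
by apply: eq_integral => t _; rewrite !patchE in_setX /= in_setT.
Qed.

Lemma measurable_integral21 :
  measurable_fun setT (fun t : measurableTypeR R => \int[leb]_(s in I) f (s, t)).
Proof.
have mp : measurable_fun setT (f \_ (I `*` [set: measurableTypeR R])).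
  apply/(measurable_restrictT _ _).1; first exact: measurableX.
  exact: measurable_funTS.
have p0 x : 0 <= (f \_ (I `*` [set: measurableTypeR R])) x by exact: erestrict_ge0.
have := measurable_fun_fubini_tonelli_G (m1 := leb) _ mp p0.
congr measurable_fun; apply/funext => t; rewrite /fubini_G [RHS]integral_mkcond.
by apply: eq_integral => s _; rewrite !patchE in_setX /= in_setT andbT.
Qed.

End Tonelli.

Lemma is_derive1_translate (F : R -> R) (a t df : R) :
  is_derive (t - a) 1 F df -> is_derive t 1 (fun u => F (u - a)) df.
Proof.
move=> dF; have dt : is_derive t 1 (fun u => u - a) 1.
  apply: is_derive_eq (is_derive1_add (is_derive_id t 1) (is_derive_cst (- a) t 1)) _.
  by rewrite addr0.
apply: is_derive_eq (is_derive1_chain (f := fun u => u - a) dF dt) _.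
by rewrite mulr1.
Qed.

Lemma integral_itvoc_FTC (f F : R -> R) a b : a <= b ->
  (forall t, is_derive t 1 F (f t)) -> (forall t, derivable f t 1) ->
  (\int[leb]_(t in `]a, b]) (f t)%:E = (F b - F a)%:E)%E.
Proof.
move=> ab dF df; rewrite integral_itv_obnd_cbnd ?(integral_segment_FTC ab dF df)//.
apply: measurable_funTS; apply/measurable_EFinP; apply: continuous_measurable_fun => t.
by apply: differentiable_continuous; apply/derivable1_diffP.
Qed.

(** The Poisson-type mass centred at y of the box with corners a and b, as the
    mixed difference of its primitive. *)
Definition box_mass e (a b y : R * R) :=
  (angle e (b.1 - y.1) (b.2 - y.2) - angle e (b.1 - y.1) (a.2 - y.2)) -
  (angle e (a.1 - y.1) (b.2 - y.2) - angle e (a.1 - y.1) (a.2 - y.2)).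

Lemma poisson_ge0 e s t : 0 <= poisson e s t.
Proof. by rewrite /poisson divr_ge0 ?sqr_ge0// mulr_ge0 ?sqr_ge0// pi_ge0. Qed.

Lemma measurable_poisson e d (T : measurableType d) (f g : T -> R) :
  measurable_fun setT f -> measurable_fun setT g ->
  measurable_fun setT (fun x => poisson e (f x) (g x)).
Proof.
move=> mf mg; rewrite /poisson; apply: measurable_funM => //.
apply: (measurableT_comp (@measurable_inv R)).
apply: measurable_funM => //; apply: measurable_funX.
apply: measurable_funD => //.
by apply: measurable_funD; apply: measurable_funX.
Qed.

(** Two applications of the fundamental theorem of calculus, first to angle_ds in
    the second coordinate and then to angle in the first. *)
Lemma integral_poisson_box e (a b y : R * R) : e != 0 ->
  a.1 <= b.1 -> a.2 <= b.2 ->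
  (\int[mu2]_(x in `]a.1, b.1]%classic `*` `]a.2, b.2]%classic)
     (poisson e (x.1 - y.1) (x.2 - y.2))%:E = (box_mass e a b y)%:E)%E.
Proof.
move=> e0 ab1 ab2; rewrite (integral_setX12 (f := fun x => (poisson e (x.1 - y.1) (x.2 - y.2))%:E))//; last 2 first.
- by apply/measurable_EFinP; apply: measurable_poisson; exact: measurable_funB.
- by move=> x; rewrite lee_fin poisson_ge0.
have inner s : (\int[leb]_(t in `]a.2, b.2]) (poisson e (s - y.1) (t - y.2))%:E =
    (angle_ds e (s - y.1) (b.2 - y.2) - angle_ds e (s - y.1) (a.2 - y.2))%:E)%E.
  apply: (@integral_itvoc_FTC (fun t => poisson e (s - y.1) (t - y.2))
    (fun t => angle_ds e (s - y.1) (t - y.2)) _ _ ab2) => t.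
    by apply: is_derive1_translate; exact: is_derive_angle_ds.
  by have [] := is_derive1_translate
    (derivableP (@derivable_poisson R e (s - y.1) (t - y.2) e0)).
under eq_integral => s _ do rewrite /= inner.
apply: (@integral_itvoc_FTC
  (fun s => angle_ds e (s - y.1) (b.2 - y.2) - angle_ds e (s - y.1) (a.2 - y.2))
  (fun s => angle e (s - y.1) (b.2 - y.2) - angle e (s - y.1) (a.2 - y.2))
  _ _ ab1) => t.
  apply: is_derive1_add; last apply: is_derive1_opp.
    apply: (is_derive1_translate (F := fun s => angle e s (b.2 - y.2))).
    exact: is_derive_angle.
  apply: (is_derive1_translate (F := fun s => angle e s (a.2 - y.2))).
  exact: is_derive_angle.
have H c : derivable (fun s => angle_ds e (s - y.1) c) t 1.
  by have [] := is_derive1_translate (F := fun s => angle_ds e s c)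
    (derivableP (@derivable_angle_ds R e (t - y.1) c e0)).
by apply: derivableB; exact: H.
Qed.

Lemma box_mass_le e a b y : `|box_mass e a b y| <= 2.
Proof.
rewrite /box_mass; have := angle_le e; move: (angle e) => A H.
have := H (b.1 - y.1) (b.2 - y.2); have := H (b.1 - y.1) (a.2 - y.2).
have := H (a.1 - y.1) (b.2 - y.2); have := H (a.1 - y.1) (a.2 - y.2).
by rewrite !ler_norml; lra.
Qed.

Lemma sgr_sub_half (a b y : R) : a <= b -> y != a -> y != b ->
  (Num.sg (b - y) - Num.sg (a - y)) / 2 = \1_(`]a, b]%classic) y.
Proof.
move=> ab ya yb; rewrite indicE mem_setE in_itv /=.
have [|] := boolP (a < y <= b) => /= H.
  have /andP[ay yb'] := H.
  rewrite gtr0_sg; last by rewrite subr_gt0 lt_neqAle yb.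
  by rewrite ltr0_sg ?subr_lt0// opprK divff.
move: H; rewrite negb_and -leNgt -ltNge => /orP[ya'|by'].
  have {}ya' : y < a by rewrite lt_neqAle ya.
  rewrite !gtr0_sg ?subr_gt0 ?subrr ?mul0r//; exact: lt_le_trans ab.
by rewrite !ltr0_sg ?subr_lt0 ?subrr ?mul0r//; exact: le_lt_trans by'.
Qed.

(** In the limit angle is a quarter of the product of the signs, and its mixed
    difference factors into two half-differences of signs, which are indicators
    of intervals away from the end points. *)
Lemma cvg_box_mass (a b y : R * R) : a.1 <= b.1 -> a.2 <= b.2 ->
  y.1 != a.1 -> y.1 != b.1 -> y.2 != a.2 -> y.2 != b.2 ->
  box_mass (@harmonic R n) a b y @[n --> \oo] -->
    (\1_(`]a.1, b.1]%classic `*` `]a.2, b.2]%classic) y : R).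
Proof.
move=> ab1 ab2 ya1 yb1 ya2 yb2.
have -> : (\1_(`]a.1, b.1]%classic `*` `]a.2, b.2]%classic) y : R) =
    \1_(`]a.1, b.1]%classic) y.1 * \1_(`]a.2, b.2]%classic) y.2.
  by rewrite !indicE in_setX -mulnb natrM.
rewrite -!sgr_sub_half//.
set A1 := Num.sg _; set B1 := Num.sg _; set A2 := Num.sg _; set B2 := Num.sg _.
have -> : (A1 - B1) / 2 * ((A2 - B2) / 2) =
    (A1 * A2 / 4 - A1 * B2 / 4) - (B1 * A2 / 4 - B1 * B2 / 4) by field.
by do ?apply: cvgB; exact: cvg_angle.
Qed.

(** The derivative in s of (4 pi)^-1 log (s^2 + t^2 + e^2), that is, a component of
    the regularised gradient of the fundamental solution of the Laplacian. *)
Definition kern e s t := s / (2 * pi * (s ^+ 2 + t ^+ 2 + e ^+ 2)).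

Lemma kern0_abs s t : `|kern 0 s t| = kern 0 `|s| t.
Proof.
rewrite /kern expr0n !addr0 normrM normfV real_normK ?num_real//; congr (_ / _).
by rewrite ger0_norm// !mulr_ge0 ?pi_ge0// addr_ge0// sqr_ge0.
Qed.

(** The regularisation only enlarges the denominator, so that the singular kernel
    dominates all the regularised ones. *)
Lemma kern_abs_le e s t : `|kern e s t| <= `|kern 0 s t|.
Proof.
have [->|s0] := eqVneq s 0; first by rewrite /kern !mul0r.
have S0 : 0 < s ^+ 2 + t ^+ 2 by rewrite ltr_wpDr ?sqr_ge0// exprn_even_gt0.
have p0 : 0 < 2 * pi :> R by rewrite mulr_gt0 ?pi_gt0.
have N0 : 0 < 2 * pi * (s ^+ 2 + t ^+ 2) by rewrite mulr_gt0.
have N01 : 2 * pi * (s ^+ 2 + t ^+ 2) <= 2 * pi * (s ^+ 2 + t ^+ 2 + e ^+ 2).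
  by rewrite ler_pM2l// lerDl sqr_ge0.
have N1 := lt_le_trans N0 N01.
rewrite /kern expr0n addr0 2!normrM ler_wpM2l// 2!normfV.
by rewrite (gtr0_norm N0) (gtr0_norm N1) lef_pV2.
Qed.

Lemma measurable_kern e d (T : measurableType d) (f g : T -> R) :
  measurable_fun setT f -> measurable_fun setT g ->
  measurable_fun setT (fun x => kern e (f x) (g x)).
Proof.
move=> mf mg; rewrite /kern; apply: measurable_funM => //.
apply: (measurableT_comp (@measurable_inv R)).
apply: measurable_funM => //; apply: measurable_funD => //.
by apply: measurable_funD; apply: measurable_funX.
Qed.

(** On a line at distance |s| from the singularity the kernel has the primitive
    (2 pi)^-1 atan (t / |s|), so its integral is at most 1/2 whatever s is. *)
Lemma integral_kern_segment_le (c d s y : R) :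
  (\int[leb]_(t in `]c, d]) `|kern 0 s (t - y)|%:E <= (2^-1)%:E)%E.
Proof.
have [dc|cd] := ltP d c; first by rewrite set_itv_ge ?integral_set0// bnd_simp -leNgt ltW.
have [s0|s0] := eqVneq s 0.
  by rewrite integral0_eq// => t _; rewrite s0 /kern mul0r normr0.
have a0 : 0 < `|s| by rewrite normr_gt0.
have p0 := pi_gt0 R.
have dF t : is_derive t 1 (fun t => (2 * pi)^-1 * atan (t / `|s|)) `|kern 0 s t|.
  have dc c' : is_derive t 1 (fun=> c' : R) 0 by exact: is_derive_cst.
  have := is_derive1_mul (dc (2 * pi)^-1) (is_derive1_chain (is_derive1_atan _)
    (is_derive1_mul (is_derive_id t 1) (dc `|s|^-1))).
  move/is_derive_eq; apply; rewrite kern0_abs /kern expr0n addr0 /=.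
  move: (`|s|) (pi : R) a0 p0 => r p r0 p0.
  have N : 0 < r ^+ 2 + t ^+ 2 by rewrite ltr_wpDr ?sqr_ge0// exprn_gt0.
  have -> : 1 + (t / r) ^+ 2 = (r ^+ 2 + t ^+ 2) / r ^+ 2.
    by field; rewrite gt_eqF.
  by field; rewrite !gt_eqF.
have df t : derivable (fun t => `|kern 0 s t|) t 1.
  have dc c' : is_derive t 1 (fun=> c' : R) 0 by exact: is_derive_cst.
  under eq_fun do rewrite kern0_abs /kern.
  have D0 : 2 * pi * (`|s| ^+ 2 + t ^+ 2 + 0 ^+ 2) != 0.
    rewrite gt_eqF// expr0n addr0 !mulr_gt0// ltr_wpDr ?sqr_ge0// exprn_gt0//.
  have [+ _] := is_derive1_mul (dc `|s|) (is_derive1_inv (is_derive1_mul (dc (2 * pi))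
    (is_derive1_add (is_derive1_add (dc (`|s| ^+ 2)) (is_derive1_exp 2 (is_derive_id t 1)))
       (dc (0 ^+ 2)))) D0).
  by [].
have -> : (\int[leb]_(t in `]c, d]) `|kern 0 s (t - y)|%:E =
    ((2 * pi)^-1 * atan ((d - y) / `|s|) - (2 * pi)^-1 * atan ((c - y) / `|s|))%:E)%E.
  apply: (@integral_itvoc_FTC (fun t => `|kern 0 s (t - y)|)
    (fun t => (2 * pi)^-1 * atan ((t - y) / `|s|)) _ _ cd) => t.
    exact: is_derive1_translate (dF (t - y)).
  by have [] := is_derive1_translate (derivableP (df (t - y))).
rewrite lee_fin -mulrBr ler_pdivrMl ?mulr_gt0//.
have := atan_ltpi2 ((d - y) / `|s|); have := atan_gtNpi2 ((c - y) / `|s|).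
by lra.
Qed.

End BoxIntegrals.

(** * Uniform local bounds and an integrable weight *)

Section Integrability.
Variable R : realType.
Local Notation leb := (@lebesgue_measure R).
Local Notation mu2 := (@lebesgue_measure R \x @lebesgue_measure R)%E.
Implicit Types (e s t : R).

Lemma measurable_ocitv (I : set (measurableTypeR R)) : ocitv I -> measurable I.
Proof. by move=> oI; exact: sub_sigma_algebra. Qed.

Lemma ocitv_le (I : set R) : ocitv I ->
  exists a b : R, a <= b /\ I = `]a, b]%classic.
Proof.
move=> /ocitvP[->|[[a b] /= ab ->]].
  by exists 0, 0; rewrite set_itvoc0.
by exists a, b; rewrite ltW.
Qed.

Lemma integral_cst_itvoc_lty (a b c : R) : a <= b ->
  (\int[leb]_(t in `]a, b]) c%:E = (c * (b - a))%:E)%E.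
Proof.
move=> ab; rewrite integral_cst//= lebesgue_measure_itv /= lte_fin.
case: ltP => [_|ba]; first by rewrite -EFinD -EFinM.
by rewrite mule0 (@le_anti _ _ a b) ?ab// subrr mulr0.
Qed.

(** The bound of integral_kern_segment_le on the lines parallel to one side is
    integrated along the other side; nothing depends on the centre y. *)
Lemma integral_kern_box_le (I J : set (measurableTypeR R)) : ocitv I -> ocitv J ->
  exists C : R, forall y : R * R,
    (\int[mu2]_(x in I `*` J) `|kern 0 (x.1 - y.1) (x.2 - y.2)|%:E <= C%:E)%E /\
    (\int[mu2]_(x in I `*` J) `|kern 0 (x.2 - y.2) (x.1 - y.1)|%:E <= C%:E)%E.
Proof.
move=> oI oJ; have [a [b [ab IE]]] := ocitv_le oI; have [c [d [cd JE]]] := ocitv_le oJ.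
have mI := measurable_ocitv oI; have mJ := measurable_ocitv oJ.
exists (2^-1 * (b - a) + 2^-1 * (d - c)) => y.
have mk1 : measurable_fun setT (fun x : plane R => `|kern 0 (x.1 - y.1) (x.2 - y.2)|%:E).
  apply/measurable_EFinP; apply: measurableT_comp => //.
  by apply: measurable_kern; apply: measurable_funB.
have mk2 : measurable_fun setT (fun x : plane R => `|kern 0 (x.2 - y.2) (x.1 - y.1)|%:E).
  apply/measurable_EFinP; apply: measurableT_comp => //.
  by apply: measurable_kern; apply: measurable_funB.
split.
- rewrite (integral_setX12 (f := fun x : plane R => `|kern 0 (x.1 - y.1) (x.2 - y.2)|%:E))//.
  apply: (@le_trans _ _ (\int[leb]_(s in I) (2^-1)%:E)%E); last first.
    rewrite IE integral_cst_itvoc_lty// lee_fin lerDl.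
    by rewrite mulr_ge0// subr_ge0.
  apply: ge0_le_integral => //.
  + by move=> s _; apply: integral_ge0 => t _; rewrite lee_fin.
  + by apply: measurable_funTS; apply: (measurable_integral12 mk1) => // x; rewrite lee_fin.
  + by move=> s _ /=; rewrite JE; apply: integral_kern_segment_le.
- rewrite (integral_setX21 (f := fun x : plane R => `|kern 0 (x.2 - y.2) (x.1 - y.1)|%:E))//.
  apply: (@le_trans _ _ (\int[leb]_(s in J) (2^-1)%:E)%E); last first.
    rewrite JE integral_cst_itvoc_lty// lee_fin lerDr.
    by rewrite mulr_ge0// subr_ge0.
  apply: ge0_le_integral => //.
  + by move=> t _; apply: integral_ge0 => s _; rewrite lee_fin.
  + by apply: measurable_funTS; apply: (measurable_integral21 mk2) => // x; rewrite lee_fin.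
  + by move=> t _ /=; rewrite IE; apply: integral_kern_segment_le.
Qed.

Lemma integral_le_of_segments (f : R -> \bar R) (C : \bar R) :
  measurable_fun setT f -> (forall t, 0 <= f t)%E ->
  (forall n : nat, \int[leb]_(t in `[(- n%:R)%R, n%:R%R]) f t <= C)%E ->
  (\int[leb]_t f t <= C)%E.
Proof.
move=> mf f0 fC.
pose F n : set R := `[- n%:R, n%:R]%classic.
have FT : (\bigcup_n F n)%classic = setT.
  apply/seteqP; split => // t _; exists (Num.bound `|t|) => //.
  have : `|t| < (Num.bound `|t|)%:R by exact: archi_boundP.
  by move=> /ltr_normlP[? ?]; rewrite /F /= in_itv /=; apply/andP; split; lra.
rewrite -FT.
have H : (\int[leb]_(t in F n) f t @[n --> \oo] --> \int[leb]_(t in (\bigcup_n F n)%classic) f t)%E.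
  apply: ge0_nondecreasing_set_cvg_integral => //.
  - apply/nondecreasing_seqP => n; rewrite subsetEset => t; rewrite /F /= !in_itv /=.
    by move=> /andP[? ?]; apply/andP; split; rewrite -natr1; lra.
  - by move=> n; exact: measurable_itv.
  - by move=> n; exact: measurable_funTS.
rewrite -(cvg_lim _ H)//; apply: lime_le; first by apply/cvg_ex; eexists; exact: H.
exact: nearW.
Qed.

Lemma is_derive_div_regrad e t : e != 0 ->
  is_derive t 1 (fun t => t / regrad e t) (e ^+ 2 / regrad e t ^+ 3).
Proof.
move=> e0; have r0 := regrad_gt0 t e0.
have := is_derive1_mul (is_derive_id t 1)
  (is_derive1_inv (is_derive_regrad t e0) (lt0r_neq0 r0)).
move/is_derive_eq; apply.
have -> : e ^+ 2 = regrad e t ^+ 2 - t ^+ 2 by rewrite regrad_sqr; ring.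
by field; rewrite gt_eqF.
Qed.

Lemma bracket_ge1 (y : R * R) : 1 <= bracket y.
Proof.
by rewrite -[leLHS]sqrtr1 ler_wsqrtr// lerDl addr_ge0// sqr_ge0.
Qed.

Lemma measurable_sqrt : measurable_fun setT (@Num.sqrt R).
Proof. by apply: continuous_measurable_fun; exact: sqrt_continuous. Qed.

Lemma measurable_bracket : measurable_fun setT (@bracket R : plane R -> R).
Proof.
apply: (measurableT_comp measurable_sqrt); apply: measurable_funD => //.
by apply: measurable_funD; apply: measurable_funX.
Qed.

Lemma div_regrad_le1 e t : e != 0 -> `|t / regrad e t| <= 1.
Proof.
move=> e0; have r0 := regrad_gt0 t e0.
rewrite normrM normfV (gtr0_norm r0) ler_pdivrMr// mul1r -sqrtr_sqr.
by rewrite ler_wsqrtr// lerDl sqr_ge0.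
Qed.

(** With c^2 = 1 + s^2, the function (c^2 + t^2)^(-3/2) has the primitive
    c^-2 t / (c^2 + t^2)^(1/2). *)
Lemma integral_bracket_inv3_segment_le (n : nat) s :
  (\int[leb]_(t in `[(- n%:R)%R, n%:R%R]) ((bracket (s, t))^-1 ^+ 3)%:E <=
    (2 / (1 + s ^+ 2))%:E)%E.
Proof.
pose e := regrad 1 s; have e0 : 0 < e by rewrite regrad_gt0 ?oner_neq0.
have e2 : e ^+ 2 = 1 + s ^+ 2 by rewrite regrad_sqr expr1n addrC.
have bE t : bracket (s, t) = regrad e t.
  by rewrite /bracket /regrad e2; congr Num.sqrt; rewrite /normsq /=; ring.
under eq_integral do rewrite bE.
have en0 : e != 0 by rewrite gt_eqF.
have nn : - n%:R <= n%:R :> R by rewrite ge0_cp// ler0n.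
have -> : (\int[leb]_(t in `[(- n%:R)%R, n%:R%R]) ((regrad e t)^-1 ^+ 3)%:E =
    ((e ^+ 2)^-1 * (n%:R / regrad e n%:R) -
     (e ^+ 2)^-1 * (- n%:R / regrad e (- n%:R)))%:E)%E.
  apply: (@integral_segment_FTC _ (fun t => (regrad e t)^-1 ^+ 3)
    (fun t => (e ^+ 2)^-1 * (t / regrad e t)) _ _ nn) => t.
    have dc : is_derive t 1 (fun=> (e ^+ 2)^-1) 0 by exact: is_derive_cst.
    apply: is_derive_eq (is_derive1_mul dc (is_derive_div_regrad t en0)) _.
    by field; rewrite !gt_eqF// regrad_gt0.
  have [+ _] := is_derive1_exp 3
    (is_derive1_inv (is_derive_regrad t en0) (lt0r_neq0 (regrad_gt0 t en0))).
  by [].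
rewrite lee_fin -mulrBr -e2 mulrC ler_pM2r ?invr_gt0 ?exprn_gt0//.
have := div_regrad_le1 n%:R en0; have := div_regrad_le1 (- n%:R) en0.
by rewrite !ler_norml; lra.
Qed.

(** This weight absorbs the decay factors when psi is compared with its components
    in L^2 and L^3. Integrating out one coordinate leaves at most 2 / (1 + s^2). *)
Lemma integrable_bracket_inv3 :
  mu2.-integrable setT (fun y => ((bracket y)^-1 ^+ 3)%:E).
Proof.
have mf : measurable_fun setT (fun y : plane R => ((bracket y)^-1 ^+ 3)%:E).
  apply/measurable_EFinP; apply: measurable_funX.
  exact: (measurableT_comp (@measurable_inv R) measurable_bracket).
have f0 (y : plane R) : (0 <= ((bracket y)^-1 ^+ 3)%:E)%E.
  by rewrite lee_fin exprn_ge0// invr_ge0 sqrtr_ge0.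
apply/integrableP; split => //.
under eq_integral do rewrite gee0_abs//.
have -> : (\int[mu2]_y ((bracket y)^-1 ^+ 3)%:E =
   \int[leb]_s \int[leb]_t ((bracket (s, t))^-1 ^+ 3)%:E)%E.
  by rewrite -setXTT integral_setX12.
apply: (@le_lt_trans _ _ (2 * pi)%:E); last by rewrite ltry.
have mF : measurable_fun setT (fun s : measurableTypeR R =>
    \int[leb]_t ((bracket (s, t))^-1 ^+ 3)%:E)%E.
  exact: (measurable_integral12 mf f0).
have m1 : measurable_fun setT (fun s : R => (2 / (1 + s ^+ 2))%:E).
  apply/measurable_EFinP; apply: measurable_funM => //.
  apply: (measurableT_comp (@measurable_inv R)); apply: measurable_funD => //.
apply: (@le_trans _ _ (\int[leb]_s (2 / (1 + s ^+ 2))%:E)%E).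
  apply: ge0_le_integral => //.
  - by move=> s _; apply: integral_ge0.
  - move=> s _; apply: integral_le_of_segments => //.
      exact: (measurableT_comp mf (measurable_pair1 s)).
    by move=> n; exact: integral_bracket_inv3_segment_le.
apply: integral_le_of_segments => //.
- by move=> t; rewrite lee_fin divr_ge0// addr_ge0// sqr_ge0.
- move=> n.
  have nn : - n%:R <= n%:R :> R by rewrite ge0_cp// ler0n.
  have -> : (\int[leb]_(s in `[(- n%:R)%R, n%:R%R]) (2 / (1 + s ^+ 2))%:E =
      (2 * atan n%:R - 2 * atan (- n%:R))%:E)%E.
    apply: (@integral_segment_FTC _ (fun s => 2 / (1 + s ^+ 2))
      (fun s => 2 * atan s) _ _ nn) => s.
    have dc (c : R) : is_derive s 1 (fun=> c) 0 by exact: is_derive_cst.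
    have D0 : 1 + s ^+ 2 != 0 by rewrite gt_eqF// ltr_wpDr// sqr_ge0.
    have [+ _] := is_derive1_mul (dc 2) (is_derive1_inv (is_derive1_add (dc 1)
      (is_derive1_exp 2 (is_derive_id s 1))) D0).
    by [].
  rewrite lee_fin.
  have := atan_ltpi2 (n%:R : R); have := atan_gtNpi2 (- n%:R : R).
  by lra.
Qed.

End Integrability.

(** * Dominated convergence and cutoffs *)

Section RealIntegrals.
Variables (d : measure_display) (T : measurableType d) (R : realType).
Variable mu : {measure set T -> \bar R}.
Implicit Types f g : T -> R.

Lemma integrable_dominated f g : measurable_fun setT f ->
  (forall x, `|f x| <= g x) -> mu.-integrable setT (EFin \o g) ->
  mu.-integrable setT (EFin \o f).
Proof.
move=> mf fg ig; apply: (le_integrable _ _ _ ig) => //; first exact/measurable_EFinP.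
by move=> x _ /=; rewrite lee_fin (le_trans (fg x))// ler_norm.
Qed.

Lemma Rintegral_dominated_cvg (f_ : (T -> R)^nat) f g :
  (forall n, measurable_fun setT (f_ n)) -> measurable_fun setT f ->
  {ae mu, forall x, f_ n x @[n --> \oo] --> f x} ->
  (forall n x, `|f_ n x| <= g x) -> mu.-integrable setT (EFin \o g) ->
  \int[mu]_x f_ n x @[n --> \oo] --> \int[mu]_x f x.
Proof.
move=> mf_ mf ff fg ig.
have [] := @dominated_convergence _ _ _ mu setT measurableT
  (fun n => EFin \o f_ n) (EFin \o f) (EFin \o g).
- by move=> n; exact/measurable_EFinP.
- exact/measurable_EFinP.
- by apply: filterS ff => x fx _; apply: cvg_EFin => //; exact: nearW.
- exact: ig.
- by apply: aeW => x n _ /=; rewrite lee_fin.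
move=> iF _ H; apply: fine_cvg; rewrite fineK; first exact: H.
exact: integrable_fin_num.
Qed.

Lemma integrable_mulc (c : R) f : mu.-integrable setT (EFin \o f) ->
  mu.-integrable setT (EFin \o (fun x => c * f x)).
Proof. by move=> If; exact: (integrableZl measurableT c If). Qed.

Lemma integrable_add f g : mu.-integrable setT (EFin \o f) ->
  mu.-integrable setT (EFin \o g) ->
  mu.-integrable setT (EFin \o (fun x => f x + g x)).
Proof. by move=> If Ig; exact: (integrableD measurableT If Ig). Qed.

Lemma integrable_abs f : mu.-integrable setT (EFin \o f) ->
  mu.-integrable setT (EFin \o (fun x => `|f x|)).
Proof. exact: integrable_norm. Qed.

Lemma integrable_measurable f : mu.-integrable setT (EFin \o f) ->
  measurable_fun setT f.
Proof. by move=> /measurable_int/measurable_EFinP. Qed.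

End RealIntegrals.

Section Cutoff.
Variable R : realType.
Implicit Types (e : R) (x y : R * R).

Lemma bracket_sqr y : bracket y ^+ 2 = 1 + normsq y.
Proof. by rewrite sqr_sqrtr// !addr_ge0// sqr_ge0. Qed.

Lemma bracket_gt0 y : 0 < bracket y.
Proof. exact: lt_le_trans (bracket_ge1 y). Qed.

(** The limit of these cutoffs is the positive constant flat 0 1, not 1; the
    constant is divided out of the final identity. *)
Definition cutoff (n : nat) y : R := flat 0 (1 - normsq y / n.+1%:R ^+ 2).

(** The gradient of the cutoff at y is this factor times y. *)
Definition cutoff_slope (n : nat) y : R :=
  - 2 / n.+1%:R ^+ 2 * flat 2 (1 - normsq y / n.+1%:R ^+ 2).

Lemma elementary_sqr (f : R * R -> R) : elementary f ->
  elementary (fun x => f x ^+ 2).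
Proof.
move=> ef; have -> : (fun x => f x ^+ 2) = (fun x => f x * f x).
  by apply/funext => x; rewrite expr2.
exact: elementary_mul.
Qed.

Lemma elementary_normsq : elementary (@normsq R).
Proof.
apply: (elementary_add (f := fun x => x.1 ^+ 2) (g := fun x => x.2 ^+ 2));
  apply: elementary_sqr; constructor.
Qed.

Lemma elementary_cutoff n : elementary (cutoff n).
Proof.
have -> : cutoff n = fun y => flat 0 (1 + (- n.+1%:R ^-2) * normsq y).
  by apply/funext => y; rewrite /cutoff mulNr mulrC.
apply: elementary_flat.
apply: (elementary_add (f := fun=> 1)); first exact: elementary_cst.
apply: (elementary_mul (f := fun=> - n.+1%:R ^-2)); first exact: elementary_cst.
exact: elementary_normsq.
Qed.

Lemma has_grad_sqr (f f1 f2 : R * R -> R) : has_grad f f1 f2 ->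
  has_grad (fun x => f x ^+ 2) (fun x => 2 * f x * f1 x) (fun x => 2 * f x * f2 x).
Proof.
move=> df.
have -> : (fun x => f x ^+ 2) = (fun x => f x * f x).
  by apply/funext => x; rewrite expr2.
have -> : (fun x => 2 * f x * f1 x) = (fun x => f1 x * f x + f x * f1 x).
  by apply/funext => x; ring.
have -> : (fun x => 2 * f x * f2 x) = (fun x => f2 x * f x + f x * f2 x).
  by apply/funext => x; ring.
exact: has_grad_mul.
Qed.

Lemma has_grad_eq (f f1 f2 g1 g2 : R * R -> R) : has_grad f f1 f2 ->
  f1 =1 g1 -> f2 =1 g2 -> has_grad f g1 g2.
Proof. by move=> + /funext <- /funext <-. Qed.

Lemma has_grad_cutoff n : has_grad (cutoff n)
  (fun y => cutoff_slope n y * y.1) (fun y => cutoff_slope n y * y.2).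
Proof.
have gn := has_grad_add (has_grad_sqr (@has_grad_fst R)) (has_grad_sqr (@has_grad_snd R)).
have gi := has_grad_add (has_grad_cst 1) (has_grad_mul (has_grad_cst (- n.+1%:R ^-2)) gn).
have -> : cutoff n = fun y => flat 0 (1 + - n.+1%:R ^-2 * (y.1 ^+ 2 + y.2 ^+ 2)).
  by apply/funext => y; rewrite /cutoff mulNr mulrC.
have E y : 1 - normsq y / n.+1%:R ^+ 2 = 1 + - n.+1%:R ^-2 * (y.1 ^+ 2 + y.2 ^+ 2).
  by rewrite mulNr mulrC.
apply: has_grad_eq (@has_grad_chain _ (flat 0)
    (fun t => flat 2 t - 0%:R * flat 1 t) _ _ _
    (fun x => is_derive_flat 0 _) gi) _ _ => y /=;
  rewrite /cutoff_slope E; ring.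
Qed.

Lemma cutoff_eq0 n y : n.+1%:R ^+ 2 <= normsq y -> cutoff n y = 0.
Proof.
move=> ny; rewrite /cutoff /flat ifF//; apply/negbTE; rewrite -leNgt subr_le0.
by rewrite ler_pdivlMr ?mul1r// exprn_gt0.
Qed.

Lemma cutoff_abs_le n y : `|cutoff n y| <= 1.
Proof.
rewrite ger0_norm ?flat_ge0//.
by have := flat_le 0 (1 - normsq y / n.+1%:R ^+ 2); rewrite fact0.
Qed.

Lemma cvg_natV2 (c : R) : c / n.+1%:R ^+ 2 @[n --> \oo] --> (0 : R).
Proof.
suff : c / n.+1%:R ^+ 2 @[n --> \oo] --> c * (0 * 0) by rewrite !mulr0.
apply: cvgM; first exact: cvg_cst.
under eq_fun do rewrite expr2 invfM.
by apply: cvgM; exact: cvg_harmonic.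
Qed.

Lemma cvg_cutoff y : cutoff n y @[n --> \oo] --> flat 0 (1 : R).
Proof.
have c0 : {for 1, continuous (@flat R 0)}.
  apply: differentiable_continuous; apply/derivable1_diffP.
  by have [] := is_derive_flat 0 (1 : R).
apply: (continuous_cvg _ c0).
suff : 1 - normsq y / n.+1%:R ^+ 2 @[n --> \oo] --> 1 - (0 : R) by rewrite subr0.
by apply: cvgB; [exact: cvg_cst|exact: cvg_natV2].
Qed.

Lemma cutoff_slope_le n y : `|cutoff_slope n y| <= 4 / n.+1%:R ^+ 2.
Proof.
rewrite /cutoff_slope !normrM normrN normfV.
rewrite (ger0_norm (flat_ge0 _ _)) [`|n.+1%:R ^+ 2|]ger0_norm ?exprn_ge0//.
rewrite ger0_norm// mulrAC ler_pM2r ?invr_gt0 ?exprn_gt0//.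
by have := flat_le 2 (1 - normsq y / n.+1%:R ^+ 2); rewrite !factS fact0; lra.
Qed.

Lemma cvg_cutoff_slope y : cutoff_slope n y @[n --> \oo] --> (0 : R).
Proof.
apply/norm_cvg0P; apply: (squeeze_cvgr _ (@cvg_cst _ (0 : R) _ _ _) (cvg_natV2 4)).
by apply: nearW => n; rewrite normr_ge0 cutoff_slope_le.
Qed.

Lemma abs_le_bracket y : `|y.1| <= bracket y /\ `|y.2| <= bracket y.
Proof.
by split; rewrite -sqrtr_sqr ler_wsqrtr// /normsq;
  have := sqr_ge0 y.1; have := sqr_ge0 y.2; lra.
Qed.

(** The slope is at most 4 / (n+1)^2 and vanishes unless <y>^2 <= 2 (n+1)^2, so
    the gradient of the cutoff decays like <y>^-1 uniformly in n. *)
Lemma cutoff_slope_decay n y t : `|t| <= bracket y ->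
  `|cutoff_slope n y * t| * bracket y <= 8.
Proof.
move=> tb; have [nN|Nn] := leP (n.+1%:R ^+ 2) (normsq y).
  rewrite /cutoff_slope /flat ifF ?mulr0 ?mul0r ?normr0 ?mul0r//.
  by apply/negbTE; rewrite -leNgt subr_le0 ler_pdivlMr ?mul1r// exprn_gt0.
have N0 : 0 < n.+1%:R ^+ 2 :> R by rewrite exprn_gt0.
have N1 : 1 <= n.+1%:R ^+ 2 :> R by rewrite exprn_ege1// ler1n.
have b0 := bracket_gt0 y; have b2 := bracket_sqr y.
rewrite normrM -mulrA.
apply: (le_trans (ler_pM _ _ (cutoff_slope_le n y) (ler_wpM2r (ltW b0) tb))) => //.
  by rewrite mulr_ge0// ltW.
rewrite -expr2 b2 mulrAC ler_pdivrMr//; lra.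
Qed.

End Cutoff.

(** * The regularised gradient kernel and its decay *)

Section RegularisedKernel.
Variable R : realType.
Variables (e : R) (x : R * R).
Hypothesis e0 : e != 0.
Implicit Types (s t : R) (y : R * R).

(** With its companion kern_dt, minus the derivatives of kern: the sign is that of
    the derivatives of kern e (x.1 - y.1) (x.2 - y.2) in y. *)
Definition kern_ds s t :=
  (2 * s ^+ 2 - (s ^+ 2 + t ^+ 2 + e ^+ 2)) / (2 * pi * (s ^+ 2 + t ^+ 2 + e ^+ 2) ^+ 2).

Definition kern_dt s t := s * t / (pi * (s ^+ 2 + t ^+ 2 + e ^+ 2) ^+ 2).

Definition K1 y := kern e (x.1 - y.1) (x.2 - y.2).
Definition K2 y := kern e (x.2 - y.2) (x.1 - y.1).

Let den_gt0 s t : 0 < s ^+ 2 + t ^+ 2 + e ^+ 2.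
Proof. by rewrite ltr_wpDl ?addr_ge0 ?sqr_ge0// exprn_even_gt0. Qed.

Let den2pi s t : 2 * pi * (s ^+ 2 + t ^+ 2 + e ^+ 2) != 0.
Proof. by rewrite gt_eqF// !mulr_gt0// pi_gt0. Qed.

(** Both sides are the Laplacian of (4 pi)^-1 log (s^2 + t^2 + e^2). *)
Lemma kern_ds_sum s t : - (kern_ds s t + kern_ds t s) = poisson e s t.
Proof.
have := den_gt0 s t; rewrite /kern_ds /poisson [t ^+ 2 + s ^+ 2]addrC.
have -> : e ^+ 2 = (s ^+ 2 + t ^+ 2 + e ^+ 2) - s ^+ 2 - t ^+ 2 by ring.
move: (_ - s ^+ 2 - t ^+ 2) => E.
have -> : s ^+ 2 + t ^+ 2 + E = (s ^+ 2 + t ^+ 2 + E) by [].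
move: (pi : R) (pi_gt0 R) => p p0 D0.
by field; rewrite !gt_eqF.
Qed.

Lemma elementary_shift1 : elementary (fun y : R * R => x.1 - y.1).
Proof.
have -> : (fun y : R * R => x.1 - y.1) = (fun y => x.1 + (-1) * y.1).
  by apply/funext => y; rewrite mulN1r.
by apply: (elementary_add (f := fun=> x.1)); repeat constructor.
Qed.

Lemma elementary_shift2 : elementary (fun y : R * R => x.2 - y.2).
Proof.
have -> : (fun y : R * R => x.2 - y.2) = (fun y => x.2 + (-1) * y.2).
  by apply/funext => y; rewrite mulN1r.
by apply: (elementary_add (f := fun=> x.2)); repeat constructor.
Qed.

Lemma elementary_kern (f g : R * R -> R) : elementary f -> elementary g ->
  elementary (fun y => kern e (f y) (g y)).
Proof.
move=> ef eg; apply: (elementary_mul (f := f)) => //.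
apply: elementary_inv => //; apply: (elementary_mul (f := fun=> 2 * pi)).
  exact: elementary_cst.
apply: (elementary_add (f := fun y => f y ^+ 2 + g y ^+ 2)).
  by apply: (elementary_add (f := fun y => f y ^+ 2)); exact: elementary_sqr.
exact: elementary_cst.
Qed.

Lemma has_grad_kern (f g : R * R -> R) f1 f2 g1 g2 :
  has_grad f f1 f2 -> has_grad g g1 g2 ->
  has_grad (fun y => kern e (f y) (g y))
    (fun y => - (kern_ds (f y) (g y) * f1 y + kern_dt (f y) (g y) * g1 y))
    (fun y => - (kern_ds (f y) (g y) * f2 y + kern_dt (f y) (g y) * g2 y)).
Proof.
move=> df dg.
have dD := has_grad_mul (has_grad_cst (2 * pi)) (has_grad_add
  (has_grad_add (has_grad_sqr df) (has_grad_sqr dg)) (has_grad_cst (e ^+ 2))).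
have := has_grad_mul df (has_grad_inv (fun y => den2pi (f y) (g y)) dD).
move/has_grad_eq; apply => y; rewrite /kern_ds /kern_dt;
  have := den_gt0 (f y) (g y); have := pi_gt0 R;
  move: (f y) (g y) (f1 y) (f2 y) (g1 y) (g2 y) (pi : R) => s t s1 s2 t1 t2 p p0 D0;
  by field; rewrite !gt_eqF.
Qed.

Lemma has_grad_shift1 : has_grad (fun y : R * R => x.1 - y.1) (fun=> -1) (fun=> 0).
Proof.
have := has_grad_add (has_grad_cst x.1) (has_grad_mul (has_grad_cst (-1)) (@has_grad_fst R)).
have -> : (fun y : R * R => x.1 - y.1) = (fun y => x.1 + (-1) * y.1).
  by apply/funext => y; rewrite mulN1r.
by move/has_grad_eq; apply => y; ring.
Qed.

Lemma has_grad_shift2 : has_grad (fun y : R * R => x.2 - y.2) (fun=> 0) (fun=> -1).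
Proof.
have := has_grad_add (has_grad_cst x.2) (has_grad_mul (has_grad_cst (-1)) (@has_grad_snd R)).
have -> : (fun y : R * R => x.2 - y.2) = (fun y => x.2 + (-1) * y.2).
  by apply/funext => y; rewrite mulN1r.
by move/has_grad_eq; apply => y; ring.
Qed.

Definition dK1 y := kern_ds (x.1 - y.1) (x.2 - y.2).
Definition dK2 y := kern_ds (x.2 - y.2) (x.1 - y.1).
(** The mixed derivative is shared by K1 and K2 because (K1, K2) is a gradient
    field. *)
Definition dK12 y := kern_dt (x.1 - y.1) (x.2 - y.2).

Lemma has_grad_K1 : has_grad K1 dK1 dK12.
Proof.
have := has_grad_kern has_grad_shift1 has_grad_shift2.
by move/has_grad_eq; apply => y; rewrite /dK1 /dK12; ring.
Qed.

Lemma has_grad_K2 : has_grad K2 dK12 dK2.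
Proof.
have := has_grad_kern has_grad_shift2 has_grad_shift1.
move/has_grad_eq; apply => y; rewrite /dK2 /dK12; last by ring.
have -> : kern_dt (x.1 - y.1) (x.2 - y.2) = kern_dt (x.2 - y.2) (x.1 - y.1).
  by rewrite /kern_dt [_ ^+ 2 + _ ^+ 2]addrC [X in X / _]mulrC.
by ring.
Qed.

(** Chosen so that <y>^2 <= growth (|x - y|^2 + e^2): with x and e fixed, decay
    away from x becomes decay in <y>. *)
Definition growth : R := 2 + (1 + 2 * normsq x) / e ^+ 2.

Lemma growth_ge1 : 1 <= growth.
Proof.
rewrite /growth; suff : 0 <= (1 + 2 * normsq x) / e ^+ 2 by lra.
by rewrite divr_ge0 ?sqr_ge0// addr_ge0// mulr_ge0// addr_ge0// sqr_ge0.
Qed.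

Lemma bracket_le_growth y :
  bracket y ^+ 2 <= growth * ((x.1 - y.1) ^+ 2 + (x.2 - y.2) ^+ 2 + e ^+ 2).
Proof.
rewrite bracket_sqr; set z := _ ^+ 2 + _ ^+ 2.
have z0 : 0 <= z by rewrite addr_ge0// sqr_ge0.
have H1 : 1 + normsq y <= (1 + 2 * normsq x) + 2 * z.
  rewrite /normsq /z; have := sqr_ge0 (2 * x.1 - y.1); have := sqr_ge0 (2 * x.2 - y.2).
  by nra.
apply: (le_trans H1); rewrite /growth; set A := 1 + 2 * normsq x.
have A0 : 0 <= A by rewrite addr_ge0// mulr_ge0// addr_ge0// sqr_ge0.
have e2 : 0 < e ^+ 2 by rewrite exprn_even_gt0.
have HA : A <= A / e ^+ 2 * (z + e ^+ 2).
  by rewrite mulrDr divfK ?gt_eqF// lerDr mulr_ge0// divr_ge0// ltW.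
by rewrite mulrDl; lra.
Qed.

Let pi_ge1 : 1 <= pi :> R.
Proof. by have := pi_ge2 R; lra. Qed.

Lemma kern_ds_le s t : `|kern_ds s t| * (s ^+ 2 + t ^+ 2 + e ^+ 2) <= 1.
Proof.
have D0 := den_gt0 s t; set D := _ + _ + _ in D0 *.
have p2 : 0 < 2 * pi :> R by rewrite mulr_gt0// pi_gt0.
have DD : 0 < 2 * pi * D ^+ 2 by rewrite mulr_gt0// exprn_gt0.
rewrite /kern_ds -/D normrM normfV (gtr0_norm DD) mulrAC ler_pdivrMr// mul1r.
rewrite [D ^+ 2]expr2 mulrA ler_pM2r//.
have H : `|2 * s ^+ 2 - D| <= D.
  rewrite ler_norml /D; have := sqr_ge0 s; have := sqr_ge0 t; have := sqr_ge0 e.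
  by lra.
apply: (le_trans H); rewrite ler_peMl ?ltW//.
by have := pi_ge1; lra.
Qed.

Lemma kern_dt_le s t : `|kern_dt s t| * (s ^+ 2 + t ^+ 2 + e ^+ 2) <= 1.
Proof.
have D0 := den_gt0 s t; set D := _ + _ + _ in D0 *.
have DD : 0 < pi * D ^+ 2 by rewrite mulr_gt0 ?pi_gt0// exprn_gt0.
rewrite /kern_dt -/D normrM normfV (gtr0_norm DD) mulrAC ler_pdivrMr// mul1r.
rewrite [D ^+ 2]expr2 mulrA ler_pM2r//.
have H : `|s * t| <= D.
  rewrite ler_norml /D; have := sqr_ge0 (s - t); have := sqr_ge0 (s + t).
  by have := sqr_ge0 e; nra.
by apply: (le_trans H); rewrite ler_peMl ?pi_ge1// ltW.
Qed.

Lemma kern_sqr_le s t : kern e s t ^+ 2 * (s ^+ 2 + t ^+ 2 + e ^+ 2) <= 1.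
Proof.
have D0 := den_gt0 s t; rewrite /kern; set D := _ + _ + _ in D0 *.
have -> : (s / (2 * pi * D)) ^+ 2 * D = s ^+ 2 / ((2 * pi) ^+ 2 * D).
  by move: (pi : R) (pi_gt0 R) => p p0; field; rewrite !gt_eqF.
have p1 : 1 <= (2 * pi) ^+ 2 :> R.
  by rewrite exprn_ege1//; have := pi_ge1; lra.
have p0 : 0 < (2 * pi) ^+ 2 :> R by exact: lt_le_trans p1.
rewrite ler_pdivrMr; last by rewrite mulr_gt0.
rewrite mul1r.
apply: (@le_trans _ _ D); last by rewrite ler_peMl// ltW.
by rewrite /D; have := sqr_ge0 t; have := sqr_ge0 e; lra.
Qed.

Lemma dK_decay y : [/\ `|dK1 y| * bracket y ^+ 2 <= growth,
  `|dK2 y| * bracket y ^+ 2 <= growth & `|dK12 y| * bracket y ^+ 2 <= growth].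
Proof.
have H u D : 0 < D -> bracket y ^+ 2 <= growth * D -> `|u| * D <= 1 ->
    `|u| * bracket y ^+ 2 <= growth.
  move=> D0 bD uD; apply: (le_trans (ler_wpM2l _ bD)) => //.
  by rewrite mulrCA ler_piMr// (le_trans ler01)// growth_ge1.
have B := bracket_le_growth y; split.
- exact: H (den_gt0 _ _) B (kern_ds_le _ _).
- apply: H (den_gt0 _ _) _ (kern_ds_le _ _).
  by apply: (le_trans B); rewrite [X in _ * (X + _)]addrC.
- exact: H (den_gt0 _ _) B (kern_dt_le _ _).
Qed.

Lemma K_decay y :
  `|K1 y| * bracket y <= growth /\ `|K2 y| * bracket y <= growth.
Proof.
have g1 := growth_ge1; have b0 := bracket_gt0 y.
have H u D : 0 < D -> bracket y ^+ 2 <= growth * D -> u ^+ 2 * D <= 1 ->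
    `|u| * bracket y <= growth.
  move=> D0 bD uD.
  rewrite -(@ler_pXn2r _ 2)// ?nnegrE ?mulr_ge0 ?(ltW b0)//; last by lra.
  rewrite exprMn real_normK ?num_real//.
  apply: (le_trans (ler_wpM2l (sqr_ge0 u) bD)).
  rewrite mulrCA; apply: (@le_trans _ _ growth).
    by rewrite ler_piMr//; lra.
  by rewrite expr2 ler_peMr//; lra.
have B := bracket_le_growth y; split.
- exact: H (den_gt0 _ _) B (kern_sqr_le _ _).
- apply: H (den_gt0 _ _) _ (kern_sqr_le _ _).
  by apply: (le_trans B); rewrite [X in _ * (X + _)]addrC.
Qed.

End RegularisedKernel.

(** * The regularised representation at a point *)

Section TestFunctions.
Variable R : realType.
Local Notation mu2 := (@lebesgue_measure R \x @lebesgue_measure R)%E.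

Definition real_test (chi : R * R -> R) :=
  smooth chi /\ compact (closure [set x | chi x != 0]).

Lemma elementary_partial k (f : R * R -> R) :
  elementary f -> elementary (partial k f).
Proof.
move=> /elementary_grad[f1 [f2 [e1 e2 df]]].
by have [p1 p2] := has_grad_partial df; case: k; rewrite ?p1 ?p2.
Qed.

Lemma real_test_cutoff n (f : R * R -> R) : elementary f ->
  real_test (fun y => f y * cutoff n y).
Proof.
move=> ef; split.
  apply: elementary_smooth; apply: elementary_mul => //; exact: elementary_cutoff.
pose N : R := n.+1%:R.
pose B : set (R * R) := `[(- N), N]%classic `*` `[(- N), N]%classic.
have cB : compact B by apply: compact_setX; exact: segment_compact.
apply: (@subclosed_compact _ _ B) => //; first exact: closed_closure.
rewrite (closure_id B).1; last by apply: compact_closed => //; exact: norm_hausdorff.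
apply: closureS => y /=; apply: contraNP => yB.
suff -> : cutoff n y = 0 by rewrite mulr0.
apply: cutoff_eq0; rewrite leNgt; apply/negP => yN; apply: yB.
have N0 : 0 <= N by rewrite ler0n.
have H (u v : R) : u ^+ 2 + v ^+ 2 < N ^+ 2 -> - N <= u <= N.
  move=> uv; rewrite -ler_norml -(@ler_pXn2r _ 2)// ?nnegrE//.
  by rewrite real_normK ?num_real//; have := sqr_ge0 v; lra.
by split; rewrite /= in_itv /=; [apply: (H _ y.2)|apply: (H _ y.1); rewrite addrC].
Qed.

End TestFunctions.

Section Representation.
Variable R : realType.
Local Notation mu2 := (@lebesgue_measure R \x @lebesgue_measure R)%E.
Variables p r a b : plane R -> R.
Hypotheses (mp : measurable_fun setT p) (mr : measurable_fun setT r).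
Hypothesis ip : mu2.-integrable setT (EFin \o (fun y => (bracket y)^-1 ^+ 2 * p y)).
Hypothesis ir : mu2.-integrable setT (EFin \o (fun y => (bracket y)^-1 ^+ 2 * r y)).
Hypothesis ia : mu2.-integrable setT (EFin \o a).
Hypothesis ib : mu2.-integrable setT (EFin \o b).
Hypothesis weak1 : forall chi, real_test chi ->
  \int[mu2]_y (partial false chi y * r y + partial true chi y * p y - chi y * a y) = 0.
Hypothesis weak2 : forall chi, real_test chi ->
  \int[mu2]_y (partial false chi y * p y - partial true chi y * r y + chi y * b y) = 0.

Definition majorant (y : plane R) := `|(bracket y)^-1 ^+ 2 * p y| +
  `|(bracket y)^-1 ^+ 2 * r y| + `|a y| + `|b y|.

Lemma integrable_majorant (C : R) :
  mu2.-integrable setT (EFin \o (fun y => C * majorant y)).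
Proof.
apply: integrable_mulc; apply: integrable_add; last exact: integrable_abs.
apply: integrable_add; last exact: integrable_abs.
by apply: integrable_add; exact: integrable_abs.
Qed.

(** Only <y>^-2 p and <y>^-2 r are integrable, so the coefficients of p and r have
    to decay like <y>^-2, while those of a and b need only be bounded. *)
Lemma combination_le (C u v c d : R) (y : plane R) :
  `|u| * bracket y ^+ 2 <= C -> `|v| * bracket y ^+ 2 <= C ->
  `|c| <= C -> `|d| <= C ->
  `|u * p y + v * r y + c * a y + d * b y| <= C * majorant y.
Proof.
move=> uC vC cC dC; have b0 := bracket_gt0 y.
have H w q : `|w| * bracket y ^+ 2 <= C -> `|w * q| <= C * `|(bracket y)^-1 ^+ 2 * q|.
  move=> wC; rewrite 2!normrM mulrA ler_wpM2r//.
  rewrite exprVn [X in C * X]ger0_norm ?invr_ge0 ?sqr_ge0//.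
  by rewrite ler_pdivlMr// exprn_gt0.
rewrite /majorant !mulrDr.
apply: (le_trans (ler_normD _ _)); apply: lerD; last by rewrite normrM ler_wpM2r.
apply: (le_trans (ler_normD _ _)); apply: lerD; last by rewrite normrM ler_wpM2r.
by apply: (le_trans (ler_normD _ _)); apply: lerD; exact: H.
Qed.

Lemma measurable_combination (u v c d : plane R -> R) :
  measurable_fun setT u -> measurable_fun setT v ->
  measurable_fun setT c -> measurable_fun setT d ->
  measurable_fun setT (fun y => u y * p y + v y * r y + c y * a y + d y * b y).
Proof.
move=> mu mv mc md.
have ma := integrable_measurable ia; have mb := integrable_measurable ib.
apply: measurable_funD; last exact: measurable_funM.
apply: measurable_funD; last exact: measurable_funM.
by apply: measurable_funD; exact: measurable_funM.
Qed.

(** The weak equations state d_1 r + d_2 p = - a and d_1 p - d_2 r = b. Tested on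
    the components K2 and K1 of the gradient kernel and added, they give the
    Laplacian of its potential, which is poisson, in front of p, while r is
    multiplied by the curl of a gradient, which is 0. The kernels become test
    functions after multiplication by a cutoff; the terms with the gradient of
    the cutoff carry one factor <y>^-1 from the kernel and one from the cutoff,
    so they are dominated and tend to 0. *)
Lemma regularised_identity e (x : R * R) : e != 0 ->
  \int[mu2]_y (poisson e (x.1 - y.1) (x.2 - y.2) * p y +
    kern e (x.2 - y.2) (x.1 - y.1) * a y - kern e (x.1 - y.1) (x.2 - y.2) * b y) = 0.
Proof.
move=> e0.
have eK1 : elementary (K1 e x).
  exact: elementary_kern (elementary_shift1 x) (elementary_shift2 x).
have eK2 : elementary (K2 e x).
  exact: elementary_kern (elementary_shift2 x) (elementary_shift1 x).
have [pK11 pK12] := has_grad_partial (has_grad_K1 x e0).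
have [pK21 pK22] := has_grad_partial (has_grad_K2 x e0).
have me (f : R * R -> R) : elementary f -> measurable_fun setT (f : plane R -> R).
  exact: measurable_elementary.
have mK1 := me _ eK1; have mK2 := me _ eK2.
have mdK1 : measurable_fun setT (dK1 e x : plane R -> R).
  by apply: me; rewrite -pK11; exact: elementary_partial.
have mdK2 : measurable_fun setT (dK2 e x : plane R -> R).
  by apply: me; rewrite -pK22; exact: elementary_partial.
have mdK12 : measurable_fun setT (dK12 e x : plane R -> R).
  by apply: me; rewrite -pK12; exact: elementary_partial.
have mP : measurable_fun setT (fun y : plane R => poisson e (x.1 - y.1) (x.2 - y.2)).
  have -> : (fun y : plane R => poisson e (x.1 - y.1) (x.2 - y.2)) =
      (fun y => - (dK1 e x y + dK2 e x y)).
    by apply/funext => y; rewrite kern_ds_sum.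
  by apply: measurable_funN; exact: measurable_funD.
have g1 := growth_ge1 e x; set g := growth e x in g1.
have dKle y : [/\ `|dK1 e x y| * bracket y ^+ 2 <= g,
    `|dK2 e x y| * bracket y ^+ 2 <= g & `|dK12 e x y| * bracket y ^+ 2 <= g].
  exact: dK_decay.
have Kle y : `|K1 e x y| <= g /\ `|K2 e x y| <= g.
  have b1 := bracket_ge1 y.
  by have [k1 k2] := K_decay x e0 y; split;
    [apply: le_trans k1|apply: le_trans k2]; rewrite ler_peMr.
pose s n (k : bool) (y : R * R) : R := cutoff_slope n y * (if k then y.2 else y.1).
have pcut n : (partial false (cutoff n) = s n false) /\ (partial true (cutoff n) = s n true).
  exact: has_grad_partial (has_grad_cutoff n).
have ms n k : measurable_fun setT (s n k : plane R -> R).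
  by case: k; [rewrite -(pcut n).2|rewrite -(pcut n).1]; apply: me;
    apply: elementary_partial; exact: elementary_cutoff.
have mcut n : measurable_fun setT (cutoff n : plane R -> R).
  by apply: me; exact: elementary_cutoff.
have Kslope n k y : `|K1 e x y * s n k y| * bracket y ^+ 2 <= 8 * g /\
    `|K2 e x y * s n k y| * bracket y ^+ 2 <= 8 * g.
  have sb : `|s n k y| * bracket y <= 8.
    by apply: cutoff_slope_decay; have [] := abs_le_bracket y; case: k.
  have b0 := bracket_gt0 y.
  have [k1 k2] := K_decay x e0 y.
  by split; rewrite normrM expr2 mulrACA [8 * g]mulrC ler_pM// mulr_ge0// ltW.
have cut1 n y (u : R) : `|u| * bracket y ^+ 2 <= g -> `|u * cutoff n y| * bracket y ^+ 2 <= g.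
  move=> ug; rewrite normrM mulrAC; apply: le_trans ug; rewrite ler_piMr//.
    by rewrite mulr_ge0// sqr_ge0.
  exact: cutoff_abs_le.
have sum_le (u v : R) (A B c : R) : `|u| * c <= A -> `|v| * c <= B -> 0 <= c ->
    `|u + v| * c <= A + B.
  move=> uA vB c0; apply: le_trans (lerD uA vB).
  by rewrite -mulrDl ler_wpM2r// ler_normD.
(* The weak equations tested on - K2 cutoff and on - K1 cutoff, sorted by p, r,
   a and b.  In the sum the terms in dK12 * r cancel. *)
pose F1 n (y : plane R) : R := - (dK2 e x y * cutoff n y + K2 e x y * s n true y) * p y +
   - (dK12 e x y * cutoff n y + K2 e x y * s n false y) * r y +
   (K2 e x y * cutoff n y) * a y + 0 * b y.
pose F2 n (y : plane R) : R := - (dK1 e x y * cutoff n y + K1 e x y * s n false y) * p y +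
   (dK12 e x y * cutoff n y + K1 e x y * s n true y) * r y +
   0 * a y + - (K1 e x y * cutoff n y) * b y.
have int1 n : \int[mu2]_y F1 n y = 0.
  have eN : elementary (fun y => - K2 e x y).
    have -> : (fun y => - K2 e x y) = (fun y => (-1) * K2 e x y).
      by apply/funext => y; rewrite mulN1r.
    by apply: (elementary_mul (f := fun=> -1)) => //; exact: elementary_cst.
  have gN : has_grad (fun y => - K2 e x y) (fun y => - dK12 e x y) (fun y => - dK2 e x y).
    have -> : (fun y => - K2 e x y) = (fun y => (-1) * K2 e x y).
      by apply/funext => y; rewrite mulN1r.
    by apply: has_grad_eq (has_grad_mul (has_grad_cst (-1)) (has_grad_K2 x e0)) _ _ => y; ring.
  rewrite -[RHS](weak1 (real_test_cutoff n eN)).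
  have [-> ->] := has_grad_partial (has_grad_mul gN (has_grad_cutoff n)).
  by apply: eq_Rintegral => y _; rewrite /F1 /s; ring.
have int2 n : \int[mu2]_y F2 n y = 0.
  have eN : elementary (fun y => - K1 e x y).
    have -> : (fun y => - K1 e x y) = (fun y => (-1) * K1 e x y).
      by apply/funext => y; rewrite mulN1r.
    by apply: (elementary_mul (f := fun=> -1)) => //; exact: elementary_cst.
  have gN : has_grad (fun y => - K1 e x y) (fun y => - dK1 e x y) (fun y => - dK12 e x y).
    have -> : (fun y => - K1 e x y) = (fun y => (-1) * K1 e x y).
      by apply/funext => y; rewrite mulN1r.
    by apply: has_grad_eq (has_grad_mul (has_grad_cst (-1)) (has_grad_K1 x e0)) _ _ => y; ring.
  rewrite -[RHS](weak2 (real_test_cutoff n eN)).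
  have [-> ->] := has_grad_partial (has_grad_mul gN (has_grad_cutoff n)).
  by apply: eq_Rintegral => y _; rewrite /F2 /s; ring.
have bK (n : nat) y : `|K1 e x y * cutoff n y| <= g /\ `|K2 e x y * cutoff n y| <= g.
  have [k1 k2] := Kle y; have c1 := cutoff_abs_le n y.
  by split; rewrite normrM; [apply: le_trans k1|apply: le_trans k2]; rewrite ler_piMr.
(* The constant 9 g is g for the derivatives of the kernel and 8 g for those of
   the cutoff. *)
have F1le n y : `|F1 n y| <= (9 * g) * majorant y.
  have b2 : 0 <= bracket y ^+ 2 by exact: sqr_ge0.
  have [d1 d2 d12] := dKle y; have [k1 k2] := bK n y.
  have [_ st] := Kslope n true y; have [_ sf] := Kslope n false y.
  apply: combination_le.
  - by rewrite normrN; have := sum_le _ _ _ _ _ (cut1 n _ _ d2) st b2; lra.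
  - by rewrite normrN; have := sum_le _ _ _ _ _ (cut1 n _ _ d12) sf b2; lra.
  - by lra.
  - by rewrite normr0; lra.
have F2le n y : `|F2 n y| <= (9 * g) * majorant y.
  have b2 : 0 <= bracket y ^+ 2 by exact: sqr_ge0.
  have [d1 d2 d12] := dKle y; have [k1 k2] := bK n y.
  have [st _] := Kslope n true y; have [sf _] := Kslope n false y.
  apply: combination_le.
  - by rewrite normrN; have := sum_le _ _ _ _ _ (cut1 n _ _ d1) sf b2; lra.
  - by have := sum_le _ _ _ _ _ (cut1 n _ _ d12) st b2; lra.
  - by rewrite normr0; lra.
  - by rewrite normrN; lra.
have m0 : measurable_fun setT (fun _ : plane R => (0 : R)) by exact: measurable_cst.
have mF1 n : measurable_fun setT (F1 n).
  apply: measurable_combination => //; last exact: measurable_funM.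
  - by apply: measurable_funN; apply: measurable_funD; exact: measurable_funM.
  - by apply: measurable_funN; apply: measurable_funD; exact: measurable_funM.
have mF2 n : measurable_fun setT (F2 n).
  apply: measurable_combination => //.
  - by apply: measurable_funN; apply: measurable_funD; exact: measurable_funM.
  - by apply: measurable_funD; exact: measurable_funM.
  - by apply: measurable_funN; exact: measurable_funM.
pose F n (y : plane R) : R := F1 n y + F2 n y.
have int0 n : \int[mu2]_y F n y = 0.
  rewrite RintegralD ?int1 ?int2 ?addr0//.
  - exact: integrable_dominated (mF1 n) (F1le n) (integrable_majorant _).
  - exact: integrable_dominated (mF2 n) (F2le n) (integrable_majorant _).
pose L (y : plane R) : R := poisson e (x.1 - y.1) (x.2 - y.2) * p y + 0 * r y +
  K2 e x y * a y + - K1 e x y * b y.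
have mL : measurable_fun setT L.
  by apply: measurable_combination => //; exact: measurable_funN.
have c0 : 0 < flat 0 (1 : R) by rewrite /flat ltr01 expr0 mul1r expR_gt0.
have cF y : F n y @[n --> \oo] --> flat 0 1 * L y.
  have cs k : s n k y @[n --> \oo] --> 0 * (if k then y.2 else y.1).
    by apply: cvgM; [exact: cvg_cutoff_slope|exact: cvg_cst].
  have FE n : F n y = L y * cutoff n y - (K1 e x y * s n false y + K2 e x y * s n true y) * p y
     + (K1 e x y * s n true y - K2 e x y * s n false y) * r y.
    by rewrite /F /F1 /F2 /L -(kern_ds_sum e0) -/(dK1 e x y) -/(dK2 e x y); ring.
  under eq_fun do rewrite FE.
  have -> : flat 0 1 * L y = L y * flat 0 1 -
    (K1 e x y * (0 * y.1) + K2 e x y * (0 * y.2)) * p y +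
    (K1 e x y * (0 * y.2) - K2 e x y * (0 * y.1)) * r y by ring.
  have cK (K : R) k : K * s n k y @[n --> \oo] --> K * (0 * (if k then y.2 else y.1)).
    by apply: cvgM; [exact: cvg_cst|exact: cs].
  apply: cvgD; first apply: cvgB.
  - by apply: cvgM; [exact: cvg_cst|exact: cvg_cutoff].
  - apply: cvgM; last exact: cvg_cst.
    by apply: cvgD; [exact: (cK _ false)|exact: (cK _ true)].
  - apply: cvgM; last exact: cvg_cst.
    by apply: cvgB; [exact: (cK _ true)|exact: (cK _ false)].
have lim : \int[mu2]_y F n y @[n --> \oo] --> \int[mu2]_y (flat 0 1 * L y).
  apply: (@Rintegral_dominated_cvg _ _ _ mu2 F _ (fun y => (18 * g) * majorant y)).
  - by move=> n; exact: measurable_funD.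
  - exact: measurable_funM.
  - exact: aeW.
  - move=> n y; apply: (le_trans (ler_normD _ _)).
    by apply: (le_trans (lerD (F1le n y) (F2le n y))); rewrite -mulrDl -mulrDl; lra.
  - exact: integrable_majorant.
have iL : mu2.-integrable setT (EFin \o L).
  apply: (integrable_dominated mL _ (integrable_majorant (9 * g))) => y.
  have b2 : 0 <= bracket y ^+ 2 by exact: sqr_ge0.
  have [d1 d2 d12] := dKle y; have [k1 k2] := Kle y.
  apply: combination_le; rewrite ?normr0 ?mul0r ?normrN; [|lra..].
  by rewrite -(kern_ds_sum e0) normrN; have := sum_le _ _ _ _ _ d1 d2 b2; lra.
have L0 : flat 0 1 * \int[mu2]_y L y = 0.
  rewrite -RintegralZl// -(cvg_lim _ lim)//.
  by rewrite (_ : (fun n => _) = fun=> 0) ?lim_cst//; apply/funext => n; exact: int0.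
move/eqP: L0; rewrite mulf_eq0 gt_eqF//= => /eqP <-.
by apply: eq_Rintegral => y _; rewrite /L /K1 /K2; ring.
Qed.

End Representation.

(** * Fubini for real functions and a Schur test *)

Section RealFubini.
Variables (d1 d2 : measure_display) (T1 : measurableType d1) (T2 : measurableType d2).
Variable R : realType.
Variable m1 : {sigma_finite_measure set T1 -> \bar R}.
Variable m2 : {sigma_finite_measure set T2 -> \bar R}.
Variable f : T1 * T2 -> R.
Hypothesis If : (m1 \x m2)%E.-integrable setT (EFin \o f).

Let fine_integral d (T : measurableType d) (mu : {measure set T -> \bar R})
    (F : T -> \bar R) : mu.-integrable setT F ->
  mu.-integrable setT (EFin \o (fun x => fine (F x))) /\
  \int[mu]_x fine (F x) = fine (\int[mu]_x F x)%E.
Proof.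
move=> iF; have mF := measurable_int mu iF.
have mfF : measurable_fun setT (EFin \o (fun x => fine (F x))).
  by apply/measurable_EFinP; exact: measurableT_comp.
have ae : ae_eq mu setT F (EFin \o (fun x => fine (F x))).
  have := integrable_ae measurableT iF; apply: filterS => x /(_ Logic.I) Fx _ /=.
  by rewrite fineK.
split; last first.
  by rewrite /Rintegral; congr fine; apply: ae_eq_integral => //; exact: ae_eq_sym.
apply: (le_integrable measurableT _ _ iF) => // x _ /=.
by case: (F x) => [r| |] /=; rewrite ?lexx ?normr0 ?leey.
Qed.

Lemma Rintegral_fubini12 :
  \int[m1]_x \int[m2]_y f (x, y) = \int[(m1 \x m2)%E]_z f z.
Proof.
have [_ E] := fine_integral (integrable_fubini_F If).
by apply: (etrans E); rewrite (integral12_prod_meas1 If).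
Qed.

Lemma integrable_fubini12 :
  m1.-integrable setT (EFin \o (fun x => \int[m2]_y f (x, y))).
Proof. by have [] := fine_integral (integrable_fubini_F If). Qed.

Lemma integrable_fubini_G : m2.-integrable setT (fubini_G m1 (EFin \o f)).
Proof.
apply/integrableP; split; first exact: measurable_fubini_G If.
have mf := measurable_int _ If.
apply: (@le_lt_trans _ _ (\int[m2]_y fubini_G m1 (abse \o (EFin \o f)) y)%E).
  apply: ge0_le_integral => //.
  - by apply: measurableT_comp => //; exact: measurable_fubini_G If.
  - have maf : measurable_fun setT (abse \o (EFin \o f)) by exact: measurableT_comp.
    by apply: (measurable_fun_fubini_tonelli_G _ maf) => z; exact: abse_ge0.
  - move=> y _; apply: le_abse_integral => //.
    exact: (measurableT_comp mf (measurable_pair2 y)).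
by have /integrable21ltyP := If; apply.
Qed.

Lemma Rintegral_fubini21 :
  \int[m2]_y \int[m1]_x f (x, y) = \int[(m1 \x m2)%E]_z f z.
Proof.
have [_ E] := fine_integral integrable_fubini_G.
by apply: (etrans E); rewrite (integral21_prod_meas1 If).
Qed.

End RealFubini.

Section SchurTest.
Variables (d1 d2 : measure_display) (T1 : measurableType d1) (T2 : measurableType d2).
Variable R : realType.
Variable m1 : {sigma_finite_measure set T1 -> \bar R}.
Variable m2 : {sigma_finite_measure set T2 -> \bar R}.

(** Tonelli with the integral in x performed first, where the weight W bounds the
    kernel. *)
Lemma integrable_kernel_mul (M : T1 * T2 -> R) (f W : T2 -> R) :
  measurable_fun setT M -> measurable_fun setT f ->
  (forall y, \int[m1]_x `|M (x, y)|%:E <= (W y)%:E)%E ->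
  m2.-integrable setT (EFin \o (fun y => W y * f y)) ->
  (m1 \x m2)%E.-integrable setT (EFin \o (fun z => M z * f z.2)).
Proof.
move=> mM mf MW iWf.
have mMf : measurable_fun setT (EFin \o (fun z : T1 * T2 => M z * f z.2)).
  apply/measurable_EFinP; apply: measurable_funM => //.
  exact: (measurableT_comp mf measurable_snd).
apply/(integrable21ltyP _ _ mMf).
have [_] := integrableP _ _ _ iWf; apply: le_lt_trans.
apply: ge0_le_integral => //.
- by move=> y _; exact: integral_ge0.
- apply: (measurable_fun_fubini_tonelli_G (fun z => `|(M z * f z.2)%:E|%E)) => //.
  exact: measurableT_comp.
- by apply: measurableT_comp => //; exact: measurable_int iWf.
- move=> y _ /=.
  have mMy : measurable_fun setT (fun x => M (x, y)).
    exact: (measurableT_comp mM (measurable_pair2 y)).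
  under eq_integral do rewrite normrM mulrC EFinM.
  rewrite ge0_integralZl//; last by apply/measurable_EFinP; exact: measurableT_comp.
  rewrite normrM mulrC EFinM lee_wpmul2l//.
  by apply: (le_trans (MW y)); rewrite lee_fin ler_norm.
Qed.

End SchurTest.

(** * Box averages of the Poisson-type kernel *)

Section BoxWeights.
Variable R : realType.
Local Notation leb := (@lebesgue_measure R).
Local Notation mu2 := (@lebesgue_measure R \x @lebesgue_measure R)%E.

(** Combines <y>^2 <= 2 <x>^2 (1 + |x - y|^2) with the bound
    |z|^2 poisson(z) <= 1, which is uniform in e. *)
Lemma poisson_weighted_le e (x y : R * R) : e != 0 ->
  poisson e (x.1 - y.1) (x.2 - y.2) <=
  2 * (1 + normsq x) * (bracket y)^-1 ^+ 2 * (1 + poisson e (x.1 - y.1) (x.2 - y.2)).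
Proof.
move=> e0; set z1 := x.1 - y.1; set z2 := x.2 - y.2; set P := poisson _ _ _.
have b0 : 0 < bracket y ^+ 2 by rewrite exprn_gt0// bracket_gt0.
have P0 : 0 <= P by exact: poisson_ge0.
have nx : 0 <= normsq x by rewrite addr_ge0// sqr_ge0.
have zs : 0 <= z1 ^+ 2 + z2 ^+ 2 by rewrite addr_ge0// sqr_ge0.
have e2 : 0 < e ^+ 2 by rewrite exprn_even_gt0.
have PD : P * (1 + (z1 ^+ 2 + z2 ^+ 2)) <= 1 + P.
  rewrite mulrDr mulr1 addrC lerD2r /P /poisson.
  set D := _ ^+ 2 + _ + _; have D0 : 0 < D by rewrite ltr_wpDl.
  have DD : 0 < pi * D ^+ 2 by rewrite mulr_gt0 ?pi_gt0// exprn_gt0.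
  rewrite mulrAC ler_pdivrMr// mul1r.
  apply: (@le_trans _ _ (D ^+ 2)).
    rewrite [D ^+ 2]expr2; apply: ler_pM => //; [exact: ltW| |by rewrite lerDl ltW].
    by rewrite lerDr.
  by rewrite ler_peMl ?sqr_ge0//; have := pi_ge2 R; lra.
have by2 : bracket y ^+ 2 <= 2 * (1 + normsq x) * (1 + (z1 ^+ 2 + z2 ^+ 2)).
  rewrite bracket_sqr; apply: (@le_trans _ _ (1 + 2 * normsq x + 2 * (z1 ^+ 2 + z2 ^+ 2))).
    rewrite /normsq /z1 /z2; have := sqr_ge0 (2 * x.1 - y.1); have := sqr_ge0 (2 * x.2 - y.2).
    by nra.
  by have := mulr_ge0 nx zs; nra.
rewrite exprVn mulrAC ler_pdivlMr//.
apply: (le_trans (ler_wpM2l P0 by2)).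
rewrite mulrCA ler_wpM2l//.
by rewrite mulr_ge0// addr_ge0.
Qed.

Lemma lebesgue_box (a b : R * R) : a.1 <= b.1 -> a.2 <= b.2 ->
  mu2 (`]a.1, b.1]%classic `*` `]a.2, b.2]%classic) = ((b.1 - a.1) * (b.2 - a.2))%:E.
Proof.
move=> ab1 ab2; rewrite product_measure1E; [|exact: measurable_itv..].
have H (c d : R) : c <= d -> leb `]c, d]%classic = (d - c)%:E.
  move=> cd; rewrite lebesgue_measure_itv /= lte_fin.
  case: ltP => [_|dc]; first by rewrite -EFinD.
  by rewrite (@le_anti _ _ c d) ?cd// subrr.
by rewrite EFinM; congr (_ * _)%E; exact: H.
Qed.

Lemma normsq_box_le (a b x : R * R) : `]a.1, b.1]%classic x.1 ->
  `]a.2, b.2]%classic x.2 ->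
  normsq x <= (`|a.1| + `|b.1|) ^+ 2 + (`|a.2| + `|b.2|) ^+ 2.
Proof.
rewrite /= !in_itv /= => /andP[x1 x2] /andP[x3 x4].
have H (u v w : R) : v < u -> u <= w -> u ^+ 2 <= (`|v| + `|w|) ^+ 2.
  move=> vu uw; rewrite -(real_normK (num_real u)) ler_pXn2r ?nnegrE ?addr_ge0//.
  by rewrite ler_norml; have := ler_norm w; have := ler_norm (- v); rewrite normrN;
    have := normr_ge0 v; have := normr_ge0 w; lra.
by rewrite /normsq lerD// H.
Qed.

(** The bound of poisson_weighted_le is integrated over x in the box. This decay,
    uniform in e, is what the integrability of <y>^-2 p requires. *)
Lemma box_mass_weighted_le (a b : R * R) : a.1 <= b.1 -> a.2 <= b.2 ->
  exists C : R, forall e (y : R * R), e != 0 ->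
    box_mass e a b y <= C * (bracket y)^-1 ^+ 2.
Proof.
move=> ab1 ab2.
pose M := (`|a.1| + `|b.1|) ^+ 2 + (`|a.2| + `|b.2|) ^+ 2.
pose A := (b.1 - a.1) * (b.2 - a.2).
have M0 : 0 <= M by rewrite addr_ge0// sqr_ge0.
(* M bounds |x|^2 on the box, A is its area and 2 bounds box_mass. *)
exists (2 * (1 + M) * (A + 2)) => e y e0.
pose Q : set (plane R) := `]a.1, b.1]%classic `*` `]a.2, b.2]%classic.
have mQ : measurable Q by apply: measurableX; exact: measurable_itv.
pose P (x : plane R) : R := poisson e (x.1 - y.1) (x.2 - y.2).
have mP : measurable_fun setT P by apply: measurable_poisson; exact: measurable_funB.
pose c : R := 2 * (1 + M) * (bracket y)^-1 ^+ 2.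
have c0 : 0 <= c by rewrite mulr_ge0 ?sqr_ge0// mulr_ge0// addr_ge0.
have intP : (\int[mu2]_(x in Q) (P x)%:E = (box_mass e a b y)%:E)%E.
  exact: integral_poisson_box.
have QM (x : plane R) : Q x -> normsq x <= M.
  by move=> [? ?]; exact: normsq_box_le.
have : ((box_mass e a b y)%:E <= (c * (A + box_mass e a b y))%:E)%E.
  rewrite -intP.
  apply: (@le_trans _ _ (\int[mu2]_(x in Q) (c%:E * (1 + (P x)%:E)))%E).
    apply: ge0_le_integral => //.
    - by move=> x _; rewrite lee_fin poisson_ge0.
    - by apply: measurable_funTS; exact/measurable_EFinP.
    - apply: measurable_funTS; apply/measurable_EFinP.
      by apply: measurable_funM => //; exact: measurable_funD.
    - move=> x Qx; rewrite -EFinD -EFinM lee_fin.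
      apply: (le_trans (poisson_weighted_le x y e0)).
      rewrite ler_wpM2r ?addr_ge0 ?poisson_ge0// ler_wpM2r ?sqr_ge0// ler_wpM2l//.
      by rewrite lerD2l QM.
  rewrite ge0_integralZl//; last 2 first.
  - apply: measurable_funTS; apply/measurable_EFinP; exact: measurable_funD.
  - by move=> x _; rewrite -EFinD lee_fin addr_ge0// poisson_ge0.
  rewrite [X in (_ <= X)%E]EFinM lee_wpmul2l// ge0_integralD//; last 2 first.
  - by move=> x _; rewrite lee_fin poisson_ge0.
  - by apply: measurable_funTS; exact/measurable_EFinP.
  rewrite intP integral_cst// mul1e [X in (X + _)%E](_ : _ = A%:E)//.
  exact: lebesgue_box.
rewrite lee_fin => /le_trans; apply.
rewrite [leRHS](_ : _ = c * (A + 2)); last by rewrite /c; ring.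
rewrite ler_wpM2l// lerD2l; have := box_mass_le e a b y; exact/le_trans/ler_norm.
Qed.

End BoxWeights.

(** * The gradient kernel against an integrable function *)

(** A name of its own for Lebesgue measure on the plane, to which sigma-finiteness
    is attached so that the product of two copies can be formed. *)
Definition lebesgue2 (R : realType) : set (plane R) -> \bar R :=
  (@lebesgue_measure R \x @lebesgue_measure R)%E.

Arguments lebesgue2 : clear implicits.

HB.instance Definition _ (R : realType) :=
  Measure.copy (lebesgue2 R) (@lebesgue_measure R \x @lebesgue_measure R)%E.

Lemma sigma_finite_lebesgue2 (R : realType) : sigma_finite setT (lebesgue2 R).
Proof.
have /sigma_finiteP[F [TF ndF Foo]] := sigma_finiteT (@lebesgue_measure R).
exists (fun n => F n `*` F n).
  rewrite -setXTT TF predeqE => -[x y]; split.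
    move=> [/= [n _ Fnx] [k _ Gky]]; exists (maxn n k) => //; split.
    - by move: x Fnx; exact/subsetPset/ndF/leq_maxl.
    - by move: y Gky; exact/subsetPset/ndF/leq_maxr.
  by move=> [n _ []/= ? ?]; split; exists n.
move=> k; have [? Fk] := Foo k; split; first exact: measurableX.
rewrite /lebesgue2 product_measure1E//.
by rewrite lte_mul_pinfty// ge0_fin_numE.
Qed.

HB.instance Definition _ (R : realType) :=
  Measure_isSigmaFinite.Build _ _ _ (lebesgue2 R) (sigma_finite_lebesgue2 R).

Section KernelIntegrals.
Variable R : realType.
Local Notation mu2 := (lebesgue2 R).
Local Notation mu4 := (lebesgue2 R \x lebesgue2 R)%E.

(** The components of the gradient kernel at x - y; k = true is the derivative in
    the second coordinate, as for partial. *)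
Definition grad_log (k : bool) e (x y : R * R) :=
  if k then kern e (x.2 - y.2) (x.1 - y.1) else kern e (x.1 - y.1) (x.2 - y.2).

Lemma measurable_indic_fst (Q : set (plane R)) : measurable Q ->
  measurable_fun setT (fun z : plane R * plane R => (\1_Q z.1 : R)).
Proof.
by move=> mQ; apply: (measurableT_comp (measurable_indic mQ)).
Qed.

Lemma measurable_diff (i : bool) :
  measurable_fun setT (fun z : plane R * plane R =>
    if i then z.1.2 - z.2.2 else z.1.1 - z.2.1 : R).
Proof.
case: i; apply: measurable_funB.
- exact: (measurableT_comp measurable_snd).
- exact: (measurableT_comp measurable_snd).
- exact: (measurableT_comp measurable_fst).
- exact: (measurableT_comp measurable_fst).
Qed.

Lemma measurable_grad_log k e :
  measurable_fun setT (fun z : plane R * plane R => grad_log k e z.1 z.2).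
Proof.
rewrite /grad_log; case: k; apply: measurable_kern;
  first [exact: (measurable_diff true)|exact: (measurable_diff false)].
Qed.

Lemma grad_log_abs_le k e x y : `|grad_log k e x y| <= `|grad_log k 0 x y|.
Proof. by case: k; exact: kern_abs_le. Qed.

Lemma cvg_kern (s t : R) : kern (@harmonic R n) s t @[n --> \oo] --> kern 0 s t.
Proof.
have [->|s0] := eqVneq s 0.
  by rewrite /kern; under eq_fun do rewrite mul0r; rewrite mul0r; exact: cvg_cst.
have D0 : 2 * pi * (s ^+ 2 + t ^+ 2 + 0 ^+ 2) != 0.
  rewrite gt_eqF// expr0n addr0 !mulr_gt0 ?pi_gt0// ltr_wpDr ?sqr_ge0//.
  by rewrite exprn_even_gt0.
apply: cvgM; first exact: cvg_cst.
apply: cvgV => //; apply: cvgM; first exact: cvg_cst.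
apply: cvgD; first exact: cvg_cst.
rewrite expr2; under eq_fun do rewrite expr2.
by apply: cvgM; exact: cvg_harmonic.
Qed.

Lemma cvg_grad_log k x y : grad_log k (@harmonic R n) x y @[n --> \oo] --> grad_log k 0 x y.
Proof. by case: k; exact: cvg_kern. Qed.

Variables (I J : set R).
Hypotheses (oI : ocitv I) (oJ : ocitv J).
Let Q : set (plane R) := I `*` J.

Let mQ : measurable Q.
Proof. by apply: measurableX; exact: measurable_ocitv. Qed.

Lemma integral_indicM (f : plane R -> R) :
  (\int[mu2]_x `|\1_Q x * f x|%:E = \int[mu2]_(x in Q) `|f x|%:E)%E.
Proof.
rewrite [RHS]integral_mkcond; apply: eq_integral => x _.
rewrite patchE indicE; case: ifPn => _; first by rewrite mul1r.
by rewrite mul0r normr0.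
Qed.

(** The integral of the kernel over x in a box is bounded uniformly in y. *)
Lemma integrable_grad_log k e (a : plane R -> R) :
  mu2.-integrable setT (EFin \o a) ->
  mu4.-integrable setT (EFin \o (fun z => \1_Q z.1 * grad_log k e z.1 z.2 * a z.2)).
Proof.
move=> ia; have [C HC] := integral_kern_box_le oI oJ.
have mK := measurable_grad_log k e.
apply: (@integrable_kernel_mul _ _ _ _ R (lebesgue2 R) (lebesgue2 R)
  (fun z : plane R * plane R => \1_Q z.1 * grad_log k e z.1 z.2) a (fun=> C)).
- by apply: measurable_funM => //; exact: measurable_indic_fst.
- exact: integrable_measurable ia.
- move=> y /=; rewrite integral_indicM.
  have mKy e' : measurable_fun Q (fun x : plane R => `|grad_log k e' x y|%:E).
    apply: measurable_funTS; apply/measurable_EFinP; apply: measurableT_comp => //.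
    exact: (measurableT_comp (measurable_grad_log k e') (measurable_pair2 y)).
  apply: (@le_trans _ _ (\int[mu2]_(x in Q) `|grad_log k 0 x y|%:E)%E).
    apply: ge0_le_integral => //.
    by move=> x _; rewrite lee_fin grad_log_abs_le.
  by have [H1 H2] := HC y; case: (k).
- exact: integrable_mulc.
Qed.

End KernelIntegrals.

(** By Fubini on each box; the integral over y may diverge on a null set of x. *)
Lemma ae_integrable_grad_log (R : realType) k e (a : plane R -> R) :
  (lebesgue2 R).-integrable setT (EFin \o a) ->
  {ae lebesgue2 R, forall x : plane R,
    (lebesgue2 R).-integrable setT
      (EFin \o (fun y => grad_log k e x y * a y))}.
Proof.
move=> ia; apply: ae_of_boxes => I J oI oJ.
have := ae_integrable1 (integrable_grad_log oI oJ k e ia).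
apply: filterS => x + IJx; congr (is_true (_.-integrable _ _)).
by apply/funext => y /=; rewrite indicE mem_set// mul1r.
Qed.

(** * Removing the regularisation *)

Section BoxAverages.
Variable R : realType.
Local Notation mu2 := (lebesgue2 R).
Local Notation mu4 := (lebesgue2 R \x lebesgue2 R)%E.

Lemma ae_neq_line (c : R) :
  {ae mu2, forall y : plane R, y.1 != c} /\ {ae mu2, forall y : plane R, y.2 != c}.
Proof.
have mc : measurable ([set c] : set (measurableTypeR R)) by exact: measurable_set1.
split.
- exists ([set c] `*` setT : set (plane R)); split; first exact: measurableX.
  + have := product_measure1E (@lebesgue_measure R) (@lebesgue_measure R) mc measurableT.
    by rewrite [X in (X * _)%E]lebesgue_measure_set1 mul0e.
  + by move=> y /= /negP; rewrite negbK => /eqP.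
- exists (setT `*` [set c] : set (plane R)); split; first exact: measurableX.
  + have := product_measure1E (@lebesgue_measure R) (@lebesgue_measure R) measurableT mc.
    by rewrite [X in (_ * X)%E]lebesgue_measure_set1 mule0.
  + by move=> y /= /negP; rewrite negbK => /eqP.
Qed.

Lemma measurable_angle e d (T : measurableType d) (f g : T -> R) :
  measurable_fun setT f -> measurable_fun setT g ->
  measurable_fun setT (fun x => angle e (f x) (g x)).
Proof.
move=> mf mg.
have matan : measurable_fun setT (@atan R).
  by apply: continuous_measurable_fun => t; exact: continuous_atan.
have mquot (h k : T -> R) : measurable_fun setT h -> measurable_fun setT k ->
    measurable_fun setT (fun x => h x / regrad e (k x)).
  move=> mh mk; apply: measurable_funM => //.
  apply: (measurableT_comp (@measurable_inv R)).
  apply: (measurableT_comp (@measurable_sqrt R)).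
  by apply: measurable_funD => //; exact: measurable_funX.
apply: measurable_funM => //; apply: measurable_funD; apply: measurable_funM.
- exact: mquot.
- by apply: (measurableT_comp matan); exact: mquot.
- exact: mquot.
- by apply: (measurableT_comp matan); exact: mquot.
Qed.

Variables p a b : plane R -> R.
Hypothesis mp : measurable_fun setT p.
Hypothesis ip : mu2.-integrable setT (EFin \o (fun y => (bracket y)^-1 ^+ 2 * p y)).
Hypothesis ia : mu2.-integrable setT (EFin \o a).
Hypothesis ib : mu2.-integrable setT (EFin \o b).
Hypothesis identity : forall e (x : R * R), e != 0 ->
  \int[mu2]_y (poisson e (x.1 - y.1) (x.2 - y.2) * p y +
    grad_log true e x y * a y - grad_log false e x y * b y) = 0.

Section Box.
Variables (I J : set R).
Hypotheses (oI : ocitv I) (oJ : ocitv J).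
Let Q : set (plane R) := I `*` J.

Let mQ : measurable Q.
Proof. by apply: measurableX; exact: measurable_ocitv. Qed.

Lemma Rintegral_indicZ (x : plane R) (g : plane R -> R) :
  \int[mu2]_y (\1_Q x * g y) = \1_Q x * \int[mu2]_y g y.
Proof.
rewrite indicE; case: (x \in Q) => /=.
  by rewrite mul1r; apply: eq_Rintegral => y _; rewrite mul1r.
rewrite mul0r /Rintegral integral0_eq// => y _.
by rewrite mul0r.
Qed.

Let Psi k e (f : plane R -> R) (z : plane R * plane R) : R :=
  \1_Q z.1 * grad_log k e z.1 z.2 * f z.2.

Let Phi e (z : plane R * plane R) : R :=
  \1_Q z.1 * poisson e (z.1.1 - z.2.1) (z.1.2 - z.2.2) * p z.2.

Lemma cvg_Rintegral_Psi k (f : plane R -> R) : mu2.-integrable setT (EFin \o f) ->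
  \int[mu4]_z Psi k (@harmonic R n) f z @[n --> \oo] --> \int[mu4]_z Psi k 0 f z.
Proof.
move=> If; have iPsi e := integrable_grad_log oI oJ k e If.
apply: (Rintegral_dominated_cvg (g := fun z => `|Psi k 0 f z|)).
- by move=> n; exact: integrable_measurable (iPsi _).
- exact: integrable_measurable (iPsi _).
- apply: aeW => z; apply: cvgM; last exact: cvg_cst.
  by apply: cvgM; [exact: cvg_cst|exact: cvg_grad_log].
- move=> n z; rewrite /Psi !normrM ler_wpM2r// ler_wpM2l//.
  exact: grad_log_abs_le.
- exact: integrable_abs (iPsi _).
Qed.

Lemma Rintegral_Psi k (f : plane R -> R) : mu2.-integrable setT (EFin \o f) ->
  \int[mu4]_z Psi k 0 f z = \int[mu2]_x (\1_Q x * \int[mu2]_y (grad_log k 0 x y * f y)) /\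
  mu2.-integrable setT (EFin \o (fun x => \1_Q x * \int[mu2]_y (grad_log k 0 x y * f y))).
Proof.
move=> If; have iPsi := integrable_grad_log oI oJ k 0 If.
have E x : \int[mu2]_y Psi k 0 f (x, y) = \1_Q x * \int[mu2]_y (grad_log k 0 x y * f y).
  by rewrite -Rintegral_indicZ; apply: eq_Rintegral => y _; rewrite /Psi /= mulrA.
split.
  by rewrite -(Rintegral_fubini12 iPsi); apply: eq_Rintegral => x _; exact: E.
have := integrable_fubini12 iPsi.
by congr (is_true (_.-integrable _ _)); apply/funext => x /=; rewrite -E.
Qed.

Let corners : exists A B : R * R, [/\ A.1 <= B.1, A.2 <= B.2 &
  Q = `]A.1, B.1]%classic `*` `]A.2, B.2]%classic].
Proof.
have [a1 [b1 [ab1 IE]]] := ocitv_le oI; have [a2 [b2 [ab2 JE]]] := ocitv_le oJ.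
by exists (a1, a2), (b1, b2); split => //; rewrite /Q IE JE.
Qed.

Let box_poisson e (y x : plane R) : R := \1_Q x * poisson e (x.1 - y.1) (x.2 - y.2).

Let measurable_box_poisson e y : measurable_fun setT (box_poisson e y).
Proof.
apply: measurable_funM; first exact: measurable_indic.
by apply: measurable_poisson; exact: measurable_funB.
Qed.

Let box_poisson_ge0 e y x : 0 <= box_poisson e y x.
Proof. by rewrite mulr_ge0 ?poisson_ge0// indicE ler0n. Qed.

Let integral_box_poisson e y (A B : R * R) : e != 0 -> A.1 <= B.1 -> A.2 <= B.2 ->
  Q = `]A.1, B.1]%classic `*` `]A.2, B.2]%classic ->
  (\int[mu2]_x (box_poisson e y x)%:E = (box_mass e A B y)%:E)%E.
Proof.
move=> e0 AB1 AB2 QE; rewrite -integral_poisson_box// -QE [RHS]integral_mkcond.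
apply: eq_integral => x _; rewrite patchE /box_poisson indicE.
by case: ifPn => _; rewrite ?mul1r ?mul0r.
Qed.

Lemma integrable_Phi e : e != 0 -> mu4.-integrable setT (EFin \o Phi e).
Proof.
move=> e0; have [A [B [AB1 AB2 QE]]] := corners.
have [C HC] := box_mass_weighted_le AB1 AB2.
apply: (@integrable_kernel_mul _ _ _ _ R (lebesgue2 R) (lebesgue2 R)
  (fun z : plane R * plane R => \1_Q z.1 * poisson e (z.1.1 - z.2.1) (z.1.2 - z.2.2))
  p (fun y => C * (bracket y)^-1 ^+ 2)) => //.
- apply: measurable_funM; first exact: measurable_indic_fst.
  by apply: measurable_poisson; [exact: (@measurable_diff R false)|
    exact: (@measurable_diff R true)].
- move=> y /=.
  under eq_integral do rewrite ger0_norm ?(box_poisson_ge0 e y)//.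
  by rewrite (integral_box_poisson y e0 AB1 AB2 QE) lee_fin HC.
- have := integrable_mulc C ip; congr (is_true (_.-integrable _ _)).
  by apply/funext => y /=; rewrite mulrA.
Qed.

(** Integrating in x first turns the Poisson-type kernel into the box mass, which
    tends to the indicator of the box off the four lines carrying its sides and
    is dominated by a multiple of <y>^-2. *)
Lemma cvg_Rintegral_Phi :
  \int[mu4]_z Phi (@harmonic R n) z @[n --> \oo] --> \int[mu2]_y (\1_Q y * p y).
Proof.
have [A [B [AB1 AB2 QE]]] := corners.
have [C HC] := box_mass_weighted_le AB1 AB2.
have h0 n : harmonic n != 0 :> R by rewrite /harmonic /= invr_eq0 pnatr_eq0.
have E n : \int[mu4]_z Phi (@harmonic R n) z =
    \int[mu2]_y (box_mass (harmonic n) A B y * p y).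
  rewrite -(Rintegral_fubini21 (integrable_Phi (h0 n))); apply: eq_Rintegral => y _.
  have iP : mu2.-integrable setT (EFin \o box_poisson (harmonic n) y).
    apply/integrableP; split; first exact/measurable_EFinP.
    under eq_integral do rewrite /= ger0_norm//.
    by rewrite (integral_box_poisson y (h0 n) AB1 AB2 QE) ltry.
  rewrite /Phi /= (RintegralZr _ _ iP)//; congr (_ * _).
  by rewrite /Rintegral (integral_box_poisson y (h0 n) AB1 AB2 QE).
under eq_fun do rewrite E.
have mass_ge0 n y : 0 <= box_mass (harmonic n) A B y.
  rewrite -lee_fin -(integral_box_poisson y (h0 n) AB1 AB2 QE).
  by apply: integral_ge0 => x _; rewrite lee_fin.
have mmass n : measurable_fun setT (fun y : plane R => box_mass (harmonic n) A B y).
  by do 2!apply: measurable_funB; apply: measurable_angle; exact: measurable_funB.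
apply: (Rintegral_dominated_cvg (g := fun y => `|C * ((bracket y)^-1 ^+ 2 * p y)|)).
- by move=> n; exact: measurable_funM.
- by apply: measurable_funM => //; exact: measurable_indic.
- have [a1 _] := ae_neq_line A.1; have [b1 _] := ae_neq_line B.1.
  have [_ a2] := ae_neq_line A.2; have [_ b2] := ae_neq_line B.2.
  apply: filterS2 (filterI a1 b1) (filterI a2 b2) => y [ya1 yb1] [ya2 yb2].
  by apply: cvgM; [rewrite QE; exact: cvg_box_mass|exact: cvg_cst].
- move=> n y; rewrite mulrA [leLHS]normrM [leRHS]normrM ler_wpM2r//.
  by rewrite ger0_norm// (le_trans (HC _ _ (h0 n)))// ler_norm.
- exact: integrable_abs (integrable_mulc C ip).
Qed.

(** The identity is integrated over x in the box, where the singular kernels are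
    dominating functions, before e tends to 0; at a fixed x the limit could not
    be taken under the integral. *)
Lemma box_identity :
  \int[mu2]_x (\1_Q x * p x) + \int[mu2]_x (\1_Q x * \int[mu2]_y (grad_log true 0 x y * a y))
  - \int[mu2]_x (\1_Q x * \int[mu2]_y (grad_log false 0 x y * b y)) = 0.
Proof.
have [<- _] := Rintegral_Psi true ia; have [<- _] := Rintegral_Psi false ib.
have h0 n : harmonic n != 0 :> R by rewrite /harmonic /= invr_eq0 pnatr_eq0.
pose S n := \int[mu4]_z Phi (@harmonic R n) z +
  \int[mu4]_z Psi true (@harmonic R n) a z - \int[mu4]_z Psi false (@harmonic R n) b z.
have S0 n : S n = 0.
  have iPhi := integrable_Phi (h0 n).
  have iA := integrable_grad_log oI oJ true (harmonic n) ia.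
  have iB := integrable_grad_log oI oJ false (harmonic n) ib.
  rewrite /S -RintegralD// -RintegralB//; last exact: integrable_add.
  have iS : mu4.-integrable setT (EFin \o (fun z => Phi (@harmonic R n) z +
      Psi true (@harmonic R n) a z - Psi false (@harmonic R n) b z)).
    exact: (integrableB measurableT (integrable_add iPhi iA) iB).
  rewrite -(Rintegral_fubini12 iS) /Rintegral integral0_eq// => x _.
  suff E : \int[mu2]_y (Phi (harmonic n) (x, y) + Psi true (harmonic n) a (x, y) -
      Psi false (harmonic n) b (x, y)) = 0 by rewrite -[RHS]/(0%:E) -E.
  rewrite -[RHS](mulr0 (\1_Q x)) -[X in _ * X](identity x (h0 n)) -Rintegral_indicZ.
  by apply: eq_Rintegral => y _; rewrite /Phi /Psi /=; ring.
have cS : S n @[n --> \oo] --> \int[mu2]_x (\1_Q x * p x) +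
    \int[mu4]_z Psi true 0 a z - \int[mu4]_z Psi false 0 b z.
  apply: cvgB; last exact: cvg_Rintegral_Psi.
  by apply: cvgD; [exact: cvg_Rintegral_Phi|exact: cvg_Rintegral_Psi].
rewrite -(cvg_lim _ cS)//.
by rewrite (_ : (fun n => _) = fun=> 0) ?lim_cst//; apply/funext => n; exact: S0.
Qed.

Lemma integrable_indic_p : mu2.-integrable setT (EFin \o (fun x => \1_Q x * p x)).
Proof.
have [A [B [AB1 AB2 QE]]] := corners.
pose M : R := (`|A.1| + `|B.1|) ^+ 2 + (`|A.2| + `|B.2|) ^+ 2.
have M0 : 0 <= M by rewrite addr_ge0// sqr_ge0.
apply: (integrable_dominated (g := fun x => (1 + M) * `|(bracket x)^-1 ^+ 2 * p x|)).
- by apply: measurable_funM => //; exact: measurable_indic.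
- move=> x; rewrite indicE; have [xQ|_] := boolP (x \in Q); last first.
    by rewrite mul0r normr0 mulr_ge0// addr_ge0.
  have b0 : 0 < bracket x ^+ 2 by rewrite exprn_gt0// bracket_gt0.
  rewrite mul1r [`|_ ^+ 2 * p x|]normrM mulrA -[leLHS]mul1r ler_wpM2r//.
  rewrite exprVn gtr0_norm ?invr_gt0// ler_pdivlMr// mul1r bracket_sqr lerD2l.
  by move: xQ; rewrite inE QE => -[? ?]; exact: normsq_box_le.
- exact: integrable_mulc (integrable_abs ip).
Qed.

End Box.

Lemma representation_of_identity : {ae mu2, forall x,
  p x + \int[mu2]_y (grad_log true 0 x y * a y) - \int[mu2]_y (grad_log false 0 x y * b y) = 0}.
Proof.
pose w (x : plane R) : R := p x + \int[mu2]_y (grad_log true 0 x y * a y) -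
  \int[mu2]_y (grad_log false 0 x y * b y).
have restr (I J : set R) : (EFin \o w) \_ (I `*` J : set (plane R)) =
    EFin \o (fun x => \1_(I `*` J : set (plane R)) x * p x +
      \1_(I `*` J : set (plane R)) x * \int[mu2]_y (grad_log true 0 x y * a y) -
      \1_(I `*` J : set (plane R)) x * \int[mu2]_y (grad_log false 0 x y * b y)).
  apply/funext => x /=; rewrite patchE indicE; case: ifPn => _.
    by rewrite !mul1r.
  by rewrite !mul0r addr0 subr0.
have iw (I J : set R) : ocitv I -> ocitv J ->
    mu2.-integrable setT ((EFin \o w) \_ (I `*` J : set (plane R))).
  move=> oI oJ; rewrite restr.
  have [_ iA] := Rintegral_Psi oI oJ true ia.
  have [_ iB] := Rintegral_Psi oI oJ false ib.
  exact: (integrableB measurableT (integrable_add (integrable_indic_p oI oJ) iA) iB).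
have mIJ (I J : set R) : ocitv I -> ocitv J -> measurable (I `*` J : set (plane R)).
  by move=> oI oJ; apply: measurableX; exact: measurable_ocitv.
apply: (@ae_eq0_of_integrals_on_boxes R w) => I J oI oJ.
  by apply/(integrable_mkcond _ (mIJ _ _ oI oJ)); exact: iw.
rewrite integral_mkcond.
have iwIJ := iw _ _ oI oJ; rewrite restr in iwIJ.
have [_ iA] := Rintegral_Psi oI oJ true ia.
have [_ iB] := Rintegral_Psi oI oJ false ib.
have := box_identity oI oJ.
rewrite -RintegralD//; last exact: integrable_indic_p.
rewrite -RintegralB//; last exact: (integrable_add (integrable_indic_p oI oJ) iA).
move=> E; rewrite -[RHS]/(0%:E) -E /Rintegral fineK; first by rewrite restr.
exact: integrable_fin_num.
Qed.

End BoxAverages.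

Section Representation.
Variable R : realType.
Local Notation mu2 := (lebesgue2 R).

(** A function p that solves a Cauchy-Riemann system together with r is recovered
    from the data: p = K1 * b - K2 * a with convolutions over the plane. The
    weighted integrability of p and r excludes the homogeneous solutions; a
    nonzero constant, for instance, is not integrable against <y>^-2. *)
Lemma weak_gradient_representation (p r a b : plane R -> R) :
  measurable_fun setT p -> measurable_fun setT r ->
  mu2.-integrable setT (EFin \o (fun y => (bracket y)^-1 ^+ 2 * p y)) ->
  mu2.-integrable setT (EFin \o (fun y => (bracket y)^-1 ^+ 2 * r y)) ->
  mu2.-integrable setT (EFin \o a) -> mu2.-integrable setT (EFin \o b) ->
  (forall chi, real_test chi -> \int[mu2]_y
     (partial false chi y * r y + partial true chi y * p y - chi y * a y) = 0) ->
  (forall chi, real_test chi -> \int[mu2]_y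
     (partial false chi y * p y - partial true chi y * r y + chi y * b y) = 0) ->
  {ae mu2, forall x, p x + \int[mu2]_y (grad_log true 0 x y * a y) -
    \int[mu2]_y (grad_log false 0 x y * b y) = 0}.
Proof.
move=> mp mr ip ir ia ib weak1 weak2.
apply: representation_of_identity => // e x e0.
have H := regularised_identity mp mr ip ir ia ib weak1 weak2 x e0.
exact: H.
Qed.

End Representation.

(** * Algebra of the Dirac symbol and of the factorisation of V *)

Section DiracAlgebra.
Variable R : realType.
Local Open Scope complex_scope.
Implicit Types (x y : plane R) (w u : vec2 R) (c d : R).

Lemma sign0_sqr (t : R) : sign0 t * sign0 t = 1.
Proof. by rewrite /sign0; case: ifP => _; rewrite ?mulrNN mulr1. Qed.

Lemma sign0_sqrt (t : R) : Num.sqrt `|t| * (sign0 t * Num.sqrt `|t|) = t.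
Proof.
rewrite mulrCA -expr2 sqr_sqrtr// /sign0.
by case: ltP => t0; [rewrite ltr0_norm// mulN1r opprK|rewrite ger0_norm// mul1r].
Qed.

(** This is where sign 0 = 1 matters: U is an involution also where V is singular. *)
Lemma UfactorK zeta x w : Ufactor zeta x *m (Ufactor zeta x *m w) = w.
Proof.
apply/matrixP => i j; rewrite /Ufactor !mul_diag_mx !mxE mulrA.
by rewrite -rmorphM /= sign0_sqr mul1r.
Qed.

Lemma V_factorization V B zeta x w : diagonalizes V B zeta ->
  (vfactor B zeta x)^t* *m (Ufactor zeta x *m vfactor B zeta x *m w) = V x *m w.
Proof.
move=> /(_ x)[_ ->]; rewrite /vfactor trmx_mul map_mxM -!mulmxA; congr (_ *m _).
rewrite tr_diag_mx; apply/matrixP => i j.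
rewrite map_diag_mx /Ufactor !mul_diag_mx !mxE !mulrA; congr (_ * _).
rewrite [X in X * _ * _](_ : _ = (Num.sqrt `|zeta x 0 i|)%:C); last exact: conjc_real.
by rewrite -mulrA -!rmorphM /= sign0_sqrt.
Qed.

(** The products of alpha_1 and alpha_2 with w exchange its two components, so that
    the Dirac operator couples them through d_1 - i d_2 and d_1 + i d_2. *)
Lemma dirac_symbol_entries (c1 c2 c : R[i]) w u :
  ('i *: ((c1 *: @alpha1 R + c2 *: @alpha2 R) *m w) + c *: u) 0 0 =
     'i * c1 * w 1 0 + c2 * w 1 0 + c * u 0 0 /\
  ('i *: ((c1 *: @alpha1 R + c2 *: @alpha2 R) *m w) + c *: u) 1 0 =
     'i * c1 * w 0 0 - c2 * w 0 0 + c * u 1 0.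
Proof.
have iE : ('i)%R = 'i%C :> R[i] by [].
have ii : 'i%C * 'i%C = -1 :> R[i] by rewrite -expr2 sqr_i.
have l1 : lift ord0 ord0 = 1 :> 'I_2 by exact/val_inj.
have o0 : ord0 = 0 :> 'I_2 by exact/val_inj.
split; rewrite !mxE !big_ord_recl big_ord0 !mxE /= l1 o0 ?iE; move: ii; move: 'i%C => I ii.
- transitivity (I * c1 * w 1 0 - (I * I) * c2 * w 1 0 + c * u 0 0); first by ring.
  by rewrite ii; ring.
- transitivity (I * c1 * w 0 0 + (I * I) * c2 * w 0 0 + c * u 1 0); first by ring.
  by rewrite ii; ring.
Qed.

(** The entries of G_{0,0} are built from the two components of the gradient of
    (2 pi)^-1 log |x - y|; the formulas also hold at x = y, where all terms are 0. *)
Lemma G00_entries x y w :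
  (G00 x y *m w) 0 0 = (grad_log true 0 x y +i* grad_log false 0 x y) * w 1 0 /\
  (G00 x y *m w) 1 0 = (- grad_log true 0 x y +i* grad_log false 0 x y) * w 0 0.
Proof.
have l1 : lift ord0 ord0 = 1 :> 'I_2 by exact/val_inj.
have o0 : ord0 = 0 :> 'I_2 by exact/val_inj.
have iE : ('i)%R = 'i%C :> R[i] by [].
have n12 : (x.1 - y.1) ^+ 2 + (x.2 - y.2) ^+ 2 = normsq (x - y) by [].
have n21 : (x.2 - y.2) ^+ 2 + (x.1 - y.1) ^+ 2 = normsq (x - y) by rewrite addrC.
rewrite /grad_log /kern /G00 /alpha_dot n12 n21 expr0n /= addr0.
set z1 := x.1 - y.1; set z2 := x.2 - y.2; set D := 2 * pi * normsq (x - y).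
have E (s : R) : 'i%C / D%:C * (z1%:C + s%:C * (z2%:C * 'i%C)) =
    (- s * (z2 / D)) +i* (z1 / D).
  rewrite -fmorphV /=; move: D^-1 => d.
  by apply/eqP; rewrite eq_complex /=; apply/andP; split; apply/eqP; ring.
split; rewrite !mxE !big_ord_recl big_ord0 !mxE /= l1 o0 ?iE
  !mulr0 !addr0 ?mulr0 ?mul0r ?add0r ?addr0 mulr1; congr (_ * _).
- have := E (-1); rewrite opprK mul1r => <-.
  by rewrite rmorphN1 mulN1r mulrN.
- have := E 1; rewrite mulN1r => <-.
  by rewrite rmorph1 mul1r.
Qed.

End DiracAlgebra.

(** * Moduli and measurability of complex matrices *)

Section ComplexModulus.
Variable R : realType.
Implicit Types z w : R[i].
Local Notation Re := complex.Re.
Local Notation Im := complex.Im.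

Lemma cabsE z : cabs z = Num.sqrt (Re z ^+ 2 + Im z ^+ 2).
Proof. by rewrite /cabs normc_def. Qed.

Lemma cabs_ge0 z : 0 <= cabs z.
Proof. by rewrite cabsE sqrtr_ge0. Qed.

Lemma cabs_sqr z : cabs z ^+ 2 = Re z ^+ 2 + Im z ^+ 2.
Proof. by rewrite cabsE sqr_sqrtr// addr_ge0// sqr_ge0. Qed.

Lemma normr_cabs z : `|z| = (cabs z)%:C%C.
Proof. by rewrite cabsE normc_def. Qed.

Lemma cabsM z w : cabs (z * w) = cabs z * cabs w.
Proof. by rewrite {1}/cabs normrM !normr_cabs -rmorphM. Qed.

Lemma cabsD z w : cabs (z + w) <= cabs z + cabs w.
Proof.
by have := ler_normD z w; rewrite !normr_cabs -rmorphD /= lecR.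
Qed.

Lemma cabs_conj z : cabs z^*%C = cabs z.
Proof. by rewrite !cabsE; case: z => a b /=; rewrite sqrrN. Qed.

Lemma Re_le_cabs z : `|Re z| <= cabs z.
Proof. by rewrite cabsE -sqrtr_sqr ler_wsqrtr// lerDl sqr_ge0. Qed.

Lemma Im_le_cabs z : `|Im z| <= cabs z.
Proof. by rewrite cabsE -sqrtr_sqr ler_wsqrtr// lerDr sqr_ge0. Qed.

Lemma ReM z w : Re (z * w) = Re z * Re w - Im z * Im w.
Proof. by case: z w => a b [c d]. Qed.

Lemma ImM z w : Im (z * w) = Re z * Im w + Im z * Re w.
Proof. by case: z w => a b [c d]. Qed.

Lemma sum_ord2 (T : nmodType) (F : 'I_2 -> T) : \sum_k F k = F 0 + F 1.
Proof.
by rewrite !big_ord_recl big_ord0 addr0; congr (F _ + F _); exact: val_inj.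
Qed.

Lemma cabs_mulmx_le m n (A : 'M[R[i]]_(m, 2)) (W : 'M[R[i]]_(2, n)) i j :
  cabs ((A *m W) i j) <= cabs (A i 0) * cabs (W 0 j) + cabs (A i 1) * cabs (W 1 j).
Proof. by rewrite mxE sum_ord2 -!cabsM; exact: cabsD. Qed.

Lemma unitarymx_entry_le (B : mat2 R) i j : B \is unitarymx -> cabs (B i j) <= 1.
Proof.
move=> /unitarymxP/matrixP/(_ i i).
rewrite !mxE eqxx sum_ord2 !mxE.
have E z : Re (z * z^*%C) = cabs z ^+ 2.
  by rewrite ReM cabs_sqr; case: z => a b /=; ring.
move=> /(congr1 (fun z => Re z)) H.
have {}H : cabs (B i 0) ^+ 2 + cabs (B i 1) ^+ 2 = 1.
  rewrite -!E; apply: etrans H; rewrite -[RHS]/(Re (_ + _)).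
  by case: (_ * _) => a b; case: (_ * _) => c d.
have : cabs (B i j) ^+ 2 <= 1.
  have := sqr_ge0 (cabs (B i 0)); have := sqr_ge0 (cabs (B i 1)).
  case: j => -[|[|//]] lt2.
  - by rewrite (_ : Ordinal lt2 = 0); [lra|exact: val_inj].
  - by rewrite (_ : Ordinal lt2 = 1); [lra|exact: val_inj].
by rewrite expr_le1// cabs_ge0.
Qed.

End ComplexModulus.

Section ComplexMeasurability.
Variable R : realType.
Implicit Types f g : plane R -> R[i].
Local Notation Re := complex.Re.
Local Notation Im := complex.Im.

Lemma cmeasurable_add f g : cmeasurable f -> cmeasurable g ->
  cmeasurable (fun x => f x + g x).
Proof.
move=> [f1 f2] [g1 g2]; split.
- have -> : (fun x => Re (f x + g x)) = (fun x => Re (f x) + Re (g x)).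
    by apply/funext => x; case: (f x) (g x) => [? ?] [? ?].
  exact: measurable_funD.
- have -> : (fun x => Im (f x + g x)) = (fun x => Im (f x) + Im (g x)).
    by apply/funext => x; case: (f x) (g x) => [? ?] [? ?].
  exact: measurable_funD.
Qed.

Lemma cmeasurable_mul f g : cmeasurable f -> cmeasurable g ->
  cmeasurable (fun x => f x * g x).
Proof.
move=> [f1 f2] [g1 g2]; split.
- under eq_fun do rewrite ReM.
  by apply: measurable_funB; exact: measurable_funM.
- under eq_fun do rewrite ImM.
  by apply: measurable_funD; exact: measurable_funM.
Qed.

Lemma cmeasurable_conj f : cmeasurable f -> cmeasurable (fun x => (f x)^*%C).
Proof.
move=> [f1 f2]; split.
- by have -> : (fun x => Re (f x)^*%C) = (fun x => Re (f x))
    by apply/funext => x; case: (f x).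
- have -> : (fun x => Im (f x)^*%C) = (fun x => - Im (f x)).
    by apply/funext => x; case: (f x).
  exact: measurable_funN.
Qed.

Lemma cmeasurable_real (h : plane R -> R) : measurable_fun setT h ->
  cmeasurable (fun x => (h x)%:C%C).
Proof. by move=> mh; split => //=; exact: measurable_cst. Qed.

Lemma measurable_cabs f : cmeasurable f -> measurable_fun setT (fun x => cabs (f x)).
Proof.
move=> [f1 f2]; under eq_fun do rewrite cabsE.
apply: (measurableT_comp (@measurable_sqrt R)).
by apply: measurable_funD; exact: measurable_funX.
Qed.

Lemma mxmeasurable_mul m n (A : plane R -> 'M[R[i]]_(m, 2))
    (W : plane R -> 'M[R[i]]_(2, n)) :
  mxmeasurable A -> mxmeasurable W -> mxmeasurable (fun x => A x *m W x).
Proof.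
move=> mA mW i j.
have -> : (fun x => (A x *m W x) i j) = (fun x => A x i 0 * W x 0 j + A x i 1 * W x 1 j).
  by apply/funext => x; rewrite mxE sum_ord2.
by apply: cmeasurable_add; exact: cmeasurable_mul.
Qed.

Lemma mxmeasurable_adjoint m n (A : plane R -> 'M[R[i]]_(m, n)) :
  mxmeasurable A -> mxmeasurable (fun x => (A x)^t*%sesqui).
Proof.
move=> mA i j.
have -> : (fun x => ((A x)^t*)%sesqui i j) = (fun x => (A x j i)^*%C).
  by apply/funext => x; rewrite !mxE.
exact: cmeasurable_conj.
Qed.

Lemma vnormE (z : vec2 R) : vnorm z = Num.sqrt (cabs (z 0 0) ^+ 2 + cabs (z 1 0) ^+ 2).
Proof. by rewrite /vnorm sum_ord2. Qed.

Lemma measurable_vnorm (psi : plane R -> vec2 R) : mxmeasurable psi ->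
  measurable_fun setT (fun x => vnorm (psi x)).
Proof.
move=> mpsi; under eq_fun do rewrite vnormE.
apply: (measurableT_comp (@measurable_sqrt R)).
by apply: measurable_funD; apply: measurable_funX; exact: measurable_cabs.
Qed.

Lemma cabs_le_vnorm (z : vec2 R) i : cabs (z i 0) <= vnorm z.
Proof.
rewrite vnormE -[leLHS]ger0_norm ?cabs_ge0// -sqrtr_sqr ler_wsqrtr//.
have := sqr_ge0 (cabs (z 0 0)); have := sqr_ge0 (cabs (z 1 0)).
case: i => -[|[|//]] lt2.
- by rewrite (_ : Ordinal lt2 = 0); [lra|exact: val_inj].
- by rewrite (_ : Ordinal lt2 = 1); [lra|exact: val_inj].
Qed.

End ComplexMeasurability.

(** * Integrability of psi and V psi *)

Section Bounds.
Variable R : realType.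
Local Notation mu2 := (lebesgue2 R).
Local Notation Re := complex.Re.
Local Notation Im := complex.Im.
Implicit Types (psi f g : plane R -> vec2 R) (V B : plane R -> mat2 R).

Lemma integrable_of_in_Lp (n : nat) f : in_Lp (n.+1%:R)%:E f ->
  mu2.-integrable setT (EFin \o (fun x => vnorm (f x) ^+ n.+1)).
Proof.
move=> [mf fLp]; have mv := measurable_vnorm mf.
apply/integrableP; split; first by apply/measurable_EFinP; exact: measurable_funX.
have /(poweR_lty n.+1%:R) := fLp.
rewrite powR_Lnorm ?pnatr_eq0//.
congr (_ < _)%E; apply: eq_integral => x _ /=.
by rewrite powR_mulrn// normrX.
Qed.

Lemma decay_le V (beta : R) : 2 < beta -> decay V beta ->
  exists2 C : R, 0 <= C &
    forall (x : plane R) i j, cabs (V x i j) <= C * (bracket x)^-1 ^+ 2.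
Proof.
move=> b2 [C HC]; exists `|C| => // x i j.
apply: (le_trans (HC x i j)).
apply: (@le_trans _ _ (`|C| * bracket x `^ (- beta))).
  by rewrite ler_wpM2r ?powR_ge0// ler_norm.
rewrite ler_wpM2l// exprVn.
rewrite -(powR_mulrn 2 (ltW (bracket_gt0 x))) -powRN.
by apply: ler_powR; [exact: bracket_ge1|rewrite lerN2 ltW].
Qed.

(** For 0 <= s <= 1, either t <= s^2, and the left side is at most s^4 <= s^3, or
    it is at most t^2. With s = <x>^-1 this bounds weighted L^2 functions; the
    next two inequalities serve for L^3 functions. *)
Lemma weight_young2 (t s : R) : 0 <= t -> 0 <= s -> s <= 1 ->
  s ^+ 2 * t <= t ^+ 2 + s ^+ 3.
Proof.
move=> t0 s0 s1; have [ts|st] := leP t (s ^+ 2).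
  apply: (@le_trans _ _ (s ^+ 3)); last by rewrite lerDr sqr_ge0.
  apply: (le_trans (ler_wpM2l (sqr_ge0 s) ts)).
  have -> : s ^+ 2 * s ^+ 2 = s * s ^+ 3 by ring.
  by rewrite ler_piMl// exprn_ge0.
by rewrite ler_wpDr ?exprn_ge0// [t ^+ 2]expr2 ler_wpM2r// ltW.
Qed.

Lemma weight_young3 (t s : R) : 0 <= t -> 0 <= s ->
  s ^+ 2 * t <= t ^+ 3 + s ^+ 3.
Proof.
move=> t0 s0; have [ts|st] := leP t s.
  by rewrite ler_wpDl ?exprn_ge0// [leRHS]exprSr ler_wpM2l// sqr_ge0.
rewrite ler_wpDr ?exprn_ge0// [leRHS]exprSr ler_wpM2r//.
by rewrite ler_pXn2r ?nnegrE// ltW.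
Qed.

Lemma weight_young3_sqr (t s : R) : 0 <= t -> 0 <= s -> s <= 1 ->
  s ^+ 2 * t ^+ 2 <= t ^+ 3 + s ^+ 3.
Proof.
move=> t0 s0 s1; apply: (@le_trans _ _ (s * t ^+ 2)).
  by rewrite ler_wpM2r ?sqr_ge0// expr2 ler_piMl.
have [ts|st] := leP t s.
  rewrite ler_wpDl ?exprn_ge0// [leRHS]exprS ler_wpM2l//.
  by rewrite ler_pXn2r ?nnegrE.
by rewrite ler_wpDr ?exprn_ge0// [leRHS]exprS ler_wpM2r ?sqr_ge0// ltW.
Qed.

Lemma bracket_inv_itv (x : plane R) : 0 <= (bracket x)^-1 <= 1.
Proof.
by rewrite invr_ge0 ltW ?bracket_gt0//= invf_le1 ?bracket_gt0// bracket_ge1.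
Qed.

Section Psi.
Variables (psi f g : plane R -> vec2 R).
Hypotheses (f2 : in_Lp 2%:E f) (g3 : in_Lp 3%:E g).
Hypothesis psiE : forall x, psi x = f x + g x.

Let dominating (x : plane R) : R :=
  vnorm (f x) ^+ 2 + vnorm (g x) ^+ 3 + (bracket x)^-1 ^+ 3.

Let integrable_dominating : mu2.-integrable setT (EFin \o dominating).
Proof.
apply: integrable_add; last exact: integrable_bracket_inv3.
by apply: integrable_add; exact: integrable_of_in_Lp.
Qed.

Lemma mxmeasurable_psi : mxmeasurable psi.
Proof.
move=> i j; have [mf _] := f2; have [mg _] := g3.
have -> : (fun x => psi x i j) = (fun x => f x i j + g x i j).
  by apply/funext => x; rewrite psiE mxE.
exact: cmeasurable_add.
Qed.

Lemma weighted_psi_le i x :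
  (bracket x)^-1 ^+ 2 * cabs (psi x i 0) <= 2 * dominating x.
Proof.
have /andP[s0 s1] := bracket_inv_itv x; set s := (bracket x)^-1 in s0 s1 *.
have v0 (z : vec2 R) : 0 <= vnorm z by exact: sqrtr_ge0.
rewrite psiE mxE.
apply: (le_trans (ler_wpM2l (sqr_ge0 s) (cabsD _ _))).
have H1 := weight_young2 (v0 (f x)) s0 s1.
have H2 := weight_young3 (v0 (g x)) s0.
have F : s ^+ 2 * cabs (f x i 0) <= s ^+ 2 * vnorm (f x).
  by rewrite ler_wpM2l ?sqr_ge0// cabs_le_vnorm.
have G : s ^+ 2 * cabs (g x i 0) <= s ^+ 2 * vnorm (g x).
  by rewrite ler_wpM2l ?sqr_ge0// cabs_le_vnorm.
have := exprn_ge0 2 (v0 (f x)); have := exprn_ge0 3 (v0 (g x)).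
by rewrite /dominating -/s; lra.
Qed.

(** Here the weight is needed for the L^3 part only: its square is not integrable
    by itself, but is against <x>^-2. *)
Lemma weighted_psi_sqr_le i x :
  (bracket x)^-1 ^+ 2 * cabs (psi x i 0) ^+ 2 <= 2 * dominating x.
Proof.
have /andP[s0 s1] := bracket_inv_itv x; set s := (bracket x)^-1 in s0 s1 *.
have v0 (z : vec2 R) : 0 <= vnorm z by exact: sqrtr_ge0.
have H : cabs (psi x i 0) ^+ 2 <= 2 * vnorm (f x) ^+ 2 + 2 * vnorm (g x) ^+ 2.
  have h : cabs (psi x i 0) <= vnorm (f x) + vnorm (g x).
    by rewrite psiE mxE (le_trans (cabsD _ _))// lerD// cabs_le_vnorm.
  apply: (@le_trans _ _ ((vnorm (f x) + vnorm (g x)) ^+ 2)).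
    by rewrite ler_pXn2r ?nnegrE ?cabs_ge0 ?addr_ge0.
  by have := sqr_ge0 (vnorm (f x) - vnorm (g x)); lra.
apply: (le_trans (ler_wpM2l (sqr_ge0 s) H)).
have H3 := weight_young3_sqr (v0 (g x)) s0 s1.
have H4 : s ^+ 2 * vnorm (f x) ^+ 2 <= vnorm (f x) ^+ 2.
  by rewrite ler_piMl ?sqr_ge0// expr_le1.
by have := exprn_ge0 3 s0; rewrite /dominating -/s; nra.
Qed.

Lemma integrable_weighted_psi i : mu2.-integrable setT
    (EFin \o (fun x => (bracket x)^-1 ^+ 2 * Re (psi x i 0))) /\
  mu2.-integrable setT
    (EFin \o (fun x => (bracket x)^-1 ^+ 2 * Im (psi x i 0))).
Proof.
have [m1 m2] := mxmeasurable_psi i 0.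
have mb : measurable_fun setT (fun x : plane R => (bracket x)^-1 ^+ 2).
  apply: measurable_funX.
  exact: (measurableT_comp (@measurable_inv R) (@measurable_bracket R)).
have H (h : R[i] -> R) : measurable_fun setT (fun x => h (psi x i 0)) ->
    (forall z, `|h z| <= cabs z) ->
    mu2.-integrable setT (EFin \o (fun x => (bracket x)^-1 ^+ 2 * h (psi x i 0))).
  move=> mh hc; apply: (integrable_dominated (g := fun x => 2 * dominating x)).
  - exact: measurable_funM.
  - move=> x; apply: le_trans (weighted_psi_le i x).
    by rewrite normrM (ger0_norm (sqr_ge0 _)) ler_wpM2l ?sqr_ge0.
  - exact: integrable_mulc.
by split; apply: H => // z; [exact: Re_le_cabs|exact: Im_le_cabs].
Qed.

Section Potential.
Variables (V : plane R -> mat2 R) (C : R).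
Hypothesis C0 : 0 <= C.
Hypothesis VC : forall x i j, cabs (V x i j) <= C * (bracket x)^-1 ^+ 2.
Hypothesis mV : mxmeasurable V.

Lemma integrable_V_psi i :
  mu2.-integrable setT (EFin \o (fun x => Re ((V x *m psi x) i 0))) /\
  mu2.-integrable setT (EFin \o (fun x => Im ((V x *m psi x) i 0))).
Proof.
have [m1 m2] := mxmeasurable_mul mV mxmeasurable_psi i 0.
have H (h : R[i] -> R) : measurable_fun setT (fun x => h ((V x *m psi x) i 0)) ->
    (forall z, `|h z| <= cabs z) ->
    mu2.-integrable setT (EFin \o (fun x => h ((V x *m psi x) i 0))).
  move=> mh hc; apply: (integrable_dominated (g := fun x => (4 * C) * dominating x)) => //.
    move=> x; apply: (le_trans (hc _)); apply: (le_trans (cabs_mulmx_le _ _ _ _)).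
    have K j : cabs (V x i j) * cabs (psi x j 0) <= C * (2 * dominating x).
      apply: (@le_trans _ _ (C * (bracket x)^-1 ^+ 2 * cabs (psi x j 0))).
        by rewrite ler_wpM2r ?cabs_ge0.
      by rewrite -mulrA ler_wpM2l// weighted_psi_le.
    by have := K 0; have := K 1; lra.
  exact: integrable_mulc.
by split; apply: H => // z; [exact: Re_le_cabs|exact: Im_le_cabs].
Qed.

End Potential.
End Psi.
End Bounds.

(** * The Dirac equation in real components and the norm of phi *)

Section Eigenvalues.
Variable R : realType.
Variables (V B : plane R -> mat2 R) (zeta : plane R -> 'rV[R]_2).
Hypothesis VB : diagonalizes V B zeta.

(** Measurability and decay of the eigenvalues come from this formula, in which
    only V and B occur. *)
Lemma eigenvalue_entry x j :
  (zeta x 0 j)%:C%C = (B x *m V x *m (B x)^t*%sesqui) j j.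
Proof.
have [/unitarymxP BB ->] := VB x.
rewrite !mulmxA BB mul1mx -mulmxA BB mulmx1.
by rewrite !mxE eqxx mulr1n.
Qed.

Lemma measurable_eigenvalue j : mxmeasurable V -> mxmeasurable B ->
  measurable_fun setT (fun x => zeta x 0 j).
Proof.
move=> mV mB.
have [m _] := mxmeasurable_mul (mxmeasurable_mul mB mV) (mxmeasurable_adjoint mB) j j.
move: m; congr measurable_fun; apply/funext => x.
by rewrite -eigenvalue_entry.
Qed.

Lemma eigenvalue_le (C : R) x j : 0 <= C ->
  (forall i k, cabs (V x i k) <= C) -> `|zeta x 0 j| <= 4 * C.
Proof.
move=> C0 VC; have Bu := (VB x).1.
have -> : `|zeta x 0 j| = cabs ((zeta x 0 j)%:C%C).
  by rewrite cabsE /= expr0n addr0 sqrtr_sqr.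
rewrite eigenvalue_entry; apply: (le_trans (cabs_mulmx_le _ _ _ _)).
have Bs k : cabs ((B x)^t*%sesqui k j) <= 1.
  rewrite !mxE; have -> : cabs (Num.conj (B x j k)) = cabs (B x j k) by exact: cabs_conj.
  exact: unitarymx_entry_le.
have BV k : cabs ((B x *m V x) j k) <= 2 * C.
  apply: (le_trans (cabs_mulmx_le _ _ _ _)).
  have H l : cabs (B x j l) * cabs (V x l k) <= C.
    rewrite -[leRHS]mul1r; apply: ler_pM; rewrite ?cabs_ge0//.
    exact: unitarymx_entry_le.
  by have := H 0; have := H 1; lra.
have H k : cabs ((B x *m V x) j k) * cabs ((B x)^t*%sesqui k j) <= 2 * C.
  by rewrite -[leRHS]mulr1; apply: ler_pM; rewrite ?cabs_ge0.
by have := H 0; have := H 1; lra.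
Qed.

End Eigenvalues.

Section WeakEquations.
Variable R : realType.
Local Notation mu2 := (lebesgue2 R).
Local Notation Re := complex.Re.
Local Notation Im := complex.Im.

Lemma test_function_real (chi : R * R -> R) : real_test chi ->
  test_function (fun x => (chi x)%:C%C).
Proof.
move=> [sm cpt]; split => //=.
  exact: elementary_smooth (elementary_cst 0).
suff -> : [set x : R * R | (chi x)%:C%C != 0]%classic = [set x | chi x != 0]%classic by [].
by apply/seteqP; split => x /=; rewrite eq_complex /= eqxx andbT.
Qed.

Lemma cpartial_real k (chi : R * R -> R) x :
  cpartial k (fun x => (chi x)%:C%C) x = (partial k chi x)%:C%C.
Proof.
rewrite /cpartial /=; congr Complex.
by have [p1 p2] := has_grad_partial (@has_grad_cst R 0); case: k; rewrite ?p1 ?p2.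
Qed.

(** Real test functions separate the Dirac equation into four real equations. The
    two that contain a given component of psi form a Cauchy-Riemann system for
    its real and imaginary parts, with a component of V psi as the data. *)
Lemma H_null_components V psi : H_null V psi -> forall chi : R * R -> R,
  real_test chi ->
  [/\ \int[mu2]_x (- partial false chi x * Im (psi x 1 0) +
        partial true chi x * Re (psi x 1 0) + chi x * Re ((V x *m psi x) 0 0)) = 0,
      \int[mu2]_x (partial false chi x * Re (psi x 1 0) +
        partial true chi x * Im (psi x 1 0) + chi x * Im ((V x *m psi x) 0 0)) = 0,
      \int[mu2]_x (- partial false chi x * Im (psi x 0 0) -
        partial true chi x * Re (psi x 0 0) + chi x * Re ((V x *m psi x) 1 0)) = 0 &
      \int[mu2]_x (partial false chi x * Re (psi x 0 0) -
        partial true chi x * Im (psi x 0 0) + chi x * Im ((V x *m psi x) 1 0)) = 0].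
Proof.
move=> Hpsi chi /[dup] tchi /test_function_real/Hpsi /matrixP H.
have H0 := H 0 0; have H1 := H 1 0; rewrite !mxE in H0 H1.
move: H0 H1; rewrite /cintegral => /eqP; rewrite eq_complex /= => /andP[/eqP A1 /eqP A2].
move=> /eqP; rewrite eq_complex /= => /andP[/eqP A3 /eqP A4].
have iE : ('i)%R = 'i%C :> R[i] by [].
have S x := dirac_symbol_entries (cpartial false (fun x => (chi x)%:C%C) x)
  (cpartial true (fun x => (chi x)%:C%C) x) (chi x)%:C%C (psi x) (V x *m psi x).
split; [apply: etrans A1|apply: etrans A2|apply: etrans A3|apply: etrans A4];
  apply: eq_Rintegral => x _; have [E0 E1] := S x; rewrite ?E0 ?E1 !cpartial_real ?iE.
- by case: (psi x 1 0) ((V x *m psi x) 0 0) => u v [c d] /=; ring.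
- by case: (psi x 1 0) ((V x *m psi x) 0 0) => u v [c d] /=; ring.
- by case: (psi x 0 0) ((V x *m psi x) 1 0) => u v [c d] /=; ring.
- by case: (psi x 0 0) ((V x *m psi x) 1 0) => u v [c d] /=; ring.
Qed.

End WeakEquations.

Section L2.
Variable R : realType.
Local Notation mu2 := (lebesgue2 R).
Variables (V B : plane R -> mat2 R) (zeta : plane R -> 'rV[R]_2) (C : R).
Hypothesis VB : diagonalizes V B zeta.
Hypotheses (mV : mxmeasurable V) (mB : mxmeasurable B).
Hypothesis C0 : 0 <= C.
Hypothesis VC : forall x i j, cabs (V x i j) <= C * (bracket x)^-1 ^+ 2.
Variables (psi f g : plane R -> vec2 R).
Hypotheses (f2 : in_Lp 2%:E f) (g3 : in_Lp 3%:E g).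
Hypothesis psiE : forall x, psi x = f x + g x.

Let phi x := Ufactor zeta x *m vfactor B zeta x *m psi x.

Let phi_entry x i : phi x i 0 =
  (sign0 (zeta x 0 i) * Num.sqrt `|zeta x 0 i|)%:C%C * (B x *m psi x) i 0.
Proof.
rewrite /phi /Ufactor /vfactor -!mulmxA !mul_diag_mx !mxE mulrA.
by rewrite -rmorphM.
Qed.

Let mphi : mxmeasurable phi.
Proof.
move=> i j; rewrite [j]ord1.
have -> : (fun x => phi x i 0) = (fun x =>
    (sign0 (zeta x 0 i) * Num.sqrt `|zeta x 0 i|)%:C%C * (B x *m psi x) i 0).
  by apply/funext => x; exact: phi_entry.
have mz := measurable_eigenvalue VB i mV mB.
apply: cmeasurable_mul.
  apply: cmeasurable_real; apply: measurable_funM.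
    rewrite /sign0; apply: measurable_fun_ifT => //.
    exact: measurable_fun_ltr.
  by apply: (measurableT_comp (@measurable_sqrt R)); exact: measurableT_comp.
exact: (mxmeasurable_mul mB (mxmeasurable_psi f2 g3 psiE)).
Qed.

Let dom (x : plane R) : R :=
  vnorm (f x) ^+ 2 + vnorm (g x) ^+ 3 + (bracket x)^-1 ^+ 3.

Let phi_sqr_le x i : cabs (phi x i 0) ^+ 2 <= (32 * C) * dom x.
Proof.
have W0 : 0 <= (bracket x)^-1 ^+ 2 by exact: sqr_ge0.
have zC : `|zeta x 0 i| <= 4 * (C * (bracket x)^-1 ^+ 2).
  by apply: (eigenvalue_le VB) => //; rewrite mulr_ge0.
have E : cabs (phi x i 0) ^+ 2 = `|zeta x 0 i| * cabs ((B x *m psi x) i 0) ^+ 2.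
  rewrite phi_entry cabsM exprMn; congr (_ * _).
  rewrite cabs_sqr /= expr0n addr0 exprMn sqr_sqrtr//.
  by rewrite [sign0 _ ^+ 2]expr2 sign0_sqr mul1r.
have Bpsi : cabs ((B x *m psi x) i 0) <= cabs (psi x 0 0) + cabs (psi x 1 0).
  apply: (le_trans (cabs_mulmx_le _ _ _ _)).
  have H k : cabs (B x i k) * cabs (psi x k 0) <= cabs (psi x k 0).
    by rewrite ler_piMl ?cabs_ge0// unitarymx_entry_le//; have [] := VB x.
  exact: lerD.
have Bpsi2 : cabs ((B x *m psi x) i 0) ^+ 2 <=
    2 * cabs (psi x 0 0) ^+ 2 + 2 * cabs (psi x 1 0) ^+ 2.
  apply: (@le_trans _ _ ((cabs (psi x 0 0) + cabs (psi x 1 0)) ^+ 2)).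
    by rewrite ler_pXn2r ?nnegrE ?cabs_ge0 ?addr_ge0 ?cabs_ge0.
  by have := sqr_ge0 (cabs (psi x 0 0) - cabs (psi x 1 0)); lra.
rewrite E; apply: (le_trans (ler_pM _ _ zC Bpsi2)) => //; first exact: sqr_ge0.
have := ler_wpM2l C0 (weighted_psi_sqr_le psiE 0 x).
have := ler_wpM2l C0 (weighted_psi_sqr_le psiE 1 x).
rewrite -/(dom x); lra.
Qed.

(** Pointwise |phi|^2 is at most |zeta| |psi|^2 up to a constant, and the
    eigenvalues decay like <x>^-2. *)
Lemma in_L2_phi : in_Lp 2%:E phi.
Proof.
split; first exact: mphi.
have i2 : mu2.-integrable setT (EFin \o (fun x => vnorm (phi x) ^+ 2)).
  apply: (integrable_dominated (g := fun x => (64 * C) * dom x)).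
  - by apply: measurable_funX; exact: measurable_vnorm.
  - move=> x; rewrite ger0_norm ?sqr_ge0// vnormE sqr_sqrtr ?addr_ge0 ?sqr_ge0//.
    by have := phi_sqr_le x 0; have := phi_sqr_le x 1; lra.
  - apply: integrable_mulc; apply: integrable_add; last exact: integrable_bracket_inv3.
    by apply: integrable_add; exact: integrable_of_in_Lp.
apply: (@lty_poweRy _ _ 2) => //.
rewrite powR_Lnorm//.
have [_] := integrableP _ _ _ i2; congr (_ < _)%E.
by apply: eq_integral => x _ /=; rewrite powR_mulrn// normrX.
Qed.

End L2.

(** * The representation of psi by the singular kernel *)

Section AlmostEverywhere.
Variables (d : measure_display) (T : measurableType d) (R : realType).
Variable mu : {measure set T -> \bar R}.
Implicit Types P Q : T -> Prop.

Lemma ae_imp P Q : (forall x, P x -> Q x) ->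
  {ae mu, forall x, P x} -> {ae mu, forall x, Q x}.
Proof. by move=> PQ; apply: filterS. Qed.

Lemma ae_and P Q : {ae mu, forall x, P x} -> {ae mu, forall x, Q x} ->
  {ae mu, forall x, P x /\ Q x}.
Proof. exact: filterI. Qed.

End AlmostEverywhere.

(** The positive and negative parts are exchanged. *)
Lemma RintegralN d (T : measurableType d) (R : realType)
    (mu : {measure set T -> \bar R}) (f : T -> R) :
  \int[mu]_x (- f x) = - \int[mu]_x f x.
Proof.
rewrite /Rintegral integralE [in RHS]integralE.
have -> : (fun x => (- f x)%:E)^\+%E = (fun x => (f x)%:E)^\-%E.
  by rewrite -(funeposN (EFin \o f)).
have -> : (fun x => (- f x)%:E)^\-%E = (fun x => (f x)%:E)^\+%E.
  by rewrite -(funenegN (EFin \o f)).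
move: (integral _ _ _) (integral _ _ _) => [u| |] [v| |] /=; rewrite ?oppr0//.
by rewrite opprB.
Qed.

Lemma integrable_opp d (T : measurableType d) (R : realType)
    (mu : {measure set T -> \bar R}) (f : T -> R) :
  mu.-integrable setT (EFin \o f) ->
  mu.-integrable setT (EFin \o (fun x => - f x)).
Proof.
move=> /(integrable_mulc (-1)); congr (is_true (_.-integrable _ _)).
by apply/funext => x /=; rewrite mulN1r.
Qed.

Section Representation.
Variable R : realType.
Local Notation mu2 := (lebesgue2 R).
Local Notation Re := complex.Re.
Local Notation Im := complex.Im.
Variables (V : plane R -> mat2 R) (psi : plane R -> vec2 R).
Hypothesis mpsi : mxmeasurable psi.
Hypothesis ipsi : forall i, mu2.-integrable setT
    (EFin \o (fun x => (bracket x)^-1 ^+ 2 * Re (psi x i 0))) /\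
  mu2.-integrable setT
    (EFin \o (fun x => (bracket x)^-1 ^+ 2 * Im (psi x i 0))).
Hypothesis iV : forall i,
  mu2.-integrable setT (EFin \o (fun x => Re ((V x *m psi x) i 0))) /\
  mu2.-integrable setT (EFin \o (fun x => Im ((V x *m psi x) i 0))).
Hypothesis Hpsi : H_null V psi.

Let q i y : R[i] := (V y *m psi y) i 0.

Let integrable_weight_opp (h : plane R -> R) :
  mu2.-integrable setT (EFin \o (fun x => (bracket x)^-1 ^+ 2 * h x)) ->
  mu2.-integrable setT (EFin \o (fun x => (bracket x)^-1 ^+ 2 * - h x)).
Proof.
move=> /integrable_opp; congr (is_true (_.-integrable _ _)).
by apply/funext => x /=; rewrite mulrN.
Qed.

Let opp_eq0 (F G : plane R -> R) : \int[mu2]_x F x = 0 ->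
  (forall x, G x = - F x) -> \int[mu2]_x G x = 0.
Proof.
move=> F0 GF; rewrite (_ : G = fun x => - F x); last exact/funext.
by rewrite RintegralN F0 oppr0.
Qed.

(** The components of psi = - G_{0,0} V psi. Each of the four real functions Re and
    Im of psi_1, psi_2 takes the place of p in weak_gradient_representation, with
    the other part of the same component, up to sign, as its conjugate r. *)
Lemma ae_representation_entries : {ae mu2, forall x,
  [/\ Re (psi x 0 0) + \int[mu2]_y (grad_log true 0 x y * Re (q 1 y)) -
        \int[mu2]_y (grad_log false 0 x y * Im (q 1 y)) = 0,
      Im (psi x 0 0) + \int[mu2]_y (grad_log true 0 x y * Im (q 1 y)) -
        \int[mu2]_y (grad_log false 0 x y * - Re (q 1 y)) = 0,
      Re (psi x 1 0) + \int[mu2]_y (grad_log true 0 x y * - Re (q 0 y)) -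
        \int[mu2]_y (grad_log false 0 x y * Im (q 0 y)) = 0 &
      Im (psi x 1 0) + \int[mu2]_y (grad_log true 0 x y * - Im (q 0 y)) -
        \int[mu2]_y (grad_log false 0 x y * - Re (q 0 y)) = 0]}.
Proof.
have [mr0 mi0] := mpsi 0 0; have [mr1 mi1] := mpsi 1 0.
have [ir0 ii0] := ipsi 0; have [ir1 ii1] := ipsi 1.
have [qr0 qi0] := iV 0; have [qr1 qi1] := iV 1.
have W := H_null_components Hpsi.
have R1 := @weak_gradient_representation R (fun x => Re (psi x 0 0)) (fun x => Im (psi x 0 0))
  (fun y => Re (q 1 y)) (fun y => Im (q 1 y)) mr0 mi0 ir0 ii0 qr1 qi1.
have R2 := @weak_gradient_representation R (fun x => Im (psi x 0 0)) (fun x => - Re (psi x 0 0))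
  (fun y => Im (q 1 y)) (fun y => - Re (q 1 y)) mi0 (measurable_funN mr0) ii0
  (integrable_weight_opp ir0) qi1 (integrable_opp qr1).
have R3 := @weak_gradient_representation R (fun x => Re (psi x 1 0)) (fun x => - Im (psi x 1 0))
  (fun y => - Re (q 0 y)) (fun y => Im (q 0 y)) mr1 (measurable_funN mi1) ir1
  (integrable_weight_opp ii1) (integrable_opp qr0) qi0.
have R4 := @weak_gradient_representation R (fun x => Im (psi x 1 0)) (fun x => Re (psi x 1 0))
  (fun y => - Im (q 0 y)) (fun y => - Re (q 0 y)) mi1 mr1 ii1 ir1
  (integrable_opp qi0) (integrable_opp qr0).
have same_eq0 (F G : plane R -> R) : \int[mu2]_x F x = 0 ->
    (forall x, G x = F x) -> \int[mu2]_x G x = 0.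
  by move=> F0 GF; rewrite (_ : G = F)//; exact/funext.
have A1 : {ae mu2, forall x, Re (psi x 0 0) +
    \int[mu2]_y (grad_log true 0 x y * Re (q 1 y)) -
    \int[mu2]_y (grad_log false 0 x y * Im (q 1 y)) = 0}.
  apply: R1 => chi /W[W1 W2 W3 W4].
  - by apply: opp_eq0 W3 _ => x; rewrite /q; ring.
  - by apply: same_eq0 W4 _ => x; rewrite /q; ring.
have A2 : {ae mu2, forall x, Im (psi x 0 0) +
    \int[mu2]_y (grad_log true 0 x y * Im (q 1 y)) -
    \int[mu2]_y (grad_log false 0 x y * - Re (q 1 y)) = 0}.
  apply: R2 => chi /W[W1 W2 W3 W4].
  - by apply: opp_eq0 W4 _ => x; rewrite /q; ring.
  - by apply: opp_eq0 W3 _ => x; rewrite /q; ring.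
have A3 : {ae mu2, forall x, Re (psi x 1 0) +
    \int[mu2]_y (grad_log true 0 x y * - Re (q 0 y)) -
    \int[mu2]_y (grad_log false 0 x y * Im (q 0 y)) = 0}.
  apply: R3 => chi /W[W1 W2 W3 W4].
  - by apply: same_eq0 W1 _ => x; rewrite /q; ring.
  - by apply: same_eq0 W2 _ => x; rewrite /q; ring.
have A4 : {ae mu2, forall x, Im (psi x 1 0) +
    \int[mu2]_y (grad_log true 0 x y * - Im (q 0 y)) -
    \int[mu2]_y (grad_log false 0 x y * - Re (q 0 y)) = 0}.
  apply: R4 => chi /W[W1 W2 W3 W4].
  - by apply: same_eq0 W2 _ => x; rewrite /q; ring.
  - by apply: opp_eq0 W1 _ => x; rewrite /q; ring.
by have := ae_and (ae_and A1 A2) (ae_and A3 A4); apply: ae_imp => x [[? ?] [? ?]].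
Qed.

End Representation.

(** * The equation T phi = 0 *)

Section Resonance.
Variable R : realType.
Local Notation mu2 := (lebesgue2 R).
Local Notation Re := complex.Re.
Local Notation Im := complex.Im.
Variables (V B : plane R -> mat2 R) (zeta : plane R -> 'rV[R]_2).
Hypothesis VB : diagonalizes V B zeta.
Variable psi : plane R -> vec2 R.

Let q i y : R[i] := (V y *m psi y) i 0.
Let phi y := Ufactor zeta y *m vfactor B zeta y *m psi y.

Let T_integrand_entries x y :
  T_integrand B zeta phi x y 0 0 =
    (grad_log true 0 x y +i* grad_log false 0 x y)%C * q 1 y /\
  T_integrand B zeta phi x y 1 0 =
    (- grad_log true 0 x y +i* grad_log false 0 x y)%C * q 0 y.
Proof. by rewrite /T_integrand /phi (V_factorization _ _ VB); exact: G00_entries. Qed.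

(** Every real component of the integrand in T phi has this form, with a and b
    components of V psi up to sign. *)
Let row (a b : plane R -> R) x y := grad_log true 0 x y * a y - grad_log false 0 x y * b y.

Let good_row (a b : plane R -> R) x :=
  mu2.-integrable setT (EFin \o row a b x) /\
  \int[mu2]_y row a b x y =
    \int[mu2]_y (grad_log true 0 x y * a y) - \int[mu2]_y (grad_log false 0 x y * b y).

Let ae_good_row a b : mu2.-integrable setT (EFin \o a) ->
  mu2.-integrable setT (EFin \o b) -> {ae mu2, forall x, good_row a b x}.
Proof.
move=> ia ib.
have := ae_and (ae_integrable_grad_log true 0 ia) (ae_integrable_grad_log false 0 ib).
apply: ae_imp => x [Ka Kb]; split; last by rewrite /row RintegralB.
exact: (integrableB measurableT Ka Kb).
Qed.

Hypothesis iV : forall i,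
  mu2.-integrable setT (EFin \o (fun x => Re (q i x))) /\
  mu2.-integrable setT (EFin \o (fun x => Im (q i x))).
Hypothesis repr : {ae mu2, forall x,
  [/\ Re (psi x 0 0) + \int[mu2]_y (grad_log true 0 x y * Re (q 1 y)) -
        \int[mu2]_y (grad_log false 0 x y * Im (q 1 y)) = 0,
      Im (psi x 0 0) + \int[mu2]_y (grad_log true 0 x y * Im (q 1 y)) -
        \int[mu2]_y (grad_log false 0 x y * - Re (q 1 y)) = 0,
      Re (psi x 1 0) + \int[mu2]_y (grad_log true 0 x y * - Re (q 0 y)) -
        \int[mu2]_y (grad_log false 0 x y * Im (q 0 y)) = 0 &
      Im (psi x 1 0) + \int[mu2]_y (grad_log true 0 x y * - Im (q 0 y)) -
        \int[mu2]_y (grad_log false 0 x y * - Re (q 0 y)) = 0]}.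

(** Since U is an involution and v^* U v = V, one has U phi = v psi and
    v^* phi = V psi; hence T phi = v (psi + G_{0,0} V psi), and the bracket
    vanishes. *)
Lemma ae_kernel_of_T : {ae mu2, forall x,
  vintegrable (T_integrand B zeta phi x) /\ T_op B zeta phi x = 0}.
Proof.
have [r0 i0] := iV 0; have [r1 i1] := iV 1.
have g1 := ae_good_row r1 i1.
have g2 := ae_good_row i1 (integrable_opp r1).
have g3 := ae_good_row (integrable_opp r0) i0.
have g4 := ae_good_row (integrable_opp i0) (integrable_opp r0).
have := ae_and repr (ae_and (ae_and g1 g2) (ae_and g3 g4)).
apply: ae_imp => x [[R1 R2 R3 R4] [[[G1 E1] [G2 E2]] [[G3 E3] [G4 E4]]]].
have TE1 : (fun y => Re (T_integrand B zeta phi x y 0 0)) =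
    row (fun y => Re (q 1 y)) (fun y => Im (q 1 y)) x.
  by apply/funext => y; rewrite (T_integrand_entries x y).1 /row; case: (q 1 y).
have TE2 : (fun y => Im (T_integrand B zeta phi x y 0 0)) =
    row (fun y => Im (q 1 y)) (fun y => - Re (q 1 y)) x.
  apply/funext => y; rewrite (T_integrand_entries x y).1 /row; case: (q 1 y) => u v /=.
  by rewrite mulrN opprK.
have TE3 : (fun y => Re (T_integrand B zeta phi x y 1 0)) =
    row (fun y => - Re (q 0 y)) (fun y => Im (q 0 y)) x.
  apply/funext => y; rewrite (T_integrand_entries x y).2 /row; case: (q 0 y) => u v /=.
  by rewrite mulrN mulNr.
have TE4 : (fun y => Im (T_integrand B zeta phi x y 1 0)) =
    row (fun y => - Im (q 0 y)) (fun y => - Re (q 0 y)) x.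
  apply/funext => y; rewrite (T_integrand_entries x y).2 /row; case: (q 0 y) => u v /=.
  by rewrite !mulrN opprK mulNr.
have ord2 (i : 'I_2) : i = 0 \/ i = 1.
  by case: i => [[|[|//]]] ?; [left|right]; exact: val_inj.
split.
  move=> i; split; have [->|->] := ord2 i.
  - by move: G1; rewrite -TE1.
  - by move: G3; rewrite -TE3.
  - by move: G2; rewrite -TE2.
  - by move: G4; rewrite -TE4.
have psi0 : psi x + vintegral (T_integrand B zeta phi x) = 0.
  apply/colP => i; rewrite !mxE /cintegral; have [->|->] := ord2 i.
  - move: E1 E2; rewrite -TE1 -TE2 => E1 E2.
    apply/eqP; rewrite eq_complex; apply/andP; split; apply/eqP.
      apply: etrans R1; rewrite -addrA -E1; by case: (psi x 0 0).
    by apply: etrans R2; rewrite -addrA -E2; case: (psi x 0 0).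
  - move: E3 E4; rewrite -TE3 -TE4 => E3 E4.
    apply/eqP; rewrite eq_complex; apply/andP; split; apply/eqP.
      by apply: etrans R3; rewrite -addrA -E3; case: (psi x 1 0).
    by apply: etrans R4; rewrite -addrA -E4; case: (psi x 1 0).
have -> : T_op B zeta phi x = vfactor B zeta x *m (psi x + vintegral (T_integrand B zeta phi x)).
  rewrite mulmxDr /T_op; congr (_ + _).
  by rewrite /phi -!mulmxA UfactorK.
by rewrite psi0 mulmx0.
Qed.

End Resonance.

Theorem lemma7p4 (R : realType) (V B : plane R -> mat2 R)
    (zeta : plane R -> 'rV[R]_2) (beta : R) (psi : plane R -> vec2 R)
    (V_measurable : mxmeasurable V)
    (V_selfadjoint : forall x, V x \is hermsymmx)
    (beta_gt2 : 2 < beta)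
    (V_decay : decay V beta)
    (B_measurable : mxmeasurable B)
    (V_diag : diagonalizes V B zeta)
    (psi_space : in_L2_plus_Lp_gt2 psi)
    (H_psi : H_null V psi) :
  S1L2 B zeta (fun x => Ufactor zeta x *m vfactor B zeta x *m psi x).
Proof.
have [f [g [f2 gp psiE]]] := psi_space.
(* Any finite exponent above 2 gives integrability of <x>^-2 |g| and of
   <x>^-2 |g|^2; the exponent 3 keeps all powers integral. *)
have g3 : in_Lp 3%:E g by apply: gp; rewrite lte_fin; lra.
have [C C0 VC] := decay_le beta_gt2 V_decay.
have iV := integrable_V_psi f2 g3 psiE C0 VC V_measurable.
have rep := ae_representation_entries (mxmeasurable_psi f2 g3 psiE)
  (integrable_weighted_psi f2 g3 psiE) iV H_psi.
have K := ae_kernel_of_T V_diag iV rep.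
split; first exact: (in_L2_phi V_diag V_measurable B_measurable C0 VC f2 g3 psiE).
- by move: K; apply: ae_imp => x [].
- by move: K; apply: ae_imp => x [].
Qed.
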